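(* For any constant $\alpha\in(0,1/10)$, there exist constants $C\ge1$, $\delta\in(0,1)$ such that any incidence sketch of $N$ measurements that computes an $o(n^{\frac23(1-\alpha)})$-spanner with probability $\ge1-\delta$ on any $w\in\mathbb{R}_{\ge0}^{\binom n2}$ with $\frac{w_{\max}}{w_{\min}}\le C$ must satisfy $N\ge n^{1+\alpha-o(1)}$.
   Context: Graphs are on a fixed vertex set $V$ with $|V|=n$; a weighted graph is identified with its weight vector $w\in\mathbb{R}_{\ge 0}^{\binom{n}{2}}$ indexed by vertex pairs, where $w_e=0$ means no edge. A linear sketch of $N$ measurements consists of a (random) sketching matrix $\Phi\in\mathbb{R}^{N\times\binom n2}$ and a (randomized) recovery algorithm that receives only $\Phi w$. An incidence sketch is a linear sketch in which each row of $\Phi$ is supported on edge slots incident on a single vertex. $w_{\max}$, $w_{\min}$ denote the largest and smallest nonzero edge weights. The length of a path is its total edge weight and $d_G(u,v)$ is the shortest path length; for $t\ge1$, $H=(V,F,w')$ with $F\subseteq E$ is a $t$-spanner of $G=(V,E,w)$ if $d_G(u,v)\le d_H(u,v)\le t\,d_G(u,v)$ for all $u,v$. *)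

(* Defs.v *)
From HB Require Import structures.
From mathcomp Require Import all_boot all_order all_algebra.
From mathcomp Require Import all_classical all_reals all_analysis.

Set Implicit Arguments.
Unset Strict Implicit.
Unset Printing Implicit Defensive.

Import Order.TTheory GRing.Theory Num.Theory.
Import numFieldNormedType.Exports.

Local Open Scope ring_scope.

(* The edge slots: unordered pairs of distinct vertices of V = 'I_n. *)
Definition vpair (n : nat) := {e : {set 'I_n} | #|e| == 2}.

Section Graphs.
Variables (R : realType) (n : nat).
Implicit Types (w h : vpair n -> R) (u v : 'I_n) (p : seq 'I_n).

Definition nonneg w : Prop := forall e, 0 <= w e.

Definition is_edge w (e : vpair n) : bool := w e != 0.

(* The value at u = v is a dummy: [set u; u] is not a vpair. *)
Definition weight w u v : R :=
  if insub [set u; v]%SET is Some e then w e else 0.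

Definition adj w : rel 'I_n := fun u v => weight w u v != 0.

Definition path_length w u p : R := \sum_(x <- pairmap (weight w) u p) x.

(* u :: p is the vertex sequence of a path from u to v. *)
Definition is_path w u v p : bool :=
  [&& path (adj w) u p, uniq (u :: p) & last u p == v].

(* The distance is +oo when v is not reachable from u. *)
Definition dist w u v : \bar R :=
  ereal_inf [set (path_length w u p)%:E | p in [set p | is_path w u v p]]%classic.

(* h is the weight vector w' of H = (V, F, w'), with F its set of nonzero
   slots. *)
Definition spanner (t : R) w h : Prop :=
  [/\ nonneg h,
      forall e, is_edge h e -> is_edge w e
    & forall u v, (dist w u v <= dist h u v)%E /\
                  (dist h u v <= t%:E * dist w u v)%E].

Definition wmax w : R := \big[Num.max/0]_e w e.
Definition wmin w : R := \big[Num.min/wmax w]_(e | is_edge w e) w e.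

(* The ratio is only meaningful for a graph with at least one edge; the edgeless
   graph is not an admissible input. *)
Definition ratio_le (C : R) w : Prop :=
  (exists e, is_edge w e) /\ wmax w / wmin w <= C.

End Graphs.

(* A single sample omega, drawn independently of the input, carries the
   randomness of both the matrix and the recovery algorithm, so that the
   algorithm may know the sampled matrix; it accesses w only through the tuple
   of measurements.  Recovery is required to be jointly (Borel) measurable:
   inputs range over a continuum, and averaging the success probability over
   them needs Fubini. *)
Record linear_sketch (R : realType) (n N : nat) := LinearSketch {
  sk_disp : measure_display;
  sk_space : measurableType sk_disp;
  sk_prob : probability sk_space R;
  sk_mx : sk_space -> 'I_N -> vpair n -> R;
  sk_recover : sk_space * N.-tuple R -> vpair n -> R;
  sk_mx_measurable : forall i e,
    measurable_fun [set: sk_space]%classic (fun omega => sk_mx omega i e);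
  sk_recover_measurable : forall e,
    measurable_fun [set: sk_space * N.-tuple R]%classic
      (fun x => sk_recover x e)
}.

Section Sketches.
Variables (R : realType) (n N : nat).
Implicit Type S : linear_sketch R n N.

Definition measurements S (omega : sk_space S) (w : vpair n -> R) :
    N.-tuple R :=
  [tuple \sum_e sk_mx omega i e * w e | i < N].

Definition output S (omega : sk_space S) (w : vpair n -> R) : vpair n -> R :=
  sk_recover (omega, measurements omega w).

Definition incidence S : Prop :=
  forall (omega : sk_space S) (i : 'I_N),
    exists v : 'I_n, forall e : vpair n, sk_mx omega i e != 0 -> v \in val e.

Definition computes_spanner (C delta t : R) S : Prop :=
  forall w : vpair n -> R, nonneg w -> ratio_le C w ->
    ((1 - delta)%:E <=
      sk_prob S [set omega | spanner t w (output omega w)]%classic)%E.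

End Sketches.

(* Main.v *)
Require Import Defs.
From HB Require Import structures.
From mathcomp Require Import all_boot all_order all_algebra all_fingroup.
From mathcomp Require Import all_classical all_reals all_analysis.
From mathcomp Require Import measurable_realfun ring lra zify.

Set Implicit Arguments.
Unset Strict Implicit.
Unset Printing Implicit Defensive.

Import Order.TTheory GRing.Theory Num.Theory.
Import numFieldNormedType.Exports.

Local Open Scope classical_set_scope.
Local Open Scope ring_scope.

(** Fix a sketching matrix [Phi] and call [f_a] the part of a combination [y Phi]
    of its rows that comes from the measurements at the vertex [a]; it lies in a
    space of dimension [k_a], the [k_a] sum to [N], and [y Phi] takes the value
    [f_a b + f_b a] on the slot [{a, b}].  If [N] is much smaller than
    [n ^ (1 + alpha)], then most [k_a] are at most [K = n ^ (alpha - o(1))].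

    Place a layered graph on a random set of vertices: [L + 1] levels, with [L]
    about [n ^ (2 / 3 (1 - alpha))], each made of blocks of [s] vertices, in which
    all pairs at level distance at most 1 are adjacent; [u] lies on level 0 and a
    last vertex [v] forms level [L + 1].  A spanner of stretch at most [L] has to
    keep the edge [uv] whenever it is present.

    A random block of [s >> K ^ 2] vertices determines [f_v] up to a small error,
    so that the value of [y Phi] on [uv] can be transported to the preceding level,
    at the cost of the energy of [y Phi] on the edges that are used.  Going down
    level by level, and choosing among several blocks per level to avoid the
    exceptional ones, shows that for most placements [(y Phi) uv ^ 2] is at most a
    small constant times the energy of [y Phi] on the layered graph.

    By duality the column of [uv] is [Phi z], with [z] of small norm supported on
    the layered graph.  Hence shifting the weights by [z] hides the edge [uv] from
    the sketch.  When the weights are independent with density [g ^ 2] on [1, 2],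
    [g] Lipschitz, this shift is almost invisible in Hellinger distance, and the
    recovery cannot tell whether [uv] is present. *)

(** * Finite sums *)

Lemma big_option (S : Type) (idx : S) (op : Monoid.com_law idx) (A : finType)
    (F : option A -> S) :
  \big[op/idx]_o F o = op (F None) (\big[op/idx]_a F (Some a)).
Proof.
rewrite (bigD1 None) //=; congr (op _ _).
rewrite (reindex_omap Some id) /=; last by case.
by apply: eq_bigl => a; rewrite eqxx.
Qed.

Section FiniteSums.
Variable R : realFieldType.

Lemma sumr_bool (T : finType) (P : pred T) :
  \sum_t (P t)%:R = #|[set t | P t]%SET|%:R :> R.
Proof.
rewrite -sum1dep_card natr_sum [RHS]big_mkcond /=.
by apply: eq_bigr => t _; case: (P t).
Qed.

Lemma ler_eq (x y : R) : x = y -> x <= y.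
Proof. by move=> ->. Qed.

Lemma ler_term_sum (I : finType) (f : I -> R) i :
  (forall i, 0 <= f i) -> f i <= \sum_i f i.
Proof. by move=> f0; rewrite (bigD1 i) //= lerDl sumr_ge0. Qed.

Lemma ler_term_sum2 (I J : finType) (f : I -> J -> R) i j :
  (forall i j, 0 <= f i j) -> f i j <= \sum_i \sum_j f i j.
Proof.
move=> f0; apply: le_trans (ler_term_sum j (f0 i)) _.
by apply: (ler_term_sum (f := fun i => \sum_j f i j)) => i'; exact: sumr_ge0.
Qed.

Lemma ler_sum_inj (A T : finType) (h : A -> T) (P : pred T) (f : T -> R) :
  injective h -> (forall a, P (h a)) -> (forall p, 0 <= f p) ->
  \sum_a f (h a) <= \sum_(p | P p) f p.
Proof.
move=> h_inj hP f0.
have -> : \sum_a f (h a) = \sum_(p in h @: A) f p.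
  rewrite big_imset /=; last by move=> a b _ _; exact: h_inj.
  by apply: eq_bigl.
rewrite big_mkcond [leRHS]big_mkcond; apply: ler_sum => p _.
case: ifP => [/imsetP[a _ ->]|_]; first by rewrite hP.
by case: ifP.
Qed.

Lemma sumr_ord_const a (x : R) : \sum_(j < a) x = a%:R * x.
Proof. by rewrite sumr_const card_ord -[LHS]mulr_natl. Qed.

Lemma weierstrass_product (E : Type) (es : seq E) (f : E -> R) :
  (forall e, 0 <= f e <= 1) -> 1 - \sum_(e <- es) f e <= \prod_(e <- es) (1 - f e).
Proof.
move=> f01; elim: es => [|e es IH]; first by rewrite !big_nil subr0.
have prod01 : 0 <= \prod_(e <- es) (1 - f e) <= 1.
  by rewrite prodr_ge0 ?prodr_ile1 // => i _; have := f01 i; lra.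
by rewrite !big_cons; have /andP[? ?] := f01 e; move/andP: prod01 => [? ?]; nra.
Qed.

End FiniteSums.

(** * Orthogonal projections *)

Section Dot.
Variables (R : realType) (T : finType).
Implicit Types x y z : T -> R.

Definition dot x y : R := \sum_t x t * y t.
Definition unit_vec (t : T) : T -> R := fun t' => (t' == t)%:R.

Lemma dotC x y : dot x y = dot y x.
Proof. by apply: eq_bigr => t _; rewrite mulrC. Qed.

Lemma dotDl x y z : dot (fun t => x t + y t) z = dot x z + dot y z.
Proof. by rewrite /dot -big_split; apply: eq_bigr => t _; rewrite mulrDl. Qed.

Lemma dotBl x y z : dot (fun t => x t - y t) z = dot x z - dot y z.
Proof. by rewrite /dot -sumrB; apply: eq_bigr => t _; rewrite mulrBl. Qed.

Lemma dotZl a x y : dot (fun t => a * x t) y = a * dot x y.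
Proof. by rewrite /dot mulr_sumr; apply: eq_bigr => t _; rewrite mulrA. Qed.

Lemma dotDr x y z : dot z (fun t => x t + y t) = dot z x + dot z y.
Proof. by rewrite dotC dotDl !(dotC _ z). Qed.

Lemma dotBr x y z : dot z (fun t => x t - y t) = dot z x - dot z y.
Proof. by rewrite dotC dotBl !(dotC _ z). Qed.

Lemma dotZr a x y : dot y (fun t => a * x t) = a * dot y x.
Proof. by rewrite dotC dotZl (dotC _ y). Qed.

Lemma dot0l x : dot (fun=> 0) x = 0.
Proof. by rewrite /dot big1 // => t _; rewrite mul0r. Qed.

Lemma dot0r x : dot x (fun=> 0) = 0.
Proof. by rewrite dotC dot0l. Qed.

Lemma dot_unitl t x : dot (unit_vec t) x = x t.
Proof.
rewrite /dot (bigD1 t) //= big1 => [|i /negPf it]; rewrite /unit_vec ?eqxx ?it.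
  by rewrite mul1r addr0.
by rewrite mul0r.
Qed.

Lemma dot_unitr t x : dot x (unit_vec t) = x t.
Proof. by rewrite dotC dot_unitl. Qed.

Notation sqnorm x := (dot x x).

Lemma sqnormE x : sqnorm x = \sum_t x t ^+ 2.
Proof. by apply: eq_bigr => t _; rewrite expr2. Qed.

Lemma sqnorm_ge0 x : 0 <= sqnorm x.
Proof. by rewrite sqnormE sumr_ge0 // => t _; exact: sqr_ge0. Qed.

Lemma sqr_le_sqnorm x t : x t ^+ 2 <= sqnorm x.
Proof. by rewrite sqnormE (ler_term_sum (f := fun t => x t ^+ 2)) // => ?; exact: sqr_ge0. Qed.

Lemma sqnorm_eq0 x : sqnorm x = 0 -> x = fun=> 0.
Proof.
move=> x0; apply/funext => t; apply/eqP; rewrite -sqrf_eq0 eq_le sqr_ge0 andbT.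
by rewrite -x0 sqr_le_sqnorm.
Qed.

Lemma cauchy_schwarz x y : dot x y ^+ 2 <= sqnorm x * sqnorm y.
Proof.
have [y0|y0] := eqVneq (sqnorm y) 0.
  by rewrite (sqnorm_eq0 y0) !dot0r mulr0 expr0n.
have yp : 0 < sqnorm y by rewrite lt_def y0 sqnorm_ge0.
have := sqnorm_ge0 (fun t => x t - (dot x y / sqnorm y) * y t).
rewrite dotBl !dotBr !dotZl !dotZr (dotC y x) => residual_ge0.
have -> : dot x y ^+ 2 = sqnorm x * sqnorm y - sqnorm y *
   (sqnorm x - dot x y / sqnorm y * dot x y - (dot x y / sqnorm y * dot x y -
     dot x y / sqnorm y * (dot x y / sqnorm y * sqnorm y))) by field.
by rewrite gerBl mulr_ge0 // ltW.
Qed.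

Lemma sqr_sum_le (a p q : T -> R) :
  (forall t, 0 <= p t) -> (forall t, 0 <= q t) -> (forall t, a t ^+ 2 <= p t * q t) ->
  (\sum_t a t) ^+ 2 <= (\sum_t p t) * (\sum_t q t).
Proof.
move=> p0 q0 a_le; pose sp t := Num.sqrt (p t); pose sq t := Num.sqrt (q t).
have norm_a t : `|a t| <= sp t * sq t.
  by rewrite -sqrtrM // -[leLHS]sqrtr_sqr ?normr_ge0 // ler_sqrt ?mulr_ge0 // real_normK ?num_real.
have sqnorm_sqrt f : (forall t, 0 <= f t) -> sqnorm (fun t => Num.sqrt (f t)) = \sum_t f t.
  by move=> f0; rewrite sqnormE; apply: eq_bigr => t _; rewrite sqr_sqrtr.
rewrite -(sqnorm_sqrt p) // -(sqnorm_sqrt q) //; apply: le_trans (cauchy_schwarz _ _).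
rewrite -[leLHS]real_normK ?num_real // lerXn2r ?nnegrE ?normr_ge0 //.
  by apply: sumr_ge0 => t _; rewrite mulr_ge0 ?sqrtr_ge0.
by apply: le_trans (ler_norm_sum _ _ _) _; apply: ler_sum => t _; exact: norm_a.
Qed.

Lemma sqnormD_le x y : sqnorm (fun t => x t + y t) <= 2 * sqnorm x + 2 * sqnorm y.
Proof.
have := sqnorm_ge0 (fun t => x t - y t).
by rewrite dotBl !dotBr dotDl !dotDr (dotC y x); lra.
Qed.

End Dot.

Notation sqnorm x := (dot x x).
Arguments unit_vec R {T} t _.

Section Span.
Variables (R : realType) (T I : finType).
Implicit Types (x y : T -> R) (g e : I -> T -> R) (c : I -> R).

Definition lincomb g c : T -> R := fun t => \sum_i c i * g i t.

Definition in_span g x := exists c, x = lincomb g c.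

Lemma dot_lincomb g c y : dot (lincomb g c) y = \sum_i c i * dot (g i) y.
Proof.
rewrite /dot /lincomb; under eq_bigr => t _ do rewrite mulr_suml.
rewrite exchange_big; apply: eq_bigr => i _ /=; rewrite mulr_sumr.
by apply: eq_bigr => t _; rewrite mulrA.
Qed.

Lemma lincomb_unit g i : lincomb g (unit_vec R i) = g i.
Proof. by apply/funext => t; exact: (dot_unitl i (fun j => g j t)). Qed.

Lemma lincombB g c c' :
  lincomb g (fun i => c i - c' i) = fun t => lincomb g c t - lincomb g c' t.
Proof. by apply/funext => t; rewrite -sumrB; apply: eq_bigr => i _; rewrite mulrBl. Qed.

Lemma mem_span g i : in_span g (g i).
Proof. by exists (unit_vec R i); rewrite lincomb_unit. Qed.

Lemma dot_span0 g x y : in_span g x -> (forall i, dot (g i) y = 0) -> dot x y = 0.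
Proof. by move=> [c ->] gy; rewrite dot_lincomb big1 // => i _; rewrite gy mulr0. Qed.

End Span.

Section SpanOfSpan.
Variables (R : realType) (T I J : finType).
Implicit Types (x y : T -> R) (g : I -> T -> R).

Lemma lincombA g (c : J -> I -> R) a :
  lincomb g (lincomb c a) = lincomb (fun j => lincomb g (c j)) a.
Proof.
apply/funext => t; rewrite /lincomb; under eq_bigr => i _ do rewrite mulr_suml.
rewrite exchange_big; apply: eq_bigr => j _ /=; rewrite mulr_sumr.
by apply: eq_bigr => i _; rewrite mulrA.
Qed.

Lemma span_trans g (g' : J -> T -> R) x :
  (forall j, in_span g (g' j)) -> in_span g' x -> in_span g x.
Proof.
move=> /choice[c g'E] [a ->]; exists (lincomb c a); rewrite lincombA.
by congr lincomb; apply/funext.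
Qed.

End SpanOfSpan.

Lemma span_comb2 (R : realType) (T I : finType) (g : I -> T -> R) a x b y :
  in_span g x -> in_span g y -> in_span g (fun t => a * x t + b * y t).
Proof.
move=> gx gy; apply: (@span_trans _ _ _ _ _ (fun i : bool => if i then x else y)).
  by case.
by exists (fun i => if i then a else b); apply/funext => t; rewrite /lincomb big_bool.
Qed.

Section OrthonormalSystems.
Variables (R : realType) (T I : finType).
Implicit Types (x y z : T -> R) (e g : I -> T -> R) (b : I -> bool) (c : I -> R).

(* An orthonormal system padded with zero vectors, so that Gram-Schmidt can keep
   the index type of the given family. *)
Definition orthonormal b e := forall i j, dot (e i) (e j) = ((i == j) && b i)%:R.

Definition expansion e x : T -> R := lincomb e (fun i => dot x (e i)).

Lemma orthonormal_zero b e i : orthonormal b e -> b i = false -> e i = fun=> 0.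
Proof. by move=> on bi; apply: sqnorm_eq0; rewrite on bi andbF. Qed.

Lemma orthonormal_coord b e y i : orthonormal b e -> (b i)%:R * dot y (e i) = dot y (e i).
Proof.
by move=> on; case bi: (b i); rewrite ?mul1r ?mul0r // (orthonormal_zero on bi) dot0r.
Qed.

Lemma dot_lincomb_orthonormal b e c i :
  orthonormal b e -> dot (lincomb e c) (e i) = (b i)%:R * c i.
Proof.
move=> on; rewrite dot_lincomb (bigD1 i) //= big1 => [|j ji].
  by rewrite on eqxx addr0 mulrC.
by rewrite on (negPf ji) mulr0.
Qed.

Lemma dot_expansion e x y : dot (expansion e x) y = \sum_i dot x (e i) * dot y (e i).
Proof. by rewrite dot_lincomb; apply: eq_bigr => i _; rewrite (dotC y). Qed.

Lemma expansion_sym e x y : dot (expansion e x) y = dot x (expansion e y).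
Proof.
by rewrite dot_expansion dotC dot_expansion; apply: eq_bigr => i _; rewrite mulrC.
Qed.

Lemma dot_expansion_basis b e x i : orthonormal b e -> dot (expansion e x) (e i) = dot x (e i).
Proof. by move=> on; rewrite (dot_lincomb_orthonormal _ _ on) (orthonormal_coord _ _ on). Qed.

Lemma expansionD e x y :
  expansion e (fun t => x t + y t) = fun t => expansion e x t + expansion e y t.
Proof.
apply/funext => t; rewrite -big_split; apply: eq_bigr => i _ /=.
by rewrite dotDl mulrDl.
Qed.

Lemma expansion_lincomb (K : finType) e (x : K -> T -> R) a :
  expansion e (lincomb x a) = lincomb (fun k => expansion e (x k)) a.
Proof.
rewrite -lincombA; congr lincomb; apply/funext => i.
by rewrite dot_lincomb.
Qed.

Lemma expansion_fix_span e g x :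
  (forall i, expansion e (g i) = g i) -> in_span g x -> expansion e x = x.
Proof.
by move=> eg [c ->]; rewrite expansion_lincomb; congr lincomb; apply/funext.
Qed.

Lemma orthonormal_insert b e i0 u : orthonormal b e -> b i0 = false ->
  dot u u = 1 -> (forall i, dot u (e i) = 0) ->
  orthonormal [eta b with i0 |-> true] [eta e with i0 |-> u].
Proof.
move=> on bi0 u1 ue i j /=.
case: (eqVneq i i0) => [->|ii0]; case: (eqVneq j i0) => [ji0|_] //=.
by rewrite dotC ue ji0 (negPf ii0).
Qed.

Lemma expansion_insert b e i0 u x : orthonormal b e -> b i0 = false ->
  expansion [eta e with i0 |-> u] x = fun t => expansion e x t + dot x u * u t.
Proof.
move=> on bi0; apply/funext => t; rewrite /expansion /lincomb.
rewrite (bigD1 i0) //= [in RHS](bigD1 i0) //= eqxx (orthonormal_zero on bi0).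
rewrite mulr0 add0r addrC; congr (_ + _).
by apply: eq_bigr => i /negPf->.
Qed.

Lemma exists_normalizer x : sqnorm x != 0 -> exists k, k ^+ 2 * sqnorm x = 1.
Proof.
move=> x0; exists (Num.sqrt (sqnorm x))^-1.
by rewrite exprVn sqr_sqrtr ?sqnorm_ge0 // mulVf.
Qed.

Definition partial_basis g (s : seq I) b e :=
  [/\ orthonormal b e, forall i, in_span g (e i),
      {in s, forall i, expansion e (g i) = g i}
    & forall i, b i -> (i \in s) && (g i != fun=> 0)].

Lemma partial_basis_extend g s b e i0 : partial_basis g s b e -> i0 \notin s ->
  exists b' e', partial_basis g (i0 :: s) b' e'.
Proof.
move=> [on eg fix_s b_supp] i0s.
have bi0 : b i0 = false by apply: contraNF i0s => /b_supp/andP[].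
pose r := fun t => g i0 t - expansion e (g i0) t.
have re i : dot r (e i) = 0 by rewrite dotBl (dot_expansion_basis _ _ on) subrr.
have [r0|rn0] := eqVneq (sqnorm r) 0.
  exists b, e; split => // i.
  - rewrite inE => /orP[/eqP->|/fix_s//]; apply/funext => t.
    by have /esym/eqP := congr1 (@^~ t) (sqnorm_eq0 r0); rewrite eq_sym subr_eq0 => /eqP.
  - by move=> /b_supp/andP[si gi]; rewrite inE si orbT.
have [k k1] := exists_normalizer rn0; pose u := fun t => k * r t.
have ue i : dot u (e i) = 0 by rewrite dotZl re mulr0.
have u1 : sqnorm u = 1 by rewrite dotZl dotZr mulrA -expr2.
exists [eta b with i0 |-> true], [eta e with i0 |-> u]; split.
- exact: orthonormal_insert.
- move=> i /=; case: ifP => // _.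
  rewrite (_ : u = fun t => k * g i0 t + (- k) * expansion e (g i0) t); last first.
    by apply/funext => t; rewrite /u /r; ring.
  apply: span_comb2; first exact: mem_span.
  by apply: span_trans eg _; eexists.
- move=> i; rewrite inE => /orP[/eqP->|si]; rewrite (expansion_insert _ _ on bi0).
    have gr : dot (g i0) r = sqnorm r.
      by rewrite {2}/r dotBl dot_expansion big1 ?subr0 // => i' _; rewrite re mulr0.
    apply/funext => t; rewrite dotZr gr /u mulrCA mulrA mulrA -expr2 k1 mul1r /r; ring.
  apply/funext => t; rewrite fix_s //; have -> : dot (g i) u = 0; last by rewrite mul0r addr0.
  by rewrite -(fix_s i si) dot_expansion big1 // => j _; rewrite ue mulr0.
- move=> i /=; case: (eqVneq i i0) => [-> _|ii0 /b_supp/andP[si gi]]; last by rewrite inE si orbT.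
  rewrite inE eqxx /=; apply: contraNneq rn0 => g0; rewrite /r g0.
  rewrite [sqnorm _]big1 // => t _; rewrite [expansion _ _ t]big1 ?subr0 ?mul0r // => j _.
  by rewrite dot0l mul0r.
Qed.

Lemma gram_schmidt g : exists b e,
  [/\ orthonormal b e, forall i, in_span g (e i), forall i, expansion e (g i) = g i
    & forall i, b i -> g i != fun=> 0].
Proof.
suff [b [e [on eg fix_g b_supp]]] : exists b e, partial_basis g (enum I) b e.
  exists b, e; split=> // i; first by apply: fix_g; rewrite mem_enum.
  by move=> /b_supp/andP[].
elim: (enum I) (enum_uniq I) => [_|i0 s IH /= /andP[i0s /IH[b [e gbe]]]].
  exists (fun=> false), (fun _ _ => 0); split=> // [i j|i]; first by rewrite dot0l andbF.
  by exists (fun=> 0); apply/funext => t; rewrite /lincomb big1 // => j _; rewrite mul0r.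
exact: partial_basis_extend gbe i0s.
Qed.

Definition basis_mask g : I -> bool := projT1 (cid (gram_schmidt g)).
Definition basis g : I -> T -> R := projT1 (cid (projT2 (cid (gram_schmidt g)))).

Lemma basisP g :
  [/\ orthonormal (basis_mask g) (basis g), forall i, in_span g (basis g i),
      forall i, expansion (basis g) (g i) = g i & forall i, basis_mask g i -> g i != fun=> 0].
Proof. exact: (projT2 (cid (projT2 (cid (gram_schmidt g))))). Qed.

Lemma basis_orthonormal g : orthonormal (basis_mask g) (basis g).
Proof. by have [] := basisP g. Qed.

Lemma basis_in_span g i : in_span g (basis g i).
Proof. by have [_ + _ _] := basisP g; apply. Qed.

End OrthonormalSystems.

Section Projection.
Variables (R : realType) (T I : finType).
Implicit Types (x y : T -> R) (g : I -> T -> R).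

Definition proj g := expansion (basis g).

Lemma proj_gen g i : proj g (g i) = g i.
Proof. by have [_ _ + _] := basisP g; apply. Qed.

Lemma gen_in_basis_span g i : in_span (basis g) (g i).
Proof. by rewrite -(proj_gen g i); eexists. Qed.

Lemma proj_sym g x y : dot (proj g x) y = dot x (proj g y).
Proof. exact: expansion_sym. Qed.

Lemma proj_fix_span g x : in_span g x -> proj g x = x.
Proof. exact: expansion_fix_span (proj_gen g). Qed.

Lemma proj_in_span g x : in_span g (proj g x).
Proof. by apply: span_trans (basis_in_span g) _; eexists. Qed.

Lemma proj_idem g x : proj g (proj g x) = proj g x.
Proof. by apply: proj_fix_span; exact: proj_in_span. Qed.

Lemma sqnorm_proj g x : sqnorm (proj g x) = dot x (proj g x).
Proof. by rewrite proj_sym proj_idem. Qed.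

Lemma projD g x y : proj g (fun t => x t + y t) = fun t => proj g x t + proj g y t.
Proof. exact: expansionD. Qed.

Lemma proj_lincomb (K : finType) g (x : K -> T -> R) a :
  proj g (lincomb x a) = lincomb (fun k => proj g (x k)) a.
Proof. exact: expansion_lincomb. Qed.

Lemma projZ g a x : proj g (fun t => a * x t) = fun t => a * proj g x t.
Proof.
apply/funext => t; rewrite /proj /expansion /lincomb mulr_sumr; apply: eq_bigr => i _.
by rewrite dotZl mulrA.
Qed.

Lemma proj_orth g x : (forall i, dot x (g i) = 0) -> proj g x = fun=> 0.
Proof.
move=> xg; apply: sqnorm_eq0; rewrite sqnorm_proj dotC.
by apply: dot_span0 (proj_in_span g x) _ => i; rewrite dotC.
Qed.

Lemma proj_residual g x i : dot (fun t => x t - proj g x t) (g i) = 0.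
Proof. by rewrite dotBl proj_sym proj_gen subrr. Qed.

Lemma proj_unique g x y : in_span g y ->
  (forall i, dot (fun t => x t - y t) (g i) = 0) -> proj g x = y.
Proof.
move=> gy xy.
rewrite (_ : x = fun t => (x t - y t) + y t); last by apply/funext => t; rewrite subrK.
by rewrite projD (proj_orth xy) (proj_fix_span gy); apply/funext => t; rewrite add0r.
Qed.

Lemma sqnorm_proj_le g x : sqnorm (proj g x) <= sqnorm x.
Proof.
have := sqnorm_ge0 (fun t => x t - proj g x t).
by rewrite dotBl !dotBr (dotC (proj g x) x) -!sqnorm_proj; lra.
Qed.

Definition dim_span g : nat := \sum_i basis_mask g i.

Definition num_nonzero g : nat := #|[set i | g i != fun=> 0%R]%SET|.

Lemma dim_span_le g : (dim_span g <= num_nonzero g)%N.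
Proof.
rewrite /num_nonzero -sum1dep_card [leqRHS]big_mkcond /=; apply: leq_sum => i _.
have [_ _ _ mask_nz] := basisP g.
by case bi: (basis_mask g i); first rewrite mask_nz.
Qed.

(* For [g] spanning a row space, these are the leverage scores of its columns. *)
Definition leverage g t : R := proj g (unit_vec R t) t.

Lemma sqnorm_proj_unit g t : sqnorm (proj g (unit_vec R t)) = leverage g t.
Proof. by rewrite sqnorm_proj dot_unitl. Qed.

Lemma leverage_ge0 g t : 0 <= leverage g t.
Proof. by rewrite -sqnorm_proj_unit sqnorm_ge0. Qed.

Lemma sum_leverage g : \sum_t leverage g t = (dim_span g)%:R.
Proof.
rewrite natr_sum (eq_bigr (fun t => \sum_i basis g i t ^+ 2)) => [|t _]; last first.
  rewrite -sqnorm_proj_unit sqnorm_proj dotC dot_expansion.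
  by apply: eq_bigr => i _; rewrite dot_unitl.
rewrite exchange_big; apply: eq_bigr => i _ /=.
by rewrite -sqnormE (basis_orthonormal g) eqxx.
Qed.

Lemma sum_leverage_le g : \sum_t leverage g t <= (num_nonzero g)%:R.
Proof. by rewrite sum_leverage ler_nat dim_span_le. Qed.

Lemma num_nonzero_le g g' :
  (forall i, g' i = (fun=> 0) -> g i = fun=> 0) -> (num_nonzero g <= num_nonzero g')%N.
Proof.
move=> zero_gen; apply: subset_leq_card; apply/fintype.subsetP => i; rewrite !inE.
by apply: contraNN => /eqP/zero_gen->.
Qed.

Lemma sqr_le_leverage g x t : in_span g x -> x t ^+ 2 <= sqnorm x * leverage g t.
Proof.
move=> gx; rewrite -[x t]dot_unitr -{1}(proj_fix_span gx) proj_sym.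
by apply: le_trans (cauchy_schwarz _ _) _; rewrite sqnorm_proj_unit.
Qed.

Lemma leverage_le g t h : 0 <= h -> (forall x, in_span g x -> x t ^+ 2 <= h * sqnorm x) ->
  leverage g t <= h.
Proof.
move=> h0 /(_ _ (proj_in_span g (unit_vec R t))); rewrite sqnorm_proj_unit -/(leverage g t) expr2.
have := leverage_ge0 g t; rewrite le_eqVlt => /orP[/eqP<- //|l0]; by rewrite ler_pM2r.
Qed.

End Projection.

Lemma proj_eq (R : realType) (T I J : finType) (g : I -> T -> R) (g' : J -> T -> R) :
  (forall i, in_span g' (g i)) -> (forall j, in_span g (g' j)) -> proj g = proj g'.
Proof.
move=> gg' g'g; apply/funext => x; apply: proj_unique => [|i].
  by apply: span_trans g'g _; exact: proj_in_span.
rewrite dotC; apply: dot_span0 (gg' i) _ => j.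
by rewrite dotC proj_residual.
Qed.

Lemma proj_reindex (R : realType) (T T' I I' : finType) (g : I -> T -> R)
    (g' : I' -> T' -> R) (h : T' -> T) (k : I' -> I) y :
  bijective h -> bijective k -> (forall i, g' i = g (k i) \o h) ->
  proj g' (y \o h) = proj g y \o h.
Proof.
move=> h_bij k_bij g'E; apply: proj_unique => [|i].
  have [c ->] := proj_in_span g y; exists (c \o k); apply/funext => t.
  rewrite /lincomb /= (reindex k) /=; last exact: onW_bij.
  by apply: eq_bigr => i _; rewrite g'E.
rewrite g'E -(proj_residual g y (k i)) /dot [RHS](reindex h) //; exact: onW_bij.
Qed.

Lemma riesz_span (R : realType) (I T : finType) (g : I -> T -> R) (phi : I -> R) (C : R) :
  (forall y, dot y phi ^+ 2 <= C * sqnorm (lincomb g y)) -> 0 <= C ->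
  exists2 z, in_span g z & (forall i, dot (g i) z = phi i) /\ sqnorm z <= C.
Proof.
move=> phiC C0; have /choice[c qE] := basis_in_span g.
pose t l := dot (c l) phi; pose z := lincomb (basis g) t.
have phi0 y : lincomb g y = (fun=> 0) -> dot y phi = 0.
  move=> y0; apply/eqP; rewrite -sqrf_eq0 eq_le sqr_ge0 andbT.
  by apply: le_trans (phiC y) _; rewrite y0 dot0l mulr0.
have zE : z = lincomb g (lincomb c t) by rewrite lincombA /z; congr lincomb; apply/funext.
exists z; first by eexists; exact: zE.
split=> [i|].
  pose a := lincomb c (fun l => dot (g i) (basis g l)).
  have : lincomb g (fun j => unit_vec R i j - a j) = fun=> 0.
    rewrite lincombB lincomb_unit /a lincombA; apply/funext => v.
    rewrite -[X in X v - _](proj_gen g i) /proj /expansion.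
    by apply/eqP; rewrite subr_eq0; apply/eqP; congr (lincomb _ _ v); apply/funext.
  move=> /phi0; rewrite dotBl dot_unitl dot_lincomb => /eqP.
  rewrite subr_eq0 eq_sym dotC dot_lincomb => /eqP<-.
  by apply: eq_bigr => l _; rewrite mulrC (dotC (g i)).
have zt : sqnorm z <= sqnorm t.
  rewrite dot_lincomb; apply: ler_sum => l _.
  rewrite dotC (dot_lincomb_orthonormal _ _ (basis_orthonormal g)) mulrCA.
  by case: (basis_mask g l); rewrite ?mul1r // mul0r -expr2 sqr_ge0.
have := phiC (lincomb c t); rewrite -zE dot_lincomb -/(dot t t).
have := sqnorm_ge0 z; move: zt; move: (sqnorm z) (sqnorm t) => a b ab a0 bC.
have : a * b <= C * a by apply: le_trans bC; rewrite expr2 ler_wpM2r // (le_trans a0).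
move: a0; rewrite le_eqVlt => /orP[/eqP<- //|a0].
by rewrite mulrC ler_pM2r // => /(le_trans ab).
Qed.

Definition glue (A B C : Type) (y : A -> C) (z : B -> C) (i : A + B) : C :=
  match i with inl a => y a | inr b => z b end.

Definition extend (A C : Type) (v : C) (y : A -> C) (o : option A) : C :=
  if o is Some a then y a else v.

Section JointProjection.
Variables (R : realType) (T I1 I2 : finType).
Implicit Types (x y : T -> R) (f : I1 -> T -> R) (g : I2 -> T -> R).

Lemma span_gluel f g x : in_span f x -> in_span (glue f g) x.
Proof. by apply: span_trans => i; exact: (mem_span (glue f g) (inl i)). Qed.

Lemma span_gluer f g x : in_span g x -> in_span (glue f g) x.
Proof. by apply: span_trans => i; exact: (mem_span (glue f g) (inr i)). Qed.

Lemma proj_glue_basis f g : proj (glue f g) = proj (glue (basis f) (basis g)).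
Proof.
apply: proj_eq => -[i|i] /=.
- exact/span_gluel/gen_in_basis_span.
- exact/span_gluer/gen_in_basis_span.
- exact/span_gluel/basis_in_span.
- exact/span_gluer/basis_in_span.
Qed.

Lemma dim_span_glue f g : (dim_span (glue f g) <= dim_span f + dim_span g)%N.
Proof.
have -> : dim_span (glue f g) = dim_span (glue (basis f) (basis g)).
  apply/eqP; rewrite -(eqr_nat R) -!sum_leverage; apply/eqP/eq_bigr => t _.
  by rewrite /leverage proj_glue_basis.
apply: leq_trans (dim_span_le _) _.
rewrite /num_nonzero -sum1dep_card big_mkcond big_sumType /=.
apply: leq_add; apply: leq_sum => i _; case: ifPn => // bi0; rewrite lt0b;
  apply: contraNT bi0 => /negbTE; [move/(orthonormal_zero (basis_orthonormal f))
    |move/(orthonormal_zero (basis_orthonormal g))] => ->; exact: eqxx.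
Qed.

Definition joint_proj f g := proj (glue f g).

(* [P1 + P2 - Q], for the projections on two subspaces and on their sum: it
   measures how far the two subspaces are from being orthogonal. *)
Definition joint_defect f g x : T -> R :=
  fun t => proj f x t + proj g x t - joint_proj f g x t.

Lemma joint_projl f g x : joint_proj f g (proj f x) = proj f x.
Proof. exact/proj_fix_span/span_gluel/proj_in_span. Qed.

Lemma joint_projr f g x : joint_proj f g (proj g x) = proj g x.
Proof. exact/proj_fix_span/span_gluer/proj_in_span. Qed.

Lemma joint_defectD f g x y : joint_defect f g (fun t => x t + y t) =
  fun t => joint_defect f g x t + joint_defect f g y t.
Proof. by apply/funext => t; rewrite /joint_defect /joint_proj !projD; ring. Qed.

Lemma joint_defect_lincomb (K : finType) f g (x : K -> T -> R) a :
  joint_defect f g (lincomb x a) = lincomb (fun k => joint_defect f g (x k)) a.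
Proof.
apply/funext => t; rewrite /joint_defect /joint_proj !proj_lincomb /lincomb.
by rewrite -big_split -sumrB; apply: eq_bigr => k _ /=; ring.
Qed.

Lemma sqnorm_joint_defect f g x : sqnorm (joint_defect f g x) =
  sqnorm (joint_proj f g x) - sqnorm (proj f x) - sqnorm (proj g x) +
  2 * dot (proj f x) (proj g x).
Proof.
have pq : dot (proj f x) (joint_proj f g x) = sqnorm (proj f x).
  by rewrite -(proj_sym (glue f g)) -/(joint_proj f g _) joint_projl dotC -sqnorm_proj.
have pq' : dot (proj g x) (joint_proj f g x) = sqnorm (proj g x).
  by rewrite -(proj_sym (glue f g)) -/(joint_proj f g _) joint_projr dotC -sqnorm_proj.
rewrite !dotBl !dotBr !dotDl !dotDr pq pq' (dotC (proj g x) (proj f x)).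
by rewrite !(dotC (joint_proj f g x) (proj _ _)) pq pq'; ring.
Qed.

Lemma joint_defect_hilbert_schmidt f g :
  \sum_t sqnorm (joint_defect f g (unit_vec R t)) <=
  2 * \sum_t dot (proj f (unit_vec R t)) (proj g (unit_vec R t)).
Proof.
under eq_bigr => t _ do rewrite sqnorm_joint_defect /joint_proj !sqnorm_proj_unit.
rewrite big_split !sumrB /= -mulr_sumr !sum_leverage -[leRHS]add0r lerD2r.
by rewrite -addrA -opprD subr_le0 -natrD ler_nat dim_span_glue.
Qed.

Lemma sqnorm_joint_proj_le f g x : sqnorm (joint_proj f g x) <=
  4 * (sqnorm (proj f x) + sqnorm (proj g x)) + 2 * sqnorm (joint_defect f g x).
Proof.
have -> : joint_proj f g x =
    fun t => (proj f x t + proj g x t) + (-1) * joint_defect f g x t.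
  by apply/funext => t; rewrite /joint_defect; ring.
apply: le_trans (sqnormD_le _ _) _; rewrite dotZl dotZr.
by have := sqnormD_le (proj f x) (proj g x); lra.
Qed.

End JointProjection.

(** * Row and column spaces of a family of row spaces *)

Section RowAndColumnSpaces.
Variables (R : realType) (X J : finType).
Implicit Types (G : X -> J -> X -> R) (Y : X * X -> R).

Definition transpose (t : X * X) := (t.2, t.1).

(* [row_family G] spans the matrices whose row [i] lies in the span of [G i]. *)
Definition row_family G (il : X * J) : X * X -> R :=
  fun jk => (jk.1 == il.1)%:R * G il.1 il.2 jk.2.

Definition col_family G (il : X * J) : X * X -> R := row_family G il \o transpose.

Lemma transposeK : involutive transpose. Proof. by case. Qed.

Lemma transpose_bij : bijective transpose.
Proof. exact: inv_bij transposeK. Qed.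

Lemma lincomb_row_family G c :
  lincomb (row_family G) c = fun t => lincomb (G t.1) (fun l => c (t.1, l)) t.2.
Proof.
apply/funext => -[j k] /=; rewrite /lincomb.
rewrite (eq_bigr (fun il => c (il.1, il.2) * row_family G (il.1, il.2) (j, k))) => [|[]//].
rewrite -(pair_bigA _ (fun i l => c (i, l) * row_family G (i, l) (j, k))) /=.
rewrite (bigD1 j) //= [X in _ + X]big1 ?addr0 => [|i ij].
  by apply: eq_bigr => l _; rewrite /row_family /= eqxx mul1r.
by rewrite big1 // => l _; rewrite /row_family /= eq_sym (negPf ij) mul0r mulr0.
Qed.

Lemma dot_row_family G Y il :
  dot Y (row_family G il) = dot (fun k => Y (il.1, k)) (G il.1 il.2).
Proof.
rewrite /dot (eq_bigr (fun t => Y (t.1, t.2) * row_family G il (t.1, t.2))) => [|[]//].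
rewrite -(pair_bigA _ (fun j k => Y (j, k) * row_family G il (j, k))) /=.
rewrite (bigD1 il.1) //= [X in _ + X]big1 ?addr0 => [|j ij].
  by apply: eq_bigr => k _; rewrite /row_family /= eqxx mul1r.
by rewrite big1 // => k _; rewrite /row_family /= (negPf ij) mul0r mulr0.
Qed.

Lemma proj_row_family G Y :
  proj (row_family G) Y = fun jk => proj (G jk.1) (fun k => Y (jk.1, k)) jk.2.
Proof.
apply: proj_unique => [|[i l]].
  have /choice[c cE] i : exists c, proj (G i) (fun k => Y (i, k)) = lincomb (G i) c.
    exact: proj_in_span.
  exists (fun il => c il.1 il.2); rewrite lincomb_row_family.
  by apply/funext => -[j k] /=; rewrite cE.
by rewrite dot_row_family; exact: (proj_residual (G i) (fun k => Y (i, k)) l).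
Qed.

Lemma proj_col_family G Y :
  proj (col_family G) Y = proj (row_family G) (Y \o transpose) \o transpose.
Proof.
rewrite -(proj_reindex (k := id) (g' := col_family G) (Y \o transpose) transpose_bij) //.
  by congr proj; apply/funext => -[].
exact: inv_bij.
Qed.

Lemma dot_proj_row_col G i j :
  dot (proj (row_family G) (unit_vec R (i, j))) (proj (col_family G) (unit_vec R (i, j))) =
  leverage (G i) j * leverage (G j) i.
Proof.
rewrite proj_col_family !proj_row_family /dot /=.
have row_unit (a b c : X) :
    (fun k => unit_vec R (a, b) (c, k)) = if c == a then unit_vec R b else fun=> 0.
  by apply/funext => k; rewrite /unit_vec xpair_eqE; case: eqP.
have col_unit (a b c : X) : (fun k => (unit_vec R (a, b) \o transpose) (c, k)) =
    if c == b then unit_vec R a else fun=> 0.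
  by apply/funext => k; rewrite /unit_vec /= xpair_eqE andbC; case: eqP.
have proj0 c : proj (G c) (fun=> 0) = fun=> 0.
  by apply: proj_orth => l; rewrite dot0l.
rewrite (bigD1 (i, j)) //= big1 => [|[a b] /= ab].
  by rewrite addr0 row_unit eqxx col_unit eqxx.
rewrite row_unit col_unit; move: ab; rewrite xpair_eqE.
case: eqP => [->|_ _]; last by rewrite proj0 mul0r.
by case: eqP => //= _ _; rewrite proj0 mulr0.
Qed.

Definition row_col_proj G := joint_proj (row_family G) (col_family G).
Definition row_col_defect G := joint_defect (row_family G) (col_family G).

Lemma row_col_proj_symmetrized G Y : in_span (row_family G) Y ->
  row_col_proj G (fun t => Y t + Y (transpose t)) = fun t => Y t + Y (transpose t).
Proof.
move=> [c YE]; rewrite /row_col_proj /joint_proj projD.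
rewrite !proj_fix_span //; first by apply: span_gluer; exists c; rewrite YE.
by apply: span_gluel; exists c.
Qed.

Definition sym_unit (a c : X) : X * X -> R :=
  fun t => unit_vec R (a, c) t + unit_vec R (c, a) t.

Definition vertex_defect G c := \sum_a sqnorm (row_col_defect G (sym_unit a c)).

Lemma vertex_defect_ge0 G c : 0 <= vertex_defect G c.
Proof. by apply: sumr_ge0 => a _; exact: sqnorm_ge0. Qed.

Lemma sum_sqnorm_row_col_defect G h : (forall i j, leverage (G i) j <= h) ->
  \sum_t sqnorm (row_col_defect G (unit_vec R t)) <= 2 * (h ^+ 2 * #|X|%:R ^+ 2).
Proof.
move=> lev_le; apply: le_trans (joint_defect_hilbert_schmidt _ _) _; rewrite ler_pM2l //.
apply: (@le_trans _ _ (\sum_(t : X * X) h ^+ 2)).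
  apply: ler_sum => -[i j] _; rewrite dot_proj_row_col expr2.
  by apply: ler_pM; rewrite ?leverage_ge0.
by rewrite sumr_const card_prod -[X in X <= _]mulr_natr natrM expr2.
Qed.

Lemma sum_vertex_defect G h : (forall i j, leverage (G i) j <= h) ->
  \sum_c vertex_defect G c <= 8 * h ^+ 2 * #|X|%:R ^+ 2.
Proof.
move=> lev_le; pose f a c := sqnorm (row_col_defect G (unit_vec R (a, c))).
have sum_f : \sum_a \sum_c f a c <= 2 * (h ^+ 2 * #|X|%:R ^+ 2).
  rewrite pair_bigA; apply: le_trans (sum_sqnorm_row_col_defect lev_le).
  by apply: ler_eq; apply: eq_bigr => -[].
apply: (@le_trans _ _ (\sum_c \sum_a (2 * f a c + 2 * f c a))).
  apply: ler_sum => c _; apply: ler_sum => a _; rewrite /row_col_defect joint_defectD.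
  exact: sqnormD_le.
under eq_bigr => c _ do rewrite big_split -!mulr_sumr.
by rewrite big_split -!mulr_sumr exchange_big /= -mulrDr; lra.
Qed.

End RowAndColumnSpaces.

Definition hollow (R : realType) (X J : finType) (G : X -> J -> X -> R) :=
  forall a l, G a l a = 0.

Lemma hollow_lincomb (R : realType) (X J : finType) (G : X -> J -> X -> R) a c :
  hollow G -> lincomb (G a) c a = 0.
Proof. by move=> G0; rewrite /lincomb big1 // => l _; rewrite G0 mulr0. Qed.

(** * Transport across an apex *)

Section ApexTransport.
Variables (R : realType) (U J : finType).
Notation X := (option U).
Implicit Types (y z : U -> R) (Y : X * X -> R).

Definition border y : X * X -> R := fun t =>
  match t with (Some a, None) | (None, Some a) => y a | _ => 0 end.

Lemma sum_option2 Y : \sum_t Y t = Y (None, None) +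
  \sum_a (Y (Some a, None) + Y (None, Some a)) + \sum_a \sum_b Y (Some a, Some b).
Proof.
rewrite (eq_bigr (fun t => Y (t.1, t.2))) => [|[]//].
rewrite -(pair_bigA _ (fun i j => Y (i, j))) /= !big_option /= big_split /=.
under [X in _ + X]eq_bigr => a _ do rewrite big_option.
by rewrite big_split /=; ring.
Qed.

Lemma border_lincomb y : border y = lincomb (fun a => sym_unit R (Some a) None) y.
Proof.
rewrite /lincomb /sym_unit /unit_vec; apply/funext => -[[a|] [b|]] /=.
- by rewrite big1 // => c _; rewrite !xpair_eqE /= !andbF addr0 mulr0.
- rewrite (bigD1 a) //= big1 => [|c ca].
    by rewrite !xpair_eqE eqxx /= !addr0 mulr1.
  by rewrite !xpair_eqE /= andbT (inj_eq Some_inj) eq_sym (negPf ca) addr0 mulr0.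
- rewrite (bigD1 b) //= big1 => [|c cb].
    by rewrite eqxx add0r addr0 mulr1.
  by rewrite add0r xpair_eqE /= (inj_eq Some_inj) eq_sym (negPf cb) mulr0.
- by rewrite big1 // => c _; rewrite addr0 mulr0.
Qed.

Lemma dot_border y Y : dot (border y) Y = \sum_a y a * (Y (Some a, None) + Y (None, Some a)).
Proof.
rewrite /dot sum_option2 /= !mul0r add0r [X in _ + X]big1 ?addr0 => [|a _].
  by apply: eq_bigr => a _; rewrite mulrDr.
by rewrite big1 // => b _; rewrite mul0r.
Qed.

Lemma border_transpose y : border y \o (@transpose X) = border y.
Proof. by apply/funext => -[[a|] [b|]]. Qed.

Variables (G : X -> J -> X -> R) (h : R).
Hypothesis leverage_le_h : forall i j, leverage (G i) j <= h.

Definition apex_orth y := forall l, dot y (fun a => G None l (Some a)) = 0.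

Lemma row_col_defect_border y : row_col_defect G (border y) =
  lincomb (fun a => row_col_defect G (sym_unit R (Some a) None)) y.
Proof. by rewrite border_lincomb; exact: joint_defect_lincomb. Qed.

Lemma sum_defect_border_le :
  \sum_a sqnorm (row_col_defect G (sym_unit R (Some a) None)) <= vertex_defect G None.
Proof. by rewrite /vertex_defect big_option lerDr sqnorm_ge0. Qed.

Lemma sqnorm_defect_border y :
  sqnorm (row_col_defect G (border y)) <= sqnorm y * vertex_defect G None.
Proof.
apply: (@le_trans _ _ (sqnorm y *
    \sum_a sqnorm (row_col_defect G (sym_unit R (Some a) None)))); last first.
  by rewrite ler_wpM2l ?sqnorm_ge0 // sum_defect_border_le.
rewrite row_col_defect_border sqnormE exchange_big mulr_sumr; apply: ler_sum => t _ /=.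
exact: cauchy_schwarz.
Qed.

Lemma sqnorm_proj_row_border y : apex_orth y ->
  sqnorm (proj (row_family G) (border y)) <= h * sqnorm y.
Proof.
move=> y_orth; rewrite sqnorm_proj dot_border proj_row_family /=.
have apex_row : (fun k => border y (None, k)) = extend 0 y.
  by apply/funext => -[].
have other_row a : (fun k => border y (Some a, k)) = fun k => y a * unit_vec R None k.
  by apply/funext => -[b|]; rewrite /unit_vec /= ?mulr0 ?mulr1.
have -> : proj (G None) (fun k => border y (None, k)) = fun=> 0.
  apply: proj_orth => l; rewrite apex_row -[RHS](y_orth l) /dot big_option.
  by rewrite /= mul0r add0r.
rewrite sqnormE mulr_sumr; apply: ler_sum => a _; rewrite addr0 other_row projZ.
by rewrite -/(leverage (G (Some a)) None) mulrA -expr2 mulrC ler_wpM2r ?sqr_ge0.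
Qed.

Lemma sqnorm_proj_col_border y :
  sqnorm (proj (col_family G) (border y)) = sqnorm (proj (row_family G) (border y)).
Proof.
rewrite proj_col_family border_transpose /dot [RHS](reindex (@transpose X)) //.
exact/onW_bij/transpose_bij.
Qed.

Lemma sqnorm_proj_border y : apex_orth y -> sqnorm (row_col_proj G (border y)) <=
  8 * h * sqnorm y + 2 * sqnorm (row_col_defect G (border y)).
Proof.
move=> y_orth; apply: le_trans (sqnorm_joint_proj_le _ _ _) _.
by rewrite sqnorm_proj_col_border; have := sqnorm_proj_row_border y_orth; lra.
Qed.

Hypothesis small_defect : 8 * h + 2 * vertex_defect G None <= 1.

Lemma row_col_proj_border_contraction y : apex_orth y ->
  sqnorm (row_col_proj G (border y)) <= sqnorm y.
Proof.
move=> /sqnorm_proj_border/le_trans; apply.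
have := ler_wpM2l (sqnorm_ge0 y) small_defect.
by have := sqnorm_defect_border y; lra.
Qed.

(* Pairing [Y] with [border z] for [z := fun a => Y (Some a, None)] bounds the
   projection of [border z] by the part of [Y] off the apex, because this projection
   is a contraction; pairing with [border y] then gives the estimate. *)
Lemma transport_fixed_matrix y Y : row_col_proj G Y = Y -> Y \o (@transpose X) = Y ->
  Y (None, None) = 0 -> apex_orth (fun a => Y (Some a, None)) -> apex_orth y ->
  dot y (fun a => Y (Some a, None)) ^+ 2 <=
  sqnorm (row_col_proj G (border y)) * \sum_a \sum_b Y (Some a, Some b) ^+ 2.
Proof.
move=> projY symY Y0 z_orth y_orth; set z := fun a => Y (Some a, None).
pose W (t : X * X) := if t is (Some _, Some _) then Y t else 0.
have YE : Y = fun t => W t + border z t.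
  apply/funext => -[[a|] [b|]]; rewrite /= ?add0r ?addr0 //.
  by rewrite -[LHS](congr1 (@^~ (None, Some b)) symY).
have -> : \sum_a \sum_b Y (Some a, Some b) ^+ 2 = sqnorm W.
  by rewrite sqnormE sum_option2 /= expr0n /= add0r [X in X + _]big1 ?add0r // => a _;
    rewrite addr0.
set q := row_col_proj G (border y); set d := row_col_proj G (border z).
have pairing x : 2 * dot x z =
    dot (row_col_proj G (border x)) W + dot (row_col_proj G (border x)) d.
  have -> : 2 * dot x z = dot (border x) Y.
    rewrite dot_border mulr_sumr; apply: eq_bigr => a _.
    by rewrite -[Y (None, _)](congr1 (@^~ (None, Some a)) symY) /= mulrDr -mulr2n mulr_natl.
  rewrite -projY /row_col_proj /joint_proj -proj_sym {1}YE dotDr; congr (_ + _).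
  by rewrite proj_sym /d /row_col_proj /joint_proj [in RHS]proj_sym proj_idem.
have dz : sqnorm d <= sqnorm z by exact: row_col_proj_border_contraction.
have dW : sqnorm d <= sqnorm W.
  have dW1 : sqnorm d <= dot d W by have := pairing z; rewrite -/d; lra.
  have dW2 := cauchy_schwarz d W; have := sqnorm_ge0 d; have := sqnorm_ge0 W; nra.
have qW := cauchy_schwarz q W.
have qd : dot q d ^+ 2 <= sqnorm q * sqnorm W.
  by apply: le_trans (cauchy_schwarz q d) _; rewrite ler_wpM2l // sqnorm_ge0.
have : (2 * dot y z) ^+ 2 <= 4 * (sqnorm q * sqnorm W).
  by rewrite pairing -/q; have := sqr_ge0 (dot q W - dot q d); nra.
by rewrite exprMn; lra.
Qed.

Hypothesis G_hollow : hollow G.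

(* The row at the apex may be chosen freely without changing the left-hand side;
   minus the projection of the column of [F] makes the symmetrized column
   orthogonal to the space of the apex. *)
Lemma apex_transport (F : X -> X -> R) y : (forall i, in_span (G i) (F i)) -> apex_orth y ->
  dot y (fun a => F (Some a) None) ^+ 2 <= sqnorm (row_col_proj G (border y)) *
    \sum_a \sum_b (F (Some a) (Some b) + F (Some b) (Some a)) ^+ 2.
Proof.
move=> /choice[c FE] y_orth; pose column := extend 0 (fun a => F (Some a) None).
have [c0 projE] := proj_in_span (G None) column.
pose c' i := if i is Some _ then c i else fun l => - c0 l.
have F'E i : lincomb (G i) (c' i) = if i is Some a then F i else fun k => - lincomb (G None) c0 k.
  case: i => [a|] //=; apply/funext => k; rewrite /lincomb -sumrN.
  by apply: eq_bigr => l _; rewrite mulNr.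
pose M := lincomb (row_family G) (fun il => c' il.1 il.2).
have ME i k : M (i, k) = lincomb (G i) (c' i) k by rewrite /M lincomb_row_family.
pose Y t := M t + M (transpose t).
have YD a : Y (Some a, None) = column (Some a) - proj (G None) column (Some a).
  by rewrite projE /Y !ME !F'E.
have Y_orth : apex_orth (fun a => Y (Some a, None)).
  move=> l; rewrite -[RHS](proj_residual (G None) column l) /dot [RHS]big_option /=.
  by rewrite G_hollow mulr0 add0r; apply: eq_bigr => a _; rewrite YD.
have -> : dot y (fun a => F (Some a) None) = dot y (fun a => Y (Some a, None)).
  pose p := lincomb (fun l a => G None l (Some a)) c0.
  have p_orth : dot p y = 0 by apply: dot_span0 => [|l]; [eexists|rewrite dotC].
  rewrite (_ : (fun a => Y _) = fun a => F (Some a) None - p a); last first.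
    by apply/funext => a; rewrite YD projE.
  by rewrite dotBr (dotC y p) p_orth subr0.
have -> : \sum_a \sum_b (F (Some a) (Some b) + F (Some b) (Some a)) ^+ 2 =
    \sum_a \sum_b Y (Some a, Some b) ^+ 2.
  by apply: eq_bigr => a _; apply: eq_bigr => b _; rewrite /Y !ME !F'E.
apply: transport_fixed_matrix => //.
- by apply: row_col_proj_symmetrized; eexists.
- by apply/funext => t; rewrite /Y /= transposeK addrC.
- by rewrite /Y !ME !hollow_lincomb // addr0.
Qed.

End ApexTransport.

(** * Reweighting the pairs of vertices *)

Definition flat (R : realType) (X T J : finType) h (G : X -> J -> T -> R) :=
  forall a x, in_span (G a) x -> forall b, x b ^+ 2 <= h * sqnorm x.

Section Reweighting.
Variables (R : realType) (V J : finType) (M : V -> J -> V -> R) (eta : R).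
Hypothesis eta_gt0 : 0 < eta.
Implicit Types (om : V -> V -> R) (f : V -> R).

Definition weighted_energy om a f := \sum_d om a d * f d ^+ 2.

Definition concentrated om a b := exists2 f, in_span (M a) f &
  0 < om a b * f b ^+ 2 /\ eta * weighted_energy om a f <= om a b * f b ^+ 2.

Definition admissible om := [/\ forall a b, om a b = om b a,
  forall a b, 0 <= om a b <= 1 &
  forall a b, om a b < 1 -> concentrated om a b \/ concentrated om b a].

Lemma admissible1 : admissible (fun _ _ => 1).
Proof. by split=> // a b; rewrite ?ltxx // ler01 lexx. Qed.

Lemma weighted_energy_ge0 om a f : (forall a b, 0 <= om a b) -> 0 <= weighted_energy om a f.
Proof. by move=> om0; apply: sumr_ge0 => d _; rewrite mulr_ge0 ?sqr_ge0. Qed.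

Lemma weighted_energy_le om om' a f :
  (forall d, om a d <= om' a d) -> weighted_energy om a f <= weighted_energy om' a f.
Proof. by move=> le_om; apply: ler_sum => d _; rewrite ler_wpM2r // sqr_ge0. Qed.

Lemma concentrated_le om om' a b : (forall d, om' a d <= om a d) -> om' a b = om a b ->
  concentrated om a b -> concentrated om' a b.
Proof.
move=> le_om eq_ab [f Mf [f0 ef]]; exists f; rewrite ?eq_ab //; split=> //.
by apply: le_trans ef; rewrite ler_pM2l //; exact: weighted_energy_le.
Qed.

Lemma admissible_min om om' : admissible om -> admissible om' ->
  admissible (fun a b => Num.min (om a b) (om' a b)).
Proof.
move=> [omC om01 om_conc] [om'C om'01 om'_conc]; split=> [a b|a b|a b].
- by rewrite omC om'C.
- by have := om01 a b; have := om'01 a b; rewrite /Num.min; case: ifP.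
- have lel x d : Num.min (om x d) (om' x d) <= om x d by rewrite ge_min lexx.
  have ler x d : Num.min (om x d) (om' x d) <= om' x d by rewrite ge_min lexx orbT.
  have [le|gt] := leP (om a b) (om' a b).
    move=> /om_conc[] conc; [left|right]; apply: concentrated_le conc => //.
      exact: min_idPl.
    by rewrite om'C omC; exact: min_idPl.
  move=> /om'_conc[] conc; [left|right]; apply: concentrated_le conc => //.
    exact/min_idPr/ltW.
  by rewrite om'C omC; exact/min_idPr/ltW.
Qed.

Definition reweight om a l b := Num.sqrt (om a b) * M a l b.

Lemma lincomb_reweight om a c b :
  lincomb (reweight om a) c b = Num.sqrt (om a b) * lincomb (M a) c b.
Proof. by rewrite /lincomb mulr_sumr; apply: eq_bigr => l _; rewrite mulrCA. Qed.

Lemma in_span_reweight om a f : in_span (M a) f ->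
  in_span (reweight om a) (fun b => Num.sqrt (om a b) * f b).
Proof. by move=> [c ->]; exists c; apply/funext => b; rewrite lincomb_reweight. Qed.

Lemma sqnorm_reweight om a f : (forall a b, 0 <= om a b) ->
  sqnorm (fun b => Num.sqrt (om a b) * f b) = weighted_energy om a f.
Proof. by move=> om0; rewrite sqnormE; apply: eq_bigr => b _; rewrite exprMn sqr_sqrtr. Qed.

Lemma concentrated_leverage om a b : (forall a b, 0 <= om a b) -> concentrated om a b ->
  eta <= leverage (reweight om a) b.
Proof.
move=> om0 [f /(in_span_reweight om)/(sqr_le_leverage b) /=].
rewrite sqnorm_reweight // exprMn sqr_sqrtr // => f_lev [fb0 /le_trans/(_ f_lev)].
have f0 : 0 < weighted_energy om a f.
  apply: lt_le_trans fb0 _; apply: (ler_term_sum (f := fun b => om a b * f b ^+ 2)) => d.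
  by rewrite mulr_ge0 ?sqr_ge0.
by rewrite [leRHS]mulrC ler_pM2r.
Qed.

Lemma num_nonzero_reweight om a : (num_nonzero (reweight om a) <= num_nonzero (M a))%N.
Proof. by apply: num_nonzero_le => l Ml0; apply/funext => b; rewrite /reweight Ml0 mulr0. Qed.

Lemma admissible_card om : admissible om ->
  #|[set p | om p.1 p.2 < 1]%SET|%:R * eta <= 2 * (\sum_a num_nonzero (M a))%:R.
Proof.
move=> [_ om01 om_conc]; have om0 a b : 0 <= om a b by case/andP: (om01 a b).
pose lev a b := leverage (reweight om a) b.
have lev0 a b : 0 <= lev a b by exact: leverage_ge0.
rewrite -sumr_bool mulr_suml.
apply: (@le_trans _ _ (\sum_a \sum_b (lev a b + lev b a))).
  rewrite pair_bigA; apply: ler_sum => -[a b] _ /=.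
  case: ltP => [/om_conc[]/(concentrated_leverage om0) lev_ge|_]; rewrite ?mul1r ?mul0r.
  - by apply: le_trans lev_ge _; rewrite lerDl.
  - by apply: le_trans lev_ge _; rewrite lerDr.
  - by rewrite addr_ge0.
rewrite (eq_bigr (fun a => \sum_b lev a b + \sum_b lev b a)) => [|a _]; last exact: big_split.
rewrite big_split /= [X in _ + X]exchange_big /= -mulr2n -[leLHS]mulr_natl ler_pM2l // natr_sum.
apply: ler_sum => a _; apply: le_trans (sum_leverage_le _) _.
by rewrite ler_nat num_nonzero_reweight.
Qed.

Definition min_weight a b := inf [set om a b | om in admissible].

Lemma min_weight_le om a b : admissible om -> min_weight a b <= om a b.
Proof.
move=> om_adm; apply: ge_inf; last by exists om.
by exists 0 => _ [om' [_ om'01 _] <-]; case/andP: (om'01 a b).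
Qed.

Lemma min_weight_ge0 a b : 0 <= min_weight a b.
Proof.
apply: lb_le_inf; first by exists 1; exists (fun _ _ => 1) => //; exact: admissible1.
by move=> _ [om' [_ om'01 _] <-]; case/andP: (om'01 a b).
Qed.

Lemma min_weight_le1 a b : min_weight a b <= 1.
Proof. exact: min_weight_le admissible1. Qed.

Lemma min_weightC a b : min_weight a b = min_weight b a.
Proof.
by rewrite /min_weight; congr inf; apply/seteqP; split=> _ [om adm <-]; exists om => //; case: adm.
Qed.

Lemma min_weight_approx (phi : V -> V -> R) : (forall a b, min_weight a b < phi a b) ->
  exists2 om, admissible om & forall a b, om a b < phi a b.
Proof.
move=> lt_phi.
suff approx_seq (s : seq (V * V)) : exists2 om, admissible om &
    forall p, p \in s -> om p.1 p.2 < phi p.1 p.2.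
  have [om om_adm lt_om] := approx_seq (enum {: V * V}); exists om => // a b.
  by apply: (lt_om (a, b)); rewrite mem_enum.
elim: s => [|[a b] s [om om_adm lt_om]].
  by exists (fun _ _ => 1) => //; exact: admissible1.
have [|_ [om' om'_adm <-] lt_om'] := inf_lt _ (lt_phi a b).
  by exists 1; exists (fun _ _ => 1) => //; exact: admissible1.
exists (fun a b => Num.min (om a b) (om' a b)); first exact: admissible_min.
by move=> p; rewrite inE gt_min => /orP[/eqP->|/lt_om->//]; rewrite lt_om' orbT.
Qed.

Definition overconcentrated om a b f :=
  2 * eta * weighted_energy om a f < om a b * f b ^+ 2.

Lemma overconcentrated_approx a b f : overconcentrated min_weight a b f ->
  exists om, [/\ admissible om, om a b < 2 * min_weight a b & overconcentrated om a b f].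
Proof.
rewrite /overconcentrated; set W := weighted_energy _ _ _ => conc_f.
have W0 : 0 <= W by apply: weighted_energy_ge0; exact: min_weight_ge0.
pose F2 := \sum_d f d ^+ 2.
have F20 : 0 <= F2 by apply: sumr_ge0 => d _; rewrite sqr_ge0.
have ab0 : 0 < min_weight a b.
  rewrite lt_def min_weight_ge0 andbT; apply: contraTneq conc_f => ->.
  by rewrite mul0r -leNgt mulr_ge0 // mulr_ge0 // ltW.
pose gap := min_weight a b * f b ^+ 2 - 2 * eta * W.
have den0 : 0 < 2 * eta * F2 + 1 by have := ltW eta_gt0; nra.
pose slack := gap / (2 * eta * F2 + 1).
have slack0 : 0 < slack by rewrite divr_gt0 // subr_gt0.
have slackE : slack * (2 * eta * F2 + 1) = gap by rewrite /slack divfK // gt_eqF.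
pose dl := Num.min slack (min_weight a b).
have [|om om_adm lt_om] := @min_weight_approx (fun a b => min_weight a b + dl).
  by move=> x y; rewrite ltrDl lt_min slack0.
have dl_slack : dl <= slack by rewrite ge_min lexx.
have dl_ab : dl <= min_weight a b by rewrite ge_min lexx orbT.
exists om; split=> //; first by have := lt_om a b; lra.
have W_om : weighted_energy om a f <= W + slack * F2.
  rewrite mulr_sumr -big_split; apply: ler_sum => d _ /=.
  by rewrite -mulrDl ler_wpM2r ?sqr_ge0 //; have := lt_om a d; lra.
apply: (@lt_le_trans _ _ (min_weight a b * f b ^+ 2)); last first.
  by rewrite ler_wpM2r ?sqr_ge0 // min_weight_le.
apply: (@le_lt_trans _ _ (2 * eta * (W + slack * F2))).
  by rewrite ler_pM2l // mulr_gt0.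
by move: slackE; rewrite /gap; lra.
Qed.

Definition halve om a b x y :=
  if ((x, y) == (a, b)) || ((x, y) == (b, a)) then om x y / 2 else om x y.

Lemma admissible_halve om a b f : a != b -> in_span (M a) f -> overconcentrated om a b f ->
  admissible om -> admissible (halve om a b).
Proof.
move=> neq_ab Mf conc_f [omC om01 om_conc].
have om0 x y : 0 <= om x y by case/andP: (om01 x y).
have halve_le x y : halve om a b x y <= om x y.
  by rewrite /halve; case: ifP => // _; have := om0 x y; lra.
have halve0 x y : 0 <= halve om a b x y.
  by rewrite /halve; case: ifP => // _; rewrite divr_ge0.
have halveC x y : halve om a b x y = halve om a b y x.
  by rewrite /halve omC !xpair_eqE orbC andbC [in X in _ || X]andbC.
have conc_ab : concentrated (halve om a b) a b.
  exists f => //; rewrite {1 3}/halve eqxx.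
  have W0 : 0 <= eta * weighted_energy (halve om a b) a f.
    by rewrite mulr_ge0 ?(ltW eta_gt0) // weighted_energy_ge0.
  have W_le : eta * weighted_energy (halve om a b) a f <= eta * weighted_energy om a f.
    by rewrite ler_pM2l //; exact: weighted_energy_le.
  by rewrite mulrAC; move: conc_f; rewrite /overconcentrated -mulrA; split; lra.
split=> // x y; first by rewrite halve0 (le_trans (halve_le x y)) //; case/andP: (om01 x y).
have [/orP[]/eqP[-> ->]|xy] := boolP (((x, y) == (a, b)) || ((x, y) == (b, a))).
- by left.
- by right.
have halveE : halve om a b x y = om x y by rewrite /halve (negPf xy).
rewrite halveE => /om_conc[] conc; [left|right]; apply: concentrated_le conc => //.
by rewrite halveC halveE omC.
Qed.

Hypothesis M_hollow : hollow M.

Lemma min_weight_not_overconcentrated a b f : in_span (M a) f ->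
  ~ overconcentrated min_weight a b f.
Proof.
move=> Mf /[dup] conc_f /overconcentrated_approx[om [om_adm om_lt conc_om]].
have neq_ab : a != b.
  apply: contraTneq conc_f => <-; rewrite /overconcentrated -leNgt.
  have [c ->] := Mf; rewrite (hollow_lincomb _ _ M_hollow) expr0n mulr0.
  by rewrite mulr_ge0 ?weighted_energy_ge0 ?mulr_ge0 ?(ltW eta_gt0) //; exact: min_weight_ge0.
have := min_weight_le a b (admissible_halve neq_ab Mf conc_om om_adm).
by rewrite /halve eqxx /=; lra.
Qed.

Lemma flat_reweight_min : flat (2 * eta) (reweight min_weight).
Proof.
move=> a _ [c ->] b; have mw0 x y := min_weight_ge0 x y.
rewrite (_ : lincomb _ c = fun b => Num.sqrt (min_weight a b) * lincomb (M a) c b); last first.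
  by apply/funext => b'; rewrite lincomb_reweight.
rewrite sqnorm_reweight // exprMn sqr_sqrtr // leNgt; apply/negP.
by apply: min_weight_not_overconcentrated; exists c.
Qed.

Lemma min_weight_card :
  #|[set p | min_weight p.1 p.2 < 1]%SET|%:R * eta <= 2 * (\sum_a num_nonzero (M a))%:R.
Proof.
have [|om om_adm lt_om] := @min_weight_approx (fun a b => if min_weight a b < 1 then 1 else 2).
  by move=> a b; case: ifP => // _; apply: le_lt_trans (min_weight_le1 a b) _; rewrite ltr1n.
apply: le_trans (admissible_card om_adm); rewrite ler_pM2r // ler_nat.
apply: subset_leq_card; apply/fintype.subsetP => -[a b]; rewrite !inE /= => lt_ab.
by have := lt_om a b; rewrite lt_ab.
Qed.

End Reweighting.

(** * Averages over finite types *)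

Lemma expn_fact_le n m : (2 * m ^ 2 <= n)%N -> (n ^ m * (n - m)`! <= 2 * n`!)%N.
Proof.
move=> m2n; have mn : (m <= n)%N.
  by apply: leq_trans m2n; case: m => // m; rewrite expnS expn1 mulnA leq_pmull.
case: (posnP n) mn m2n => [->|n0 mn m2n]; first by case: m.
rewrite -(ffact_fact mn) mulnA leq_pmul2r ?fact_gt0 //.
apply: (@leq_trans (2 * (n - m) ^ m)); last first.
  rewrite leq_pmul2l // ffact_prod -[X in ((n - m) ^ X <= _)%N]card_ord -prod_nat_const.
  by apply: leq_prod => i _; rewrite leq_sub2l // ltnW.
rewrite -(ler_nat rat) natrM !natrX natrB //.
have n0' : 0 < n%:R :> rat by rewrite ltr0n.
pose x : rat := m%:R / n%:R.
have -> : (n%:R - m%:R : rat) = n%:R * (1 - x) by rewrite /x; field; rewrite gt_eqF.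
rewrite exprMn mulrCA ler_peMr ?exprn_ge0 ?ler0n //.
have x01 : 0 <= x <= 1 by rewrite divr_ge0 ?ler0n //= ler_pdivrMr // mul1r ler_nat.
have := weierstrass_product (index_enum 'I_m) (fun=> x01).
rewrite sumr_ord_const prodr_const card_ord.
have : m%:R * x <= 1 / 2.
  by rewrite mulrA ler_pdivrMr //; move: m2n; rewrite -(ler_nat rat) natrM natrX expr2; lra.
lra.
Qed.

Section Averages.
Variable R : realType.

Definition avg (T : finType) (F : T -> R) := (#|T|%:R)^-1 * \sum_t F t.

Lemma avg_ge0 (T : finType) (F : T -> R) : (forall t, 0 <= F t) -> 0 <= avg F.
Proof. by move=> F0; rewrite mulr_ge0 ?invr_ge0 ?sumr_ge0. Qed.

Lemma ler_avg (T : finType) (F F' : T -> R) : (forall t, F t <= F' t) -> avg F <= avg F'.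
Proof. by move=> FF'; rewrite ler_wpM2l ?invr_ge0 ?ler_sum. Qed.

Lemma avg_sum (T I : finType) (P : pred I) (F : I -> T -> R) :
  avg (fun t => \sum_(i | P i) F i t) = \sum_(i | P i) avg (F i).
Proof. by rewrite /avg exchange_big mulr_sumr. Qed.

Lemma avgD (T : finType) (F F' : T -> R) : avg (fun t => F t + F' t) = avg F + avg F'.
Proof. by rewrite /avg big_split mulrDr. Qed.

Lemma avgZ (T : finType) a (F : T -> R) : avg (fun t => a * F t) = a * avg F.
Proof. by rewrite /avg -mulr_sumr mulrCA. Qed.

Lemma avg_cst (T : finType) a : (0 < #|T|)%N -> avg (fun _ : T => a) = a.
Proof.
move=> T0; rewrite /avg sumr_const -[X in _ * X]mulr_natl mulrA mulVf ?mul1r //.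
by rewrite pnatr_eq0 -lt0n.
Qed.

Lemma avg_le_cst (T : finType) (F : T -> R) a :
  (0 < #|T|)%N -> (forall t, F t <= a) -> avg F <= a.
Proof. by move=> T0 Fa; rewrite -(avg_cst a T0); exact: ler_avg. Qed.

Lemma markov_avg (T : finType) (F : T -> R) (a : R) : 0 < a -> (forall t, 0 <= F t) ->
  avg (fun t => (a < F t)%R%:R) <= avg F / a.
Proof.
move=> a0 F0; rewrite mulrC -avgZ; apply: ler_avg => t.
case: ltP => [aF|_]; last by rewrite mulr_ge0 // invr_ge0 ltW.
by rewrite mulrC ler_pdivlMr // mul1r ltW.
Qed.

Lemma avg_reindex (T T' : finType) (h : T' -> T) (F : T -> R) :
  bijective h -> avg F = avg (F \o h).
Proof.
move=> h_bij; rewrite /avg (bij_eq_card h_bij); congr (_ * _).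
by rewrite (reindex h) //; exact: onW_bij.
Qed.

Lemma avg_pair (T T' : finType) (F : T -> T' -> R) :
  avg (fun p : T * T' => F p.1 p.2) = avg (fun t => avg (F t)).
Proof. by rewrite /avg -(pair_bigA _ F) /= card_prod natrM invfM -mulrA mulr_sumr. Qed.

Lemma avg_exchange (T T' : finType) (F : T -> T' -> R) :
  avg (fun t => avg (F t)) = avg (fun t' => avg (fun t => F t t')).
Proof. by rewrite /avg -!mulr_sumr exchange_big mulrCA. Qed.

Section Samples.
Variable V : finType.

Lemma avg_ffun_unit (F : V -> R) : avg (fun y : {ffun unit -> V} => F (y tt)) = avg F.
Proof.
rewrite [RHS](@avg_reindex _ _ (fun y : {ffun unit -> V} => y tt)) //.
exists (fun v => [ffun=> v]) => [y|v]; last by rewrite ffunE.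
by apply/ffunP => -[]; rewrite ffunE.
Qed.

Lemma avg_extend (A : finType) (F : (option A -> V) -> R) :
  avg (fun x : {ffun option A -> V} => F x) =
  avg (fun v => avg (fun y : {ffun A -> V} => F (extend v y))).
Proof.
rewrite -(avg_pair (fun v (y : {ffun A -> V}) => F (extend v y))).
pose h (p : V * {ffun A -> V}) : {ffun option A -> V} := [ffun o => extend p.1 p.2 o].
rewrite (@avg_reindex _ _ h).
  by congr avg; apply/funext => p /=; congr F; apply/funext => o; rewrite ffunE.
exists (fun x : {ffun option A -> V} => (x None, [ffun a => x (Some a)])) => [[v y]|x].
  by congr pair; [rewrite ffunE|apply/ffunP => a; rewrite !ffunE].
by apply/ffunP => -[a|]; rewrite !ffunE /= ?ffunE.
Qed.

Lemma avg_glue (A B : finType) (F : (A + B -> V) -> R) :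
  avg (fun x : {ffun A + B -> V} => F x) =
  avg (fun y : {ffun A -> V} => avg (fun z : {ffun B -> V} => F (glue y z))).
Proof.
rewrite -(avg_pair (fun (y : {ffun A -> V}) (z : {ffun B -> V}) => F (glue y z))).
pose h (p : {ffun A -> V} * {ffun B -> V}) : {ffun A + B -> V} := [ffun i => glue p.1 p.2 i].
rewrite (@avg_reindex _ _ h).
  by congr avg; apply/funext => p /=; congr F; apply/funext => o; rewrite ffunE.
exists (fun x : {ffun A + B -> V} => ([ffun a => x (inl a)], [ffun b => x (inr b)])) => [[y z]|x].
  by congr pair; apply/ffunP => a; rewrite !ffunE.
by apply/ffunP => -[a|b]; rewrite /h ffunE /= ffunE.
Qed.

Lemma avg_prod (A B : finType) (phi : (B -> V) -> R) :
  avg (fun z : {ffun A * B -> V} => \prod_a phi (fun b => z (a, b))) =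
  avg (fun S : {ffun B -> V} => phi S) ^+ #|A|.
Proof.
pose h (p : {ffun A -> {ffun B -> V}}) : {ffun A * B -> V} := [ffun ab => p ab.1 ab.2].
rewrite (@avg_reindex _ _ h); last first.
  exists (fun z : {ffun A * B -> V} => [ffun a => [ffun b => z (a, b)]]) => [p|z].
    by apply/ffunP => a; apply/ffunP => b; rewrite !ffunE.
  by apply/ffunP => -[a b]; rewrite !ffunE.
transitivity (avg (fun p : {ffun A -> {ffun B -> V}} => \prod_a phi (p a))).
  congr avg; apply/funext => p /=; apply: eq_bigr => a _; congr phi.
  by apply/funext => b; rewrite ffunE.
rewrite /avg card_ffun -(bigA_distr_bigA (fun (_ : A) (S : {ffun B -> V}) => phi S)) /=.
by rewrite prodr_const exprMn natrX exprVn.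
Qed.

Lemma avg_exchangeable (X : finType) (Phi : (X -> V) -> X -> R) c0 :
  (forall x (sg : {perm X}) c, Phi (x \o sg) c = Phi x (sg c)) ->
  #|X|%:R * avg (fun x : {ffun X -> V} => Phi x c0) =
  avg (fun x : {ffun X -> V} => \sum_c Phi x c).
Proof.
move=> Phi_exch; rewrite avg_sum (eq_bigr (fun=> avg (fun x : {ffun X -> V} => Phi x c0))).
  by rewrite sumr_const mulr_natl.
move=> c _; pose swap (x : {ffun X -> V}) := [ffun i => x (tperm c0 c i)].
rewrite [RHS](@avg_reindex _ _ swap).
  congr avg; apply/funext => x /=; rewrite -[X in Phi x X](tpermL c0 c) -Phi_exch.
  by congr Phi; apply/funext => i; rewrite /= ffunE.
by exists swap => x; apply/ffunP => i; rewrite !ffunE tpermK.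
Qed.

Lemma card_perm_fiber_le (I : finType) (iota : I -> V) (x : {ffun I -> V}) : injective iota ->
  (#|[set s : {perm V} | [ffun i => s (iota i)] == x]%SET| <= (#|V| - #|I|)`!)%N.
Proof.
move=> iota_inj; set fiber := [set s | _]%SET.
have [->|[s0 s0x]] := set_0Vmem fiber; first by rewrite cards0.
have := s0x; rewrite inE => /eqP/ffunP s0E.
have -> : (#|V| - #|I| = #|~: (iota @: I)|)%N.
  by rewrite cardsCs finset.setCK card_imset.
rewrite -card_perm -(card_imset _ (mulIg s0^-1%g)).
apply: subset_leq_card; apply/fintype.subsetP => t /imsetP[s]; rewrite inE => /eqP/ffunP sE ->.
rewrite unfold_in; apply/fintype.subsetP => v; rewrite !inE; apply: contraNN.
move=> /imsetP[i _ ->]; have := sE i; rewrite -(s0E i) !ffunE => s_s0.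
by rewrite permM s_s0 permK.
Qed.

Lemma card_permT : #|{perm V}| = (#|V|)`!.
Proof.
rewrite -(cardsT V) -card_perm; apply: eq_card => s; rewrite inE.
by apply/esym/fintype.subsetP => v _; rewrite inE.
Qed.

Lemma avg_perm_le (I : finType) (iota : I -> V) (F : {ffun I -> V} -> R) :
  injective iota -> (2 * #|I| ^ 2 <= #|V|)%N -> (forall x, 0 <= F x) ->
  avg (fun s : {perm V} => F [ffun i => s (iota i)]) <= 2 * avg F.
Proof.
move=> iota_inj IV F0; rewrite /avg.
rewrite (partition_big (fun s : {perm V} => [ffun i => s (iota i)]) xpredT) //=.
rewrite card_permT card_ffun mulrCA mulr_sumr mulrA mulr_sumr; apply: ler_sum => x _.
rewrite (eq_bigr (fun=> F x)) => [|s /eqP->//]; rewrite sumr_const.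
rewrite -[X in _ * X <= _]mulr_natr mulrCA [leRHS]mulrC ler_wpM2l //.
apply: (@le_trans _ _ ((#|V|)`!%:R^-1 * ((#|V| - #|I|)`!)%:R)).
  rewrite ler_wpM2l ?invr_ge0 ?ler0n // ler_nat.
  by apply: leq_trans (card_perm_fiber_le x iota_inj); rewrite cardsE.
have V0 : 0 < (#|V|)`!%:R :> R by rewrite ltr0n fact_gt0.
have VI0 : 0 < (#|V| ^ #|I|)%:R :> R.
  rewrite ltr0n expn_gt0; case: (posnP #|V|) IV => // ->.
  by rewrite leqn0 muln_eq0 /= expn_eq0 andbT.
rewrite [leLHS]mulrC ler_pdivrMr // [_^-1 * 2]mulrC mulrAC ler_pdivlMr //.
by rewrite -!natrM ler_nat mulnC expn_fact_le.
Qed.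

End Samples.

Lemma expR_le_quadratic (y : R) : `|y| <= 1 / 2 -> expR y <= 1 + y + 2 * y ^+ 2.
Proof.
rewrite ler_norml => /andP[y_ge y_le].
have inv_ge : 1 <= (1 - y) * (1 + y + 2 * y ^+ 2) by have := sqr_ge0 y; nra.
have := expR_ge1Dx (- y); rewrite expRN => exp_ge.
have : (1 - y) * expR y <= 1.
  by rewrite -[leRHS](mulVf (lt0r_neq0 (expR_gt0 y))) ler_pM2r ?expR_gt0.
by move=> /le_trans/(_ inv_ge); rewrite ler_pM2l //; lra.
Qed.

Lemma avg_expR_le (V : finType) (X : V -> R) b :
  (0 < #|V|)%N -> \sum_v X v = 0 -> (forall v, `|X v| <= b) -> b <= 1 / 2 ->
  avg (fun v => expR (X v)) <= expR (2 * b ^+ 2).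
Proof.
move=> V0 X0 Xb b_le; apply: le_trans (expR_ge1Dx _); rewrite /avg mulrC ler_pdivrMr ?ltr0n //.
have -> : (1 + 2 * b ^+ 2) * #|V|%:R = \sum_(v : V) (1 + X v + 2 * b ^+ 2).
  by rewrite !big_split /= X0 addr0 !sumr_const mulrDl mul1r -[X in _ = _ + X]mulr_natr.
apply: ler_sum => v _.
apply: le_trans (expR_le_quadratic (le_trans (Xb v) b_le)) _.
rewrite lerD2l ler_pM2l // -[leLHS]real_normK ?num_real // lerXn2r // ?nnegrE ?normr_ge0 //.
exact: le_trans (Xb v).
Qed.

Section Hoeffding.
Variables (V I : finType) (X : V -> R) (B : R).
Hypothesis V_gt0 : (0 < #|V|)%N.
Hypothesis X_centered : \sum_v X v = 0.
Hypothesis X_le : forall v, `|X v| <= B.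

Lemma chernoff_avg lam t : 0 < lam -> lam * B <= 1 / 2 ->
  avg (fun x : {ffun I -> V} => (t < \sum_i X (x i))%R%:R) <=
  expR (#|I|%:R * (2 * (lam * B) ^+ 2) - lam * t).
Proof.
move=> lam0 lamB.
apply: (@le_trans _ _ (avg (fun x : {ffun I -> V} =>
  expR (- (lam * t)) * \prod_i expR (lam * X (x i))))).
  apply: ler_avg => x; rewrite -expR_sum -expRD -mulr_sumr.
  case: ltP => [t_lt|_]; last exact: expR_ge0.
  by rewrite -[leLHS]expR0 ler_expR addrC subr_ge0 ler_pM2l // ltW.
rewrite avgZ addrC expRD ler_pM2l ?expR_gt0 //.
rewrite /avg card_ffun -(bigA_distr_bigA (fun (_ : I) v => expR (lam * X v))) /= prodr_const.
rewrite natrX -exprVn -exprMn expRM_natl -/(avg _).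
apply: lerXn2r; rewrite ?nnegrE ?expR_ge0 //; first by apply: avg_ge0 => v; exact: expR_ge0.
apply: avg_expR_le => // [|v]; first by rewrite -mulr_sumr X_centered mulr0.
by rewrite normrM (gtr0_norm lam0) ler_pM2l.
Qed.

Hypothesis I_gt0 : (0 < #|I|)%N.
Hypothesis B_gt0 : 0 < B.

Lemma hoeffding_avg t : 0 < t <= 2 * #|I|%:R * B ->
  avg (fun x : {ffun I -> V} => (t < \sum_i X (x i))%R%:R) <=
  expR (- (t ^+ 2 / (8 * #|I|%:R * B ^+ 2))).
Proof.
move=> /andP[t0 t_le]; have s0 : 0 < #|I|%:R :> R by rewrite ltr0n.
pose lam := t / (4 * #|I|%:R * B ^+ 2).
have lam0 : 0 < lam by rewrite divr_gt0 // !mulr_gt0 // exprn_gt0.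
apply: le_trans (chernoff_avg t lam0 _) _.
  have -> : lam * B = t / (4 * #|I|%:R * B) by rewrite /lam; field; rewrite !gt_eqF.
  by rewrite ler_pdivrMr ?mulr_gt0 //; lra.
rewrite ler_expR; apply: ler_eq.
by rewrite /lam; field; rewrite !gt_eqF.
Qed.

End Hoeffding.

Lemma hoeffding_avg_norm (V I : finType) (X : V -> R) (B t : R) :
  (0 < #|V|)%N -> (0 < #|I|)%N -> \sum_v X v = 0 -> (forall v, `|X v| <= B) -> 0 < B ->
  0 < t <= 2 * #|I|%:R * B ->
  avg (fun x : {ffun I -> V} => (t < `|\sum_i X (x i)|)%R%:R) <=
  2 * expR (- (t ^+ 2 / (8 * #|I|%:R * B ^+ 2))).
Proof.
move=> V0 I0 X0 XB B0 t_le.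
apply: (@le_trans _ _ (avg (fun x : {ffun I -> V} =>
  (t < \sum_i X (x i))%R%:R + (t < \sum_i - X (x i))%R%:R))).
  apply: ler_avg => x; rewrite -natrD ler_nat sumrN ltr_normr.
  by case: (_ < _); case: (_ < _).
rewrite avgD [leRHS]mulr_natl mulr2n; apply: lerD; first exact: hoeffding_avg.
by apply: (hoeffding_avg (X := fun v => - X v)) => // [|v]; rewrite ?sumrN ?X0 ?oppr0 ?normrN.
Qed.

End Averages.

(** * Regular samples *)

Section GramDeviation.
Variables (R : realType) (V J : finType) (g : J -> V -> R).
Notation n := (#|V|%:R : R).
Implicit Types (f : V -> R).

Definition gram_deviation l m (b : V) : R :=
  basis g l b * basis g m b - ((l == m) && basis_mask g l)%:R / n.

Lemma parseval f : in_span g f -> sqnorm f = \sum_l dot f (basis g l) ^+ 2.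
Proof.
move=> gf; rewrite -{1}(proj_fix_span gf) dot_expansion.
by apply: eq_bigr => l _; rewrite expr2.
Qed.

Lemma sqnorm_sample (I : finType) (x : I -> V) f : in_span g f ->
  sqnorm (f \o x) = #|I|%:R / n * sqnorm f +
    \sum_l \sum_m dot f (basis g l) * dot f (basis g m) * \sum_i gram_deviation l m (x i).
Proof.
move=> gf; pose d l := dot f (basis g l); rewrite (parseval gf) mulr_sumr -big_split /=.
have fE v : f v = \sum_l d l * basis g l v by rewrite -[in LHS](proj_fix_span gf).
transitivity (\sum_l \sum_m d l * d m * \sum_i basis g l (x i) * basis g m (x i)).
  under [RHS]eq_bigr => l _ do under eq_bigr => m _ do rewrite mulr_sumr.
  under [RHS]eq_bigr => l _ do rewrite exchange_big /=.
  rewrite exchange_big /=; apply: eq_bigr => i _.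
  rewrite /= fE mulr_suml; apply: eq_bigr => l _; rewrite mulr_sumr.
  by apply: eq_bigr => m _; ring.
apply: eq_bigr => l _; rewrite -/(d l).
have -> : #|I|%:R / n * d l ^+ 2 =
    \sum_m d l * d m * (#|I|%:R * ((l == m) && basis_mask g l)%:R / n).
  rewrite (bigD1 l) //= big1 ?addr0 => [|m ml]; last by rewrite eq_sym (negPf ml) mulr0 mul0r mulr0.
  rewrite eqxx /=; have := orthonormal_coord f l (basis_orthonormal g); rewrite -/(d l) => <-.
  by case: (basis_mask g l) => /=; ring.
rewrite -big_split; apply: eq_bigr => m _ /=; rewrite -/(d m) -mulrDr; congr (_ * _).
by rewrite sumrB sumr_const -[X in _ - X]mulr_natl; ring.
Qed.

Lemma gram_error_le (D : J -> J -> R) tau f : in_span g f -> 0 <= tau ->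
  (forall l m, basis_mask g l -> basis_mask g m -> `|D l m| <= tau) ->
  `|\sum_l \sum_m dot f (basis g l) * dot f (basis g m) * D l m| <=
  tau * ((dim_span g)%:R * sqnorm f).
Proof.
move=> gf tau0 D_le; pose d l := dot f (basis g l); pose b l : R := (basis_mask g l)%:R.
have normd l : `|d l| = `|d l| * b l.
  rewrite /d -(orthonormal_coord f l (basis_orthonormal g)) -/(b l) normrM /b.
  by case: (basis_mask g l); rewrite ?mulr1 // normr0 !mul0r.
apply: (@le_trans _ _ (tau * (\sum_l `|d l| * b l) ^+ 2)).
  apply: le_trans (ler_norm_sum _ _ _) _.
  rewrite expr2 mulr_suml mulr_sumr; apply: ler_sum => l _.
  apply: le_trans (ler_norm_sum _ _ _) _.
  rewrite !mulr_sumr; apply: ler_sum => m _; rewrite !normrM.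
  case bl : (basis_mask g l); last by rewrite -/(d l) normd /b bl mulr0 !mul0r mulr0.
  case bm : (basis_mask g m); last by rewrite -/(d m) (normd m) /b bm !mulr0 mul0r.
  by rewrite -!normd mulrC ler_wpM2r ?mulr_ge0 ?normr_ge0 //; exact: D_le.
rewrite ler_wpM2l // (parseval gf) mulrC.
apply: le_trans (cauchy_schwarz (fun l => `|d l|) b) _.
rewrite sqnormE; under eq_bigr => l _ do rewrite real_normK ?num_real //.
rewrite ler_wpM2l ?sumr_ge0 // => [l _|]; first exact: sqr_ge0.
rewrite natr_sum; apply: ler_sum => l _.
by rewrite /b; case: (basis_mask g l); rewrite ?mulr1 ?mulr0.
Qed.

Lemma small_gram_deviation (I : finType) (x : I -> V) tau : 0 <= tau ->
  (forall l m, basis_mask g l -> basis_mask g m -> `|\sum_i gram_deviation l m (x i)| <= tau) ->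
  forall f, in_span g f ->
  (#|I|%:R / n - tau * (dim_span g)%:R) * sqnorm f <= sqnorm (f \o x).
Proof.
move=> tau0 dev f gf; rewrite (sqnorm_sample x gf) mulrBl lerD2l -mulrA lerNl.
by apply: le_trans (gram_error_le gf tau0 dev); rewrite -normrN ler_norm.
Qed.

Hypothesis V_gt0 : (0 < #|V|)%N.
Variable h : R.
Hypothesis h_ge : n^-1 <= h.
Hypothesis basis_le : forall l v, basis g l v ^+ 2 <= h.

Let n_gt0 : 0 < n. Proof. by rewrite ltr0n. Qed.

Lemma gram_deviation_centered l m : \sum_v gram_deviation l m v = 0.
Proof.
rewrite /gram_deviation sumrB -/(dot (basis g l) (basis g m)) (basis_orthonormal g).
by rewrite sumr_const -[X in _ - X]mulr_natr divfK ?gt_eqF // subrr.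
Qed.

Lemma gram_deviation_le l m v : `|gram_deviation l m v| <= 2 * h.
Proof.
apply: le_trans (ler_normB _ _) _; rewrite [leRHS]mulr_natl mulr2n lerD //.
  rewrite normrM; have := basis_le l v; have := basis_le m v.
  rewrite -(real_normK (num_real (basis g l v))) -(real_normK (num_real (basis g m v))).
  by have := sqr_ge0 (`|basis g l v| - `|basis g m v|); nra.
rewrite ger0_norm ?divr_ge0 ?ler0n //; apply: le_trans h_ge.
by case: (_ && _); rewrite ?mul1r // mul0r invr_ge0 ltW.
Qed.

Lemma gram_deviation_tail (I : finType) l m tau : (0 < #|I|)%N ->
  0 < tau <= 4 * #|I|%:R * h ->
  avg (fun x : {ffun I -> V} => (tau < `|\sum_i gram_deviation l m (x i)|)%R%:R) <=
  2 * expR (- (tau ^+ 2 / (32 * #|I|%:R * h ^+ 2))).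
Proof.
move=> I0 tau_le; have h0 : 0 < h by apply: lt_le_trans h_ge; rewrite invr_gt0.
apply: le_trans (hoeffding_avg_norm V_gt0 I0 (gram_deviation_centered l m)
  (gram_deviation_le l m) _ _) _; [by rewrite mulr_gt0|lra|].
by rewrite (_ : 32 * _ * _ = 8 * #|I|%:R * (2 * h) ^+ 2) //; ring.
Qed.

End GramDeviation.

Definition regular (R : realType) (V J : finType) (G : V -> J -> V -> R) (rho : R)
    (I : finType) (x : I -> V) :=
  forall a f, in_span (G a) f -> rho * sqnorm f <= sqnorm (f \o x).

Section RegularSamples.
Variables (R : realType) (V J I : finType) (G : V -> J -> V -> R) (K h : R).
Notation n := (#|V|%:R : R).
Notation s := (#|I|%:R : R).
Hypothesis V_gt0 : (0 < #|V|)%N.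
Hypothesis K_ge1 : 1 <= K.
Hypothesis G_rows : forall a, (num_nonzero (G a))%:R <= K.
Hypothesis G_flat : flat h G.
Hypothesis h_ge : n^-1 <= h.

Let n_gt0 : 0 < n. Proof. by rewrite ltr0n. Qed.
Let K_gt0 : 0 < K. Proof. exact: lt_le_trans K_ge1. Qed.
Let h_gt0 : 0 < h. Proof. by apply: lt_le_trans h_ge; rewrite invr_gt0. Qed.

Let tau : R := s / (2 * n * K).

Lemma dim_span_rows a : (dim_span (G a))%:R <= K.
Proof. by apply: le_trans (G_rows a); rewrite ler_nat dim_span_le. Qed.

Lemma regular_of_gram_deviation (x : I -> V) :
  (forall a l m, basis_mask (G a) l -> basis_mask (G a) m ->
    `|\sum_i gram_deviation (G a) l m (x i)| <= tau) ->
  regular G (s / (2 * n)) x.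
Proof.
move=> dev a f Gf; have tau0 : 0 <= tau by rewrite divr_ge0 // !mulr_ge0 // ltW.
apply: le_trans (small_gram_deviation tau0 (dev a) Gf).
rewrite ler_wpM2r ?sqnorm_ge0 // lerBrDr.
have -> : s / n = s / (2 * n) + tau * K by rewrite /tau; field; rewrite !gt_eqF.
by rewrite lerD2l ler_wpM2l // dim_span_rows.
Qed.

Lemma basis_flat a l v : basis (G a) l v ^+ 2 <= h.
Proof.
apply: le_trans (G_flat (basis_in_span (G a) l) v) _.
by rewrite (basis_orthonormal (G a)) eqxx; case: (basis_mask _ _); rewrite ?mulr1 // mulr0 ltW.
Qed.

Lemma irregular_le_deviations (x : I -> V) : (~~ `[< regular G (s / (2 * n)) x >])%:R <=
  \sum_a \sum_l \sum_m (basis_mask (G a) l)%:R * (basis_mask (G a) m)%:R *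
    (tau < `|\sum_i gram_deviation (G a) l m (x i)|)%R%:R :> R.
Proof.
pose term a l m : R := (basis_mask (G a) l)%:R * (basis_mask (G a) m)%:R *
  (tau < `|\sum_i gram_deviation (G a) l m (x i)|)%R%:R.
have term0 a l m : 0 <= term a l m by rewrite !mulr_ge0.
case: asboolP => [_|irr] /=; first by do 3 (apply: sumr_ge0 => ? _).
have [a [l [m [bl bm dev]]]] : exists a l m, [/\ basis_mask (G a) l, basis_mask (G a) m &
    tau < `|\sum_i gram_deviation (G a) l m (x i)|].
  apply: contrapT => no_dev; apply: irr; apply: regular_of_gram_deviation => a l m bl bm.
  by rewrite leNgt; apply/negP => dev; apply: no_dev; exists a, l, m.
have -> : true%:R = term a l m by rewrite /term bl bm dev !mulr1.
apply: le_trans (ler_term_sum2 l m (term0 a)) _.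
by apply: (ler_term_sum (f := fun a => \sum_l \sum_m term a l m)) => a';
  do 2 (apply: sumr_ge0 => ? _).
Qed.

Lemma avg_irregular : (0 < #|I|)%N ->
  avg (fun x : {ffun I -> V} => (~~ `[< regular G (s / (2 * n)) x >])%:R : R) <=
  2 * n * K ^+ 2 * expR (- (s / (128 * n ^+ 2 * K ^+ 2 * h ^+ 2))).
Proof.
move=> I0; have s0 : 0 < s by rewrite ltr0n.
apply: le_trans (ler_avg (fun x : {ffun I -> V} => irregular_le_deviations x)) _.
set E := expR _; have E0 : 0 <= E by exact: expR_ge0.
have tail a l m : avg (fun x : {ffun I -> V} =>
    (tau < `|\sum_i gram_deviation (G a) l m (x i)|)%R%:R) <= 2 * E.
  apply: le_trans (gram_deviation_tail V_gt0 h_ge (basis_flat a) l m I0 _) _.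
    rewrite divr_gt0 ?mulr_gt0 //= ler_pdivrMr ?mulr_gt0 //.
    have nh : 1 <= h * n by rewrite -ler_pdivrMr // mul1r.
    have -> : 4 * s * h * (2 * n * K) = s * (8 * ((h * n) * K)) by ring.
    have : 1 <= h * n * K by rewrite mulr_ege1.
    by move=> hnK; rewrite ler_peMr //; lra.
  rewrite ler_pM2l // ler_expR; apply: ler_eq.
  by rewrite /tau; field; rewrite !gt_eqF.
rewrite avg_sum; apply: (@le_trans _ _ (\sum_(a : V) (2 * K ^+ 2 * E))); last first.
  by rewrite sumr_const -[leLHS]mulr_natr; apply: ler_eq; ring.
apply: ler_sum => a _; rewrite avg_sum.
apply: (@le_trans _ _ (\sum_l \sum_m
    (basis_mask (G a) l)%:R * (basis_mask (G a) m)%:R * (2 * E))).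
  apply: ler_sum => l _; rewrite avg_sum; apply: ler_sum => m _.
  by rewrite avgZ ler_wpM2l ?mulr_ge0.
under eq_bigr => l _ do rewrite -mulr_suml -mulr_sumr -natr_sum.
rewrite -!mulr_suml -natr_sum -expr2 mulrA [_ * 2]mulrC ler_wpM2r // ler_pM2l //.
by rewrite lerXn2r ?nnegrE ?ler0n ?dim_span_rows // ltW.
Qed.

End RegularSamples.

Section Interpolation.
Variables (R : realType) (V J I : finType) (g : J -> V -> R) (x : I -> V).

Definition restriction l i := g l (x i).

Definition lift l : V -> R := lincomb g (projT1 (cid (basis_in_span restriction l))).

Definition interpolant u : I -> R := lincomb (basis restriction) (fun l => lift l u).

Lemma lift_in_span a : in_span g (lincomb lift a).
Proof. by apply: (span_trans (g' := lift)) => [l|]; eexists. Qed.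

Lemma lift_sample a : lincomb lift a \o x = lincomb (basis restriction) a.
Proof.
apply/funext => i; apply: eq_bigr => l _; congr (_ * _).
by rewrite [in RHS](projT2 (cid (basis_in_span restriction l))).
Qed.

Lemma interpolant_sample u : interpolant u = lincomb lift (fun l => lift l u) \o x.
Proof. by rewrite lift_sample. Qed.

Lemma dot_interpolant u (A : I -> R) :
  dot (interpolant u) A = lincomb lift (fun l => dot A (basis restriction l)) u.
Proof. by rewrite dot_lincomb; apply: eq_bigr => l _; rewrite mulrC (dotC A). Qed.

Variables (rho h : R).
Hypothesis rho_gt0 : 0 < rho.
Hypothesis g_regular : forall f, in_span g f -> rho * sqnorm f <= sqnorm (f \o x).

Lemma sample_injective f : in_span g f -> f \o x = (fun=> 0) -> f = fun=> 0.
Proof.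
move=> gf fx0; apply: sqnorm_eq0; apply/eqP; rewrite eq_le sqnorm_ge0 andbT.
by rewrite -(pmulr_rle0 _ rho_gt0); apply: le_trans (g_regular gf) _; rewrite fx0 dot0l.
Qed.

Lemma interpolant_eval f u : in_span g f -> dot (interpolant u) (f \o x) = f u.
Proof.
move=> gf; rewrite dot_interpolant; set p := lincomb _ _.
have : (fun v => 1 * f v + (-1) * p v) = fun=> 0.
  apply: sample_injective; first by apply: span_comb2 => //; exact: lift_in_span.
  have fx : in_span restriction (f \o x) by have [c ->] := gf; exists c.
  apply/funext => i; rewrite /= -[p (x i)]/((p \o x) i) lift_sample.
  by rewrite -[lincomb _ _ i](congr1 (@^~ i) (esym (proj_fix_span fx))) /=; ring.
by move=> /(congr1 (@^~ u)) /= p_eq; lra.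
Qed.

Lemma sqnorm_interpolant u : 0 <= h ->
  (forall f, in_span g f -> forall v, f v ^+ 2 <= h * sqnorm f) ->
  sqnorm (interpolant u) <= h / rho.
Proof.
move=> h0 flat_g; set F := lincomb lift (fun l => lift l u).
have gF : in_span g F by exact: lift_in_span.
have Fu : F u = sqnorm (interpolant u).
  by rewrite {2}interpolant_sample -/F interpolant_eval.
have := ler_wpM2l h0 (g_regular gF); rewrite -interpolant_sample => regF.
have := flat_g F gF u; rewrite Fu; have := sqnorm_ge0 (interpolant u).
rewrite le_eqVlt => /orP[/eqP<- _|beta0]; first by rewrite divr_ge0 // ltW.
rewrite expr2 ler_pdivlMr // => beta_le; rewrite -(ler_pM2r beta0).
by have := ler_wpM2r (ltW rho_gt0) beta_le; lra.
Qed.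

Lemma sum_dot_interpolant (A : I -> R) :
  \sum_u dot (interpolant u) A ^+ 2 <= sqnorm A / rho.
Proof.
pose F := lincomb lift (fun l => dot A (basis restriction l)).
have -> : \sum_u dot (interpolant u) A ^+ 2 = sqnorm F.
  by rewrite sqnormE; apply: eq_bigr => u _; rewrite dot_interpolant.
rewrite ler_pdivlMr // mulrC; apply: le_trans (g_regular (lift_in_span _)) _.
by rewrite lift_sample; exact: sqnorm_proj_le.
Qed.

End Interpolation.

Definition sample (R : realType) (V J X : finType) (G : V -> J -> V -> R) (x : X -> V)
  (i : X) (l : J) (k : X) := G (x i) l (x k).

Lemma leverage_flat (R : realType) (V T J : finType) (G : V -> J -> T -> R) h i j :
  0 <= h -> flat h G -> leverage (G i) j <= h.
Proof. by move=> h0 Gh; apply: leverage_le => // f Gf; exact: (Gh i f Gf j). Qed.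

Section RegularSample.
Variables (R : realType) (V J X : finType) (G : V -> J -> V -> R) (h rho : R).
Hypothesis rho_gt0 : 0 < rho.
Hypothesis h_ge0 : 0 <= h.
Hypothesis G_flat : flat h G.

Lemma in_span_sample (x : X -> V) i f : in_span (G (x i)) f -> in_span (sample G x i) (f \o x).
Proof. by move=> [c ->]; exists c. Qed.

Lemma sample_flat (x : X -> V) : regular G rho x -> flat (h / rho) (sample G x).
Proof.
move=> x_reg i _ [c ->] j; pose f := lincomb (G (x i)) c.
have Gf : in_span (G (x i)) f by exists c.
rewrite -[lincomb _ c]/(f \o x); apply: le_trans (G_flat Gf (x j)) _.
by rewrite -mulrA ler_wpM2l // mulrC ler_pdivlMr // mulrC; exact: (x_reg (x i)).
Qed.

Lemma sample_leverage (x : X -> V) i j : regular G rho x -> leverage (sample G x i) j <= h / rho.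
Proof. by move=> x_reg; apply: leverage_flat (sample_flat x_reg); rewrite divr_ge0 // ltW. Qed.

End RegularSample.

Section ExchangeableSamples.
Variables (R : realType) (V J X : finType) (G : V -> J -> V -> R).
Implicit Types (x : X -> V) (sg : {perm X}).

Definition perm_pair sg (t : X * X) := (sg t.1, sg t.2).

Lemma perm_bij sg : bijective sg.
Proof. exact: injF_bij (@perm_inj _ sg). Qed.

Lemma perm_pair_bij sg : bijective (perm_pair sg).
Proof.
exists (perm_pair sg^-1%g) => -[a b]; by rewrite /perm_pair /= ?permK ?permKV.
Qed.

Lemma row_col_defect_perm sg x Y :
  row_col_defect (sample G (x \o sg)) (Y \o perm_pair sg) =
  row_col_defect (sample G x) Y \o perm_pair sg.
Proof.
pose k (il : X * J) := (sg il.1, il.2).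
have k_bij : bijective k.
  by exists (fun il => (sg^-1%g il.1, il.2)) => -[i l]; rewrite /k /= ?permK ?permKV.
have rowE il : row_family (sample G (x \o sg)) il = row_family (sample G x) (k il) \o perm_pair sg.
  by apply/funext => -[a b]; rewrite /row_family /sample /= (inj_eq perm_inj).
have colE il : col_family (sample G (x \o sg)) il = col_family (sample G x) (k il) \o perm_pair sg.
  by rewrite /col_family rowE; apply/funext => -[].
pose kk (i : X * J + X * J) := match i with inl il => inl (k il) | inr il => inr (k il) end.
have kk_bij : bijective kk.
  have [k' kK k'K] := k_bij.
  exists (fun i => match i with inl il => inl (k' il) | inr il => inr (k' il) end);
  by case=> i; rewrite /= ?kK ?k'K.
apply/funext => t; rewrite /row_col_defect /joint_defect /= /joint_proj.
rewrite (proj_reindex Y (perm_pair_bij sg) k_bij rowE).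
rewrite (proj_reindex Y (perm_pair_bij sg) k_bij colE).
rewrite (proj_reindex (g := glue (row_family (sample G x)) (col_family (sample G x))) Y
  (perm_pair_bij sg) kk_bij) // => -[il|il] /=; [exact: rowE|exact: colE].
Qed.

Lemma vertex_defect_perm sg x c :
  vertex_defect (sample G (x \o sg)) c = vertex_defect (sample G x) (sg c).
Proof.
rewrite /vertex_defect [RHS](reindex sg) /=; last exact/onW_bij/perm_bij.
apply: eq_bigr => a _.
have -> : sym_unit R a c = sym_unit R (sg a) (sg c) \o perm_pair sg.
  by apply/funext => -[j k]; rewrite /sym_unit /unit_vec /= !xpair_eqE /= !(inj_eq perm_inj).
rewrite row_col_defect_perm /dot [RHS](reindex (perm_pair sg)) //=.
exact/onW_bij/perm_pair_bij.
Qed.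

Lemma regular_perm rho sg x : regular G rho (x \o sg) <-> regular G rho x.
Proof.
have sqnorm_perm f : sqnorm (f \o (x \o sg)) = sqnorm (f \o x).
  by rewrite [RHS](reindex sg) //; exact/onW_bij/perm_bij.
by split=> x_reg a f Gf; have := x_reg a f Gf; rewrite sqnorm_perm.
Qed.

Variables (h rho : R).
Hypothesis rho_gt0 : 0 < rho.
Hypothesis h_ge0 : 0 <= h.
Hypothesis G_flat : flat h G.
Hypothesis V_gt0 : (0 < #|V|)%N.

(* By exchangeability the defects at all vertices of the sample have the same average. *)
Lemma avg_vertex_defect (c : X) :
  avg (fun x : {ffun X -> V} => `[< regular G rho x >]%:R * vertex_defect (sample G x) c) <=
  8 * (h / rho) ^+ 2 * #|X|%:R.
Proof.
have X0 : 0 < #|X|%:R :> R by rewrite ltr0n; apply/card_gt0P; exists c.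
rewrite -(ler_pM2l X0).
rewrite (@avg_exchangeable _ _ _
  (fun x c => `[< regular G rho x >]%:R * vertex_defect (sample G x) c)); last first.
  by move=> x sg c'; rewrite vertex_defect_perm (asbool_equiv_eq (regular_perm rho sg x)).
apply: avg_le_cst => [|x]; first by rewrite card_ffun expn_gt0 V_gt0.
rewrite -mulr_sumr; case: asboolP => [x_reg|_].
  rewrite mul1r [leRHS](_ : _ = 8 * (h / rho) ^+ 2 * #|X|%:R ^+ 2); last by ring.
  by apply: sum_vertex_defect => i j; exact: sample_leverage.
rewrite mul0r; apply: mulr_ge0 => //; apply: mulr_ge0 => //.
by apply: mulr_ge0 => //; exact: sqr_ge0.
Qed.

End ExchangeableSamples.

(** * Random blocks *)

Section RandomBlocks.
Variables (R : realType) (V J B : finType) (G : V -> J -> V -> R) (rho : R).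
Implicit Types (v u : V) (S : B -> V) (y : B + B -> R).
Notation block := {ffun B -> V}.

(* The matrix of the family on two consecutive blocks, with [v] as apex. *)
Definition block_sample v S S' := sample G (extend v (glue S S')).

Definition block_defect v S S' : R := vertex_defect (block_sample v S S') None.

Definition border_defect v S S' y : R :=
  sqnorm (row_col_defect (block_sample v S S') (border y)).

Definition step v S S' u : B + B -> R :=
  glue (interpolant (G v) S u) (fun k => - interpolant (G v) S' u k).

Definition step_cost v S S' u : R := border_defect v S S' (step v S S' u).

Definition regular_block S : bool := `[< regular G rho S >].

Lemma block_defect_ge0 v S S' : 0 <= block_defect v S S'.
Proof. exact: vertex_defect_ge0. Qed.

Lemma step_cost_ge0 v S S' u : 0 <= step_cost v S S' u.
Proof. exact: sqnorm_ge0. Qed.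

Lemma border_defect_le v S S' y : border_defect v S S' y <= sqnorm y * block_defect v S S'.
Proof. exact: sqnorm_defect_border. Qed.

Lemma regular_extend v S S' : regular G rho S -> regular G rho (extend v (glue S S')).
Proof.
move=> S_reg a f Gf; apply: le_trans (S_reg a f Gf) _.
rewrite !sqnormE big_option big_sumType /= addrCA lerDl addr_ge0 ?sqr_ge0 //.
by apply: sumr_ge0 => k _; exact: sqr_ge0.
Qed.

Hypothesis rho_gt0 : 0 < rho.

Lemma sum_step_cost v S S' : regular G rho S -> regular G rho S' ->
  \sum_u step_cost v S S' u <= 2 * block_defect v S S' / rho.
Proof.
move=> S_reg S'_reg; pose Z k := row_col_defect (block_sample v S S') (sym_unit R (Some k) None).
pose A t k := Z (inl k) t; pose A' t k := Z (inr k) t.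
have step_le u : step_cost v S S' u <= \sum_t (2 * dot (interpolant (G v) S u) (A t) ^+ 2 +
    2 * dot (interpolant (G v) S' u) (A' t) ^+ 2).
  rewrite /step_cost /border_defect row_col_defect_border sqnormE; apply: ler_sum => t _.
  have -> : lincomb Z (step v S S' u) t =
      dot (interpolant (G v) S u) (A t) - dot (interpolant (G v) S' u) (A' t).
    by rewrite /lincomb big_sumType -sumrN; congr (_ + _); apply: eq_bigr => k _; exact: mulNr.
  by set a := dot _ _; set b := dot _ _; have := sqr_ge0 (a + b); nra.
have A_le : \sum_t (sqnorm (A t) + sqnorm (A' t)) <= block_defect v S S'.
  apply: le_trans (sum_defect_border_le (block_sample v S S')).
  rewrite big_sumType big_split /=; apply: ler_eq.
  by congr (_ + _); rewrite /dot exchange_big.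
apply: le_trans; first by apply: ler_sum => u _; exact: step_le.
rewrite exchange_big /=; apply: (@le_trans _ _ (2 * (\sum_t (sqnorm (A t) + sqnorm (A' t))) / rho)).
  rewrite mulr_sumr mulr_suml; apply: ler_sum => t _.
  rewrite big_split /= -!mulr_sumr -mulrDr -mulrA ler_pM2l // mulrDl.
  by apply: lerD; apply: sum_dot_interpolant => // f Gf; [exact: S_reg Gf|exact: S'_reg Gf].
by rewrite ler_wpM2r ?invr_ge0 ?(ltW rho_gt0) // ler_wpM2l.
Qed.

Variables (h kappa : R).
Hypothesis h_ge0 : 0 <= h.
Hypothesis G_flat : flat h G.
Hypothesis kappa_gt0 : 0 < kappa.
Hypothesis V_gt0 : (0 < #|V|)%N.

Definition defect_bound : R := 8 * (h / rho) ^+ 2 * (2 * #|B| + 1)%:R.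

Lemma avg_block_defect :
  avg (fun v => avg (fun S : block => avg (fun S' : block =>
    (regular_block S)%:R * block_defect v S S'))) <= defect_bound.
Proof.
have -> : defect_bound = 8 * (h / rho) ^+ 2 * #|{: option (B + B)}|%:R.
  by rewrite card_option card_sum addnn -mul2n /defect_bound addn1.
apply: le_trans (avg_vertex_defect rho_gt0 h_ge0 G_flat V_gt0 None).
rewrite (avg_extend (fun x => `[< regular G rho x >]%:R * vertex_defect (sample G x) None)).
apply: ler_avg => v.
rewrite (avg_glue (fun x => `[< regular G rho (extend v x) >]%:R *
  vertex_defect (sample G (extend v x)) None)).
apply: ler_avg => S; apply: ler_avg => S'.
rewrite ler_wpM2r ?vertex_defect_ge0 // ler_nat /regular_block.
by case: asboolP => // S_reg; case: asboolP => // -[]; exact: regular_extend.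
Qed.

Definition bad_step v S S' : bool :=
  [&& regular_block S, regular_block S' & (1 / 4 < block_defect v S S')%R].

Definition bad_prob v S : R := avg (fun S' : block => (bad_step v S S')%:R).

Definition mean_bad_prob v : R := avg (fun S : block => bad_prob v S).

Definition poor_block v S : bool := (kappa < bad_prob v S)%R.

Definition rich_vertex v : bool := (mean_bad_prob v <= kappa ^+ 2)%R.

Lemma bad_step_le v S S' :
  (bad_step v S S')%:R <= 4 * ((regular_block S)%:R * block_defect v S S').
Proof.
have := block_defect_ge0 v S S'; rewrite /bad_step.
case: (regular_block S); case: (regular_block S') => /=; rewrite ?mul0r ?mul1r ?mulr0 //; try lra.
by case: ltP => /=; lra.
Qed.

Lemma bad_prob_ge0 v S : 0 <= bad_prob v S.
Proof. by apply: avg_ge0 => S'. Qed.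

Lemma mean_bad_prob_ge0 v : 0 <= mean_bad_prob v.
Proof. by apply: avg_ge0 => S; exact: bad_prob_ge0. Qed.

Lemma avg_mean_bad_prob : avg mean_bad_prob <= 4 * defect_bound.
Proof.
apply: (le_trans _ (ler_wpM2l _ avg_block_defect)) => //.
rewrite -avgZ; apply: ler_avg => v; rewrite -avgZ; apply: ler_avg => S.
by rewrite -avgZ; apply: ler_avg => S'; exact: bad_step_le.
Qed.

Lemma avg_not_rich : avg (fun v => (~~ rich_vertex v)%:R) <= 4 * defect_bound / kappa ^+ 2.
Proof.
apply: le_trans (_ : avg mean_bad_prob / kappa ^+ 2 <= _).
  have kappa2 : 0 < kappa ^+ 2 by rewrite exprn_gt0.
  apply: le_trans (markov_avg kappa2 mean_bad_prob_ge0); apply: ler_avg => v.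
  by rewrite /rich_vertex -ltNge.
by rewrite ler_wpM2r ?invr_ge0 ?sqr_ge0 // avg_mean_bad_prob.
Qed.

Lemma avg_poor_block v : rich_vertex v -> avg (fun S : block => (poor_block v S)%:R) <= kappa.
Proof.
move=> v_rich; apply: le_trans (markov_avg kappa_gt0 _) _ => [S|]; first exact: bad_prob_ge0.
by rewrite ler_pdivrMr // -expr2.
Qed.

Lemma avg_dead_end (A : finType) v S : rich_vertex v -> ~~ poor_block v S ->
  avg (fun z : {ffun A * B -> V} => \prod_a
    (bad_step v S (fun k => z (a, k)) || poor_block v (fun k => z (a, k)))%:R) <=
  (2 * kappa) ^+ #|A|.
Proof.
move=> v_rich S_not_poor.
rewrite (@avg_prod R V A B (fun S' => (bad_step v S S' || poor_block v S')%:R)).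
apply: lerXn2r; rewrite ?nnegrE.
- exact: avg_ge0.
- by rewrite mulr_ge0 // ltW.
apply: (@le_trans _ _ (avg (fun S' : block => (bad_step v S S')%:R + (poor_block v S')%:R))).
  apply: ler_avg => S'; rewrite -natrD ler_nat.
  by case: (bad_step _ _ _); case: (poor_block _ _).
rewrite avgD mulr_natl mulr2n lerD ?avg_poor_block //.
by move: S_not_poor; rewrite /poor_block -leNgt.
Qed.

Lemma avg_step_cost :
  avg (fun u => avg (fun v => avg (fun S : block => avg (fun S' : block =>
    (regular_block S && regular_block S')%:R * step_cost v S S' u)))) <=
  2 * defect_bound / (rho * #|V|%:R).
Proof.
have n0 : 0 < #|V|%:R :> R by rewrite ltr0n.
rewrite avg_exchange mulrAC.
apply: (le_trans _ (ler_wpM2l _ avg_block_defect)); last by rewrite divr_ge0 // mulr_ge0 // ltW.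
rewrite -avgZ; apply: ler_avg => v.
rewrite avg_exchange -avgZ; apply: ler_avg => S.
rewrite avg_exchange -avgZ; apply: ler_avg => S'.
have q0 : 0 <= 2 / (rho * #|V|%:R) by rewrite divr_ge0 // mulr_ge0 // ltW.
rewrite avgZ /regular_block; case: asboolP => S_reg; rewrite ?mul0r ?mulr0 //= mul1r.
case: asboolP => S'_reg; rewrite ?mul0r ?mul1r; last by rewrite mulr_ge0 ?block_defect_ge0.
rewrite /avg mulrC ler_pdivrMr //; apply: le_trans (sum_step_cost v S_reg S'_reg) _.
by apply: ler_eq; field; rewrite !gt_eqF.
Qed.

End RandomBlocks.

(** * Transport along a chain of blocks *)

Definition symm (R : realType) (V : Type) (F : V -> V -> R) a b := F a b + F b a.

Definition block_energy (R : realType) (V : Type) (B : finType) (F : V -> V -> R)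
    (S S' : B -> V) : R :=
  \sum_(a : B + B) \sum_(b : B + B) symm F (glue S S' a) (glue S S' b) ^+ 2.

Definition transport_const (R : realType) (eta tau1 tau2 : R) (L : nat) : R :=
  17 * eta + 16 * eta ^+ 2 * L%:R + 2 * tau1 + 4 * tau2.

Lemma transport_const_ge0 (R : realType) (eta tau1 tau2 : R) L :
  0 <= eta -> 0 <= tau1 -> 0 <= tau2 -> 0 <= transport_const eta tau1 tau2 L.
Proof. by move=> eta0 tau10 tau20; rewrite !addr_ge0 ?mulr_ge0 ?sqr_ge0. Qed.

Section BlockChain.
Variables (R : realType) (V J B : finType) (G : V -> J -> V -> R) (h rho : R).
Notation eta := (h / rho).
Hypothesis rho_gt0 : 0 < rho.
Hypothesis h_ge0 : 0 <= h.
Hypothesis G_hollow : hollow G.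
Hypothesis G_flat : flat h G.
Hypothesis eta_small : 16 * eta <= 1.

Variables (u v : V) (S : nat -> B -> V) (L : nat) (k0 : B).
Hypothesis S0_k0 : S 0 k0 = u.
Hypothesis L_gt0 : (0 < L)%N.
Hypothesis S_regular : forall j, (j <= L)%N -> regular G rho (S j).
Hypothesis S_good : forall j, (j < L)%N -> block_defect G v (S j) (S j.+1) <= 1 / 4.

Variable F : V -> V -> R.
Hypothesis F_span : forall a, in_span (G a) (F a).

(* Coefficients that recover [f u] from the values of [f], in the span of [G v],
   on the block [S j]. *)
Definition chain_weight j : B -> R :=
  if j is 0%N then unit_vec R k0 else interpolant (G v) (S j) u.

Definition chain_step j : B + B -> R :=
  glue (chain_weight j) (fun k => - chain_weight j.+1 k).

Definition transported j : R := dot (chain_weight j) (fun k => symm F (S j k) v).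

Let eta_ge0 : 0 <= eta. Proof. by rewrite divr_ge0 // ltW. Qed.

Lemma chain_weight_eval j f : (j <= L)%N -> in_span (G v) f ->
  dot (chain_weight j) (f \o S j) = f u.
Proof.
case: j => [|j] jL Gf; first by rewrite dot_unitl /= S0_k0.
by apply: interpolant_eval Gf; [exact: rho_gt0|move=> f' Gf'; exact: (S_regular jL) Gf'].
Qed.

Lemma sqnorm_chain_weight j : (0 < j <= L)%N -> sqnorm (chain_weight j) <= eta.
Proof.
case: j => // j jL; apply: sqnorm_interpolant => // f Gf; last exact: (G_flat Gf).
exact: (S_regular jL) Gf.
Qed.

Lemma sqnorm_chain_step j :
  sqnorm (chain_step j) = sqnorm (chain_weight j) + sqnorm (chain_weight j.+1).
Proof.
rewrite /dot big_sumType /=; congr (_ + _).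
by apply: eq_bigr => k _; rewrite mulrNN.
Qed.

Lemma dot_chain_step j (f : V -> R) : dot (chain_step j) (f \o glue (S j) (S j.+1)) =
  dot (chain_weight j) (f \o S j) - dot (chain_weight j.+1) (f \o S j.+1).
Proof.
rewrite /dot big_sumType -sumrN; congr (_ + _).
by apply: eq_bigr => k _; exact: mulNr.
Qed.

Lemma chain_step_orth j f : (j < L)%N -> in_span (G v) f ->
  dot (chain_step j) (f \o glue (S j) (S j.+1)) = 0.
Proof. by move=> jL Gf; rewrite dot_chain_step !chain_weight_eval ?subrr // ltnW. Qed.

Lemma transported_step j : (j < L)%N -> (transported j - transported j.+1) ^+ 2 <=
  (8 * eta * sqnorm (chain_step j) + 2 * border_defect G v (S j) (S j.+1) (chain_step j)) *
  block_energy F (S j) (S j.+1).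
Proof.
move=> jL; set x := extend v (glue (S j) (S j.+1)).
have x_reg : regular G rho x by apply: regular_extend; apply: S_regular; exact: ltnW.
have lev_le i k := sample_leverage rho_gt0 h_ge0 G_flat i k x_reg.
have x_hollow : hollow (sample G x) by move=> i l; exact: G_hollow.
have orth : apex_orth (sample G x) (chain_step j).
  by move=> l; apply: (chain_step_orth (f := G v l) jL); exact: mem_span.
have small : 8 * eta + 2 * vertex_defect (sample G x) None <= 1.
  by have := S_good jL; rewrite /block_defect /block_sample -/x; move: eta_small; lra.
have F_sample i : in_span (sample G x i) (F (x i) \o x) by exact/in_span_sample/F_span.
have := apex_transport lev_le small x_hollow F_sample orth.
have -> : dot (chain_step j) (fun a => (F (x (Some a)) \o x) None) =
    transported j - transported j.+1.
  rewrite /transported -(dot_chain_step j (fun a => symm F a v)).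
  have -> : (fun a => symm F a v) \o glue (S j) (S j.+1) = fun a => F (x (Some a)) v +
      (F v \o glue (S j) (S j.+1)) a by [].
  by rewrite dotDr (chain_step_orth jL (F_span v)) addr0.
move=> /le_trans; apply; rewrite ler_wpM2r //; last exact: sqnorm_proj_border.
by apply: sumr_ge0 => a _; apply: sumr_ge0 => b _; exact: sqr_ge0.
Qed.

Lemma transported0 : transported 0 = symm F u v.
Proof. by rewrite /transported dot_unitl S0_k0. Qed.

Lemma transported_telescope : transported 0 =
  \sum_(o : option 'I_L)
    extend (transported L) (fun j : 'I_L => transported j - transported j.+1) o.
Proof.
rewrite big_option /= -(big_mkord xpredT (fun j => transported j - transported j.+1)).
under [X in _ + X]eq_bigr => j _ do rewrite -opprB.
by rewrite sumrN telescope_sumr // opprB addrC subrK.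
Qed.

Lemma chain_bound : symm F u v ^+ 2 <=
  (\sum_(j < L) (8 * eta * sqnorm (chain_step j) +
     2 * border_defect G v (S j) (S j.+1) (chain_step j)) + eta) *
  (\sum_(j < L) block_energy F (S j) (S j.+1) + \sum_k symm F (S L k) v ^+ 2).
Proof.
rewrite -transported0 transported_telescope.
pose cost (j : nat) := 8 * eta * sqnorm (chain_step j) +
  2 * border_defect G v (S j) (S j.+1) (chain_step j).
apply: le_trans (sqr_sum_le (p := extend eta (fun j : 'I_L => cost j))
  (q := extend (\sum_k symm F (S L k) v ^+ 2)
    (fun j : 'I_L => block_energy F (S j) (S j.+1))) _ _ _) _.
- by case=> [j|//]; rewrite addr_ge0 // mulr_ge0 ?sqnorm_ge0 // mulr_ge0.
- by case=> [j|]; do 2?[apply: sumr_ge0 => ? _]; rewrite ?sqr_ge0.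
- case=> [j|]; first exact: transported_step.
  apply: le_trans (cauchy_schwarz _ _) _; rewrite -sqnormE ler_wpM2r ?sqnorm_ge0 //.
  by apply: sqnorm_chain_weight; rewrite L_gt0 leqnn.
- by rewrite !big_option /= ![_ + \sum_(i < L) _]addrC.
Qed.

Lemma first_step_cost tau : block_defect G v (S 0) (S 1) <= tau ->
  8 * eta * sqnorm (chain_step 0) + 2 * border_defect G v (S 0) (S 1) (chain_step 0) <=
  16 * eta + 4 * tau.
Proof.
move=> defect_le; have eta_le1 : eta <= 1 by move: eta_small eta_ge0; lra.
have step_le2 : sqnorm (chain_step 0) <= 2.
  have -> : sqnorm (chain_step 0) = 1 + sqnorm (chain_weight 1).
    by rewrite sqnorm_chain_step [X in X + _]dot_unitl /= /unit_vec eqxx.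
  by have := @sqnorm_chain_weight 1 L_gt0; lra.
have := border_defect_le G v (S 0) (S 1) (chain_step 0).
have := block_defect_ge0 G v (S 0) (S 1); have := sqnorm_ge0 (chain_step 0).
move: step_le2 eta_ge0; move: (sqnorm _) (border_defect _ _ _ _ _) => y c; nra.
Qed.

Lemma later_steps_cost tau :
  \sum_(j < L | (0 < j)%N) step_cost G v (S j) (S j.+1) u <= tau ->
  \sum_(j < L | (0 < j)%N) (8 * eta * sqnorm (chain_step j) +
    2 * border_defect G v (S j) (S j.+1) (chain_step j)) <= 16 * eta ^+ 2 * L%:R + 2 * tau.
Proof.
move=> cost_le; rewrite big_split /=; apply: lerD; last first.
  rewrite -mulr_sumr ler_pM2l //; apply: le_trans cost_le.
  by apply: ler_eq; apply: eq_bigr => -[[|j] jL].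
apply: (@le_trans _ _ (\sum_(j < L) 16 * eta ^+ 2)).
  rewrite big_mkcond; apply: ler_sum => j _; case: ifP => [j0|_]; last by rewrite mulr_ge0 ?sqr_ge0.
  have : sqnorm (chain_step j) <= 2 * eta.
    rewrite sqnorm_chain_step [leRHS]mulr_natl mulr2n.
    by apply: lerD; apply: sqnorm_chain_weight; rewrite ?j0 /= ?ltn_ord // ltnW.
  by move=> /(ler_wpM2l eta_ge0); lra.
by rewrite sumr_ord_const mulrC.
Qed.

Lemma chain_transport tau1 tau2 :
  \sum_(j < L | (0 < j)%N) step_cost G v (S j) (S j.+1) u <= tau1 ->
  block_defect G v (S 0) (S 1) <= tau2 ->
  symm F u v ^+ 2 <= transport_const eta tau1 tau2 L *
   (\sum_(j < L) block_energy F (S j) (S j.+1) + \sum_k symm F (S L k) v ^+ 2).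
Proof.
move=> /later_steps_cost later /first_step_cost first.
apply: le_trans chain_bound _; apply: ler_wpM2r.
  by rewrite addr_ge0 ?sumr_ge0 // => ? _; do 2?[apply: sumr_ge0 => ? _]; rewrite ?sqr_ge0.
rewrite (bigD1 (Ordinal L_gt0)) //= (eq_bigl (fun j : 'I_L => (0 < j)%N)) => [|j]; last first.
  by rewrite -val_eqE /= lt0n.
by rewrite /transport_const; lra.
Qed.

End BlockChain.

(** * Layered placements *)

(* Level [L + 1] is the single slot [None]; every level [j <= L] consists of
   [r + 1] interchangeable blocks of [s + 1] slots. *)
Definition slot L r s := option ('I_L.+1 * 'I_r.+1 * 'I_s.+1).

Definition level L r s (p : slot L r s) : nat := if p is Some (j, _, _) then j else L.+1.

Definition close L r s (p q : slot L r s) : bool :=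
  (level p <= (level q).+1)%N && (level q <= (level p).+1)%N.

Definition first_slot L r s : slot L r s := Some (ord0, ord0, ord0).

Lemma inord_neq_succ L j : (j < L)%N -> (inord j : 'I_L.+1) <> inord j.+1.
Proof.
move=> jL /(congr1 (fun i : 'I_L.+1 => i : nat)).
by rewrite !inordK ?ltnS // 1?ltnW // => /eqP; rewrite ltn_eqF.
Qed.

Lemma exists_route (I : finType) (i0 : I) L (bad : nat -> I -> I -> bool)
    (poor : nat -> I -> bool) :
  ~~ poor 0%N i0 ->
  (forall j i, (j < L)%N -> ~~ poor j i -> exists i', ~~ (bad j i i' || poor j.+1 i')) ->
  exists2 rt : nat -> I, rt 0%N = i0 & forall j, (j < L)%N -> ~~ bad j (rt j) (rt j.+1).
Proof.
move=> i0_rich next_ex.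
pose next j i := odflt i0 [pick i' | ~~ (bad j i i' || poor j.+1 i')].
have nextP j i : (j < L)%N -> ~~ poor j i -> ~~ bad j i (next j i) /\ ~~ poor j.+1 (next j i).
  move=> jL /(next_ex j i jL)[i1 i1P]; rewrite /next.
  by case: pickP => [i' /=|/(_ i1)]; [rewrite negb_or => /andP[]|rewrite i1P].
pose rt := fix rt j := if j is j'.+1 then next j' (rt j') else i0.
have rt_rich j : (j <= L)%N -> ~~ poor j (rt j).
  by elim: j => // j IH jL; have [] := nextP j (rt j) jL (IH (ltnW jL)).
by exists rt => // j jL; have [] := nextP j (rt j) jL (rt_rich j (ltnW jL)).
Qed.

Section RouteEnergy.
Variables (R : realType) (L r s : nat) (rt : nat -> 'I_r.+1).
Notation slot := (slot L r s).
Implicit Types p q : slot.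

Definition route_slot j : 'I_s.+1 + 'I_s.+1 -> slot :=
  glue (fun k => Some (inord j, rt j, k)) (fun k => Some (inord j.+1, rt j.+1, k)).

Lemma route_slot_inj j : (j < L)%N -> injective (route_slot j).
Proof.
move=> /inord_neq_succ neq_levels.
by move=> [k|k] [k'|k'] //= [] => [->|/neq_levels|/esym/neq_levels|->].
Qed.

Definition in_step (j : nat) p := (level p == j) || (level p == j.+1).

Lemma route_slot_in_step j i : (j < L)%N -> in_step j (route_slot j i).
Proof. by move=> jL; case: i => k; rewrite /in_step /= inordK ?eqxx ?orbT // ltnS // ltnW. Qed.

Lemma count_in_step p : (\sum_(j < L) in_step j p <= 2)%N.
Proof.
have once (f : nat -> nat) : injective f -> (\sum_(j < L) (level p == f j) <= 1)%N.
  move=> f_inj; have [j0 /eqP j0E|no_j] := pickP (fun j : 'I_L => level p == f j).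
    rewrite (bigD1 j0) //= big1 ?addn0 ?leq_b1 // => j jj0.
    by apply/eqP; rewrite eqb0 j0E (inj_eq f_inj) eq_sym (inj_eq val_inj).
  by rewrite big1 // => j _; rewrite no_j.
apply: leq_trans (leq_add (once id (fun _ _ => id)) (once succn succn_inj)).
by rewrite -big_split; apply: leq_sum => j _; rewrite /in_step; case: (_ == _); case: (_ == _).
Qed.

Lemma in_step_close j p q : in_step j p -> in_step j q -> close p q.
Proof.
rewrite /in_step /close => /orP[]/eqP-> /orP[]/eqP->;
  by rewrite ?leqnn ?leqnSn ?(leq_trans (leqnSn j) (leqnSn _)).
Qed.

Lemma count_route_pairs p q :
  (\sum_(j < L) (in_step j p && in_step j q) + ((level p == L) && (q == None)) <= 2 * close p q)%N.
Proof.
case: q => [q|]; last first.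
  rewrite eqxx andbT big1 => [|j _]; last first.
    have -> : in_step j None = false by rewrite /in_step /= eqSS !gtn_eqF ?ltnS ?(ltnW (ltn_ord j)).
    by rewrite andbF.
  rewrite add0n; case: eqP => // pL.
  have -> : close p None by rewrite /close /= pL leqnn (leq_trans (leqnSn L) (leqnSn _)).
  by [].
rewrite andbF addn0; have [_|not_close] := boolP (close p (Some q)).
  rewrite muln1; apply: leq_trans (count_in_step p); apply: leq_sum => j _.
  by case: (in_step j p) => //; exact: leq_b1.
rewrite big1 // => j _; apply/eqP; rewrite eqb0; apply: contraNN not_close.
by move=> /andP[]; exact: in_step_close.
Qed.

Variable e : slot -> slot -> R.
Hypothesis e_ge0 : forall p q, 0 <= e p q.

Lemma step_energy_le (j : 'I_L) : \sum_a \sum_b e (route_slot j a) (route_slot j b) <=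
  \sum_p \sum_q (in_step j p && in_step j q)%:R * e p q.
Proof.
have inj := route_slot_inj (ltn_ord j).
have in_j a := route_slot_in_step a (ltn_ord j).
apply: (@le_trans _ _ (\sum_a \sum_(q | in_step j q) e (route_slot j a) q)).
  by apply: ler_sum => a _; exact: (ler_sum_inj (f := e (route_slot j a))).
apply: le_trans (ler_sum_inj (f := fun p => \sum_(q | in_step j q) e p q) inj in_j _) _ => [p|].
  exact: sumr_ge0.
rewrite big_mkcond; apply: ler_sum => p _; case: ifP => _.
  by rewrite big_mkcond; apply: ler_sum => q _; case: ifP; rewrite ?mul1r ?mul0r.
by apply: sumr_ge0 => q _; rewrite mul0r.
Qed.

Lemma last_step_energy_le : \sum_k e (Some (inord L, rt L, k)) None <=
  \sum_p \sum_q ((level p == L) && (q == None))%:R * e p q.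
Proof.
apply: (@le_trans _ _ (\sum_(p | level p == L) e p None)).
  apply: (ler_sum_inj (h := fun k => Some (inord L, rt L, k)) (f := fun p => e p None)) => //.
    by move=> k k' [].
  by move=> k /=; rewrite inordK.
rewrite big_mkcond; apply: ler_sum => p _; rewrite (bigD1 None) //= eqxx andbT.
rewrite -[leLHS]addr0; apply: lerD; first by case: ifP; rewrite ?mul1r ?mul0r.
by apply: sumr_ge0 => q _; rewrite mulr_ge0.
Qed.

Lemma route_energy :
  \sum_(j < L) \sum_a \sum_b e (route_slot j a) (route_slot j b) +
  \sum_k e (Some (inord L, rt L, k)) None <= 2 * \sum_p \sum_(q | close p q) e p q.
Proof.
apply: le_trans (lerD (ler_sum _ (fun j _ => step_energy_le j)) last_step_energy_le) _.
rewrite exchange_big -big_split mulr_sumr; apply: ler_sum => p _ /=.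
rewrite exchange_big -big_split mulr_sumr [leRHS]big_mkcond; apply: ler_sum => q _ /=.
rewrite -mulr_suml -mulrDl -natr_sum -natrD.
rewrite (_ : (if _ then _ else _) = (2 * close p q)%:R * e p q); last first.
  by case: ifP => _; rewrite ?muln0 ?mul0r // muln1.
by rewrite ler_wpM2r // ler_nat count_route_pairs.
Qed.

End RouteEnergy.

(** * Random placements *)

(* The bound on the average failure of a placement, term by term; [theta] bounds the
   frequency of bad pairs, [er] that of irregular blocks, [D] the average defect of
   two blocks, and [2 * D / m] the average cost of a step. *)
Definition failure_bound (R : realType) (theta er D m kappa tau1 tau2 : R) (L r : nat) : R :=
  2 * (theta + L.+1%:R * r.+1%:R * er + 4 * D / kappa ^+ 2 + kappa +
   L%:R * r.+1%:R * (2 * kappa) ^+ r.+1 +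
   L%:R * r.+1%:R ^+ 2 * (2 * D / m) / tau1 + r.+1%:R * D / tau2).

Section Placements.
Variables (R : realType) (V J : finType) (G : V -> J -> V -> R) (h rho kappa tau1 tau2 : R).
Variables (L r s : nat) (good_pair : V -> V -> bool).
Notation slot := (slot L r s).
Notation eta := (h / rho).
Implicit Types x : slot -> V.

Definition block x j i (k : 'I_s.+1) : V := x (Some (inord j, i, k)).
Definition first_vertex x := x (first_slot L r s).
Definition last_vertex x := x None.

Let bad := @bad_step R V J 'I_s.+1 G rho.
Let poor := @poor_block R V J 'I_s.+1 G rho kappa.
Let rich := @rich_vertex R V J 'I_s.+1 G rho kappa.
Let is_regular := @regular_block R V J 'I_s.+1 G rho.

Definition pair_failure x : R := (~~ good_pair (first_vertex x) (last_vertex x))%:R.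

Definition irregular_blocks x : R := \sum_(j < L.+1) \sum_i (~~ is_regular (block x j i))%:R.

Definition poor_apex x : R := (~~ rich (last_vertex x))%:R.

Definition poor_start x : R := (rich (last_vertex x) && poor (last_vertex x) (block x 0 ord0))%:R.

Definition dead_ends x : R := \sum_(j < L) \sum_i
  (rich (last_vertex x) && ~~ poor (last_vertex x) (block x j i))%:R *
  \prod_i' (bad (last_vertex x) (block x j i) (block x j.+1 i') ||
    poor (last_vertex x) (block x j.+1 i'))%:R.

Definition total_cost x : R := \sum_(j < L | (0 < j)%N) \sum_i \sum_i'
  (is_regular (block x j i) && is_regular (block x j.+1 i'))%:R *
  step_cost G (last_vertex x) (block x j i) (block x j.+1 i') (first_vertex x).

Definition first_defect x : R := \sum_i' (is_regular (block x 0 ord0))%:R *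
  block_defect G (last_vertex x) (block x 0 ord0) (block x 1 i').

(* A placement of [failure] less than 1 transports; [failure] is what is averaged. *)
Definition failure x : R := pair_failure x + irregular_blocks x + poor_apex x + poor_start x +
  dead_ends x + total_cost x / tau1 + first_defect x / tau2.

Lemma irregular_blocks_ge0 x : 0 <= irregular_blocks x.
Proof. by do 2 (apply: sumr_ge0 => ? _). Qed.

Lemma dead_ends_ge0 x : 0 <= dead_ends x.
Proof. by do 2 (apply: sumr_ge0 => ? _); rewrite mulr_ge0 ?prodr_ge0. Qed.

Lemma total_cost_ge0 x : 0 <= total_cost x.
Proof. by do 3 (apply: sumr_ge0 => ? _); rewrite mulr_ge0 ?step_cost_ge0. Qed.

Lemma first_defect_ge0 x : 0 <= first_defect x.
Proof. by apply: sumr_ge0 => ? _; rewrite mulr_ge0 ?block_defect_ge0. Qed.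

Hypothesis tau1_gt0 : 0 < tau1.
Hypothesis tau2_gt0 : 0 < tau2.

Lemma failure_ge0 x : 0 <= failure x.
Proof.
rewrite !addr_ge0 ?irregular_blocks_ge0 ?dead_ends_ge0 ?divr_ge0 ?total_cost_ge0 //.
- exact: ltW.
- exact: first_defect_ge0.
- exact: ltW.
Qed.

Section Success.
Variable x : slot -> V.
Hypothesis success : failure x < 1.

Lemma success_terms : [/\ pair_failure x < 1, irregular_blocks x < 1, poor_apex x < 1,
  poor_start x < 1 & dead_ends x < 1] /\ total_cost x <= tau1 /\ first_defect x <= tau2.
Proof.
have reg0 := irregular_blocks_ge0 x; have dead0 := dead_ends_ge0 x.
have cost0 : 0 <= total_cost x / tau1 by rewrite divr_ge0 ?total_cost_ge0 // ltW.
have first0 : 0 <= first_defect x / tau2 by rewrite divr_ge0 ?first_defect_ge0 // ltW.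
have pair0 : 0 <= pair_failure x by exact: ler0n.
have apex0 : 0 <= poor_apex x by exact: ler0n.
have start0 : 0 <= poor_start x by exact: ler0n.
move: success; rewrite /failure => lt1; split; first by split; lra.
by split; rewrite -[leRHS]mul1r -ler_pdivrMr //; lra.
Qed.

Let bool_lt1 (b : bool) : (b%:R : R) < 1 -> ~~ b.
Proof. by case: b; rewrite ?ltxx. Qed.

Lemma success_pair : good_pair (first_vertex x) (last_vertex x).
Proof. by have [[/bool_lt1]] := success_terms; rewrite negbK. Qed.

Lemma success_rich : rich (last_vertex x).
Proof. by have [[_ _ /bool_lt1]] := success_terms; rewrite negbK. Qed.

Lemma success_start : ~~ poor (last_vertex x) (block x 0 ord0).
Proof. by have [[_ _ _ /bool_lt1 + _] _] := success_terms; rewrite success_rich. Qed.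

Lemma success_regular j i : (j <= L)%N -> is_regular (block x j i).
Proof.
move=> jL; have [[_ lt1 _ _ _] _] := success_terms; apply: contraTT lt1 => irr.
have jL' : (j < L.+1)%N by [].
rewrite -leNgt (_ : 1 = (~~ is_regular (block x (Ordinal jL') i))%:R); last by rewrite irr.
exact: (ler_term_sum2 (f := fun (j : 'I_L.+1) i => (~~ is_regular (block x j i))%:R)).
Qed.

Lemma success_next j i : (j < L)%N -> ~~ poor (last_vertex x) (block x j i) ->
  exists i', ~~ (bad (last_vertex x) (block x j i) (block x j.+1 i') ||
    poor (last_vertex x) (block x j.+1 i')).
Proof.
move=> jL i_rich; have [[_ _ _ _ lt1] _] := success_terms.
apply: contrapT => /forallNP dead; move: lt1; apply/negP; rewrite -leNgt.
pose f (j : 'I_L) i := (rich (last_vertex x) && ~~ poor (last_vertex x) (block x j i))%:R *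
  \prod_i' (bad (last_vertex x) (block x j i) (block x j.+1 i') ||
    poor (last_vertex x) (block x j.+1 i'))%:R : R.
rewrite (_ : 1 = f (Ordinal jL) i); last first.
  rewrite /f success_rich i_rich mul1r big1 // => i' _.
  by have /negP := dead i'; rewrite negbK => ->.
by apply: ler_term_sum2 => j' i'; rewrite mulr_ge0 ?prodr_ge0.
Qed.

Lemma success_route : exists2 rt : nat -> 'I_r.+1, rt 0%N = ord0 & forall j, (j < L)%N ->
  ~~ bad (last_vertex x) (block x j (rt j)) (block x j.+1 (rt j.+1)).
Proof.
apply: (exists_route
  (bad := fun j i i' => bad (last_vertex x) (block x j i) (block x j.+1 i'))
  (poor := fun j i => poor (last_vertex x) (block x j i))); last exact: success_next.
exact: success_start.
Qed.

Lemma success_cost (rt : nat -> 'I_r.+1) : \sum_(j < L | (0 < j)%N)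
  step_cost G (last_vertex x) (block x j (rt j)) (block x j.+1 (rt j.+1)) (first_vertex x) <= tau1.
Proof.
have [_ [cost_le _]] := success_terms; apply: le_trans cost_le; apply: ler_sum => j _.
pose f i i' := (is_regular (block x j i) && is_regular (block x j.+1 i'))%:R *
  step_cost G (last_vertex x) (block x j i) (block x j.+1 i') (first_vertex x).
rewrite (_ : step_cost _ _ _ _ _ = f (rt j) (rt j.+1)); last first.
  by rewrite /f !success_regular ?mul1r // ltnW.
by apply: ler_term_sum2 => i i'; rewrite mulr_ge0 ?step_cost_ge0.
Qed.

Lemma success_first_defect i :
  block_defect G (last_vertex x) (block x 0 ord0) (block x 1 i) <= tau2.
Proof.
have [_ [_ defect_le]] := success_terms; apply: le_trans defect_le.
rewrite -[leLHS]mul1r -[1]/(true%:R) -(success_regular ord0 (leq0n L)).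
apply: (ler_term_sum (f := fun i' => (is_regular (block x 0 ord0))%:R *
  block_defect G (last_vertex x) (block x 0 ord0) (block x 1 i'))) => i'.
by rewrite mulr_ge0 ?block_defect_ge0.
Qed.

Hypothesis rho_gt0 : 0 < rho.
Hypothesis h_ge0 : 0 <= h.
Hypothesis G_hollow : hollow G.
Hypothesis G_flat : flat h G.
Hypothesis eta_small : 16 * eta <= 1.
Hypothesis L_gt0 : (0 < L)%N.

Lemma success_transport (F : V -> V -> R) : (forall a, in_span (G a) (F a)) ->
  symm F (first_vertex x) (last_vertex x) ^+ 2 <= transport_const eta tau1 tau2 L *
    (2 * \sum_p \sum_(q | close p q) symm F (x p) (x q) ^+ 2).
Proof.
move=> F_span; have [rt rt0 rt_good] := success_route; pose S j := block x j (rt j).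
have S_regular j : (j <= L)%N -> regular G rho (S j).
  by move=> /(success_regular (rt j))/asboolP.
have S_good j : (j < L)%N -> block_defect G (last_vertex x) (S j) (S j.+1) <= 1 / 4.
  move=> jL; have := rt_good j jL; rewrite /bad /bad_step -/(is_regular _).
  rewrite success_regular ?(ltnW jL) //.
  by rewrite -/(is_regular _) success_regular // !andTb -leNgt.
have S0 : S 0 ord0 = first_vertex x.
  rewrite /S rt0 /block /first_vertex; congr (x (Some (_, _, _))).
  by apply: val_inj; rewrite /= inordK.
have first : block_defect G (last_vertex x) (S 0) (S 1) <= tau2.
  by rewrite /S rt0 success_first_defect.
apply: le_trans (chain_transport rho_gt0 h_ge0 G_hollow G_flat eta_small S0 L_gt0 S_regular
  S_good F_span (success_cost rt) first) _.
apply: ler_wpM2l.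
  by rewrite transport_const_ge0 ?divr_ge0 // ltW.
pose e (p q : slot) := symm F (x p) (x q) ^+ 2.
apply: le_trans (@route_energy _ L r s rt e _); last by move=> p q; exact: sqr_ge0.
apply: lerD => //; apply: ler_sum => j _; apply: ler_eq.
have glueE a : glue (S j) (S j.+1) a = x (route_slot L rt j a) by case: a.
by apply: eq_bigr => a _; apply: eq_bigr => b _; rewrite /e !glueE.
Qed.

End Success.

Section Averages.
Variables (emb : slot -> V) (theta er : R).
Hypothesis emb_inj : injective emb.
Hypothesis V_large : (2 * (s.+1 * (r + 3) + 2) ^ 2 <= #|V|)%N.
Hypothesis rho_gt0 : 0 < rho.
Hypothesis h_ge0 : 0 <= h.
Hypothesis kappa_gt0 : 0 < kappa.
Hypothesis G_flat : flat h G.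
Hypothesis avg_bad_pair : avg (fun u => avg (fun v => (~~ good_pair u v)%:R)) <= theta.
Hypothesis avg_irregular_block : avg (fun S : {ffun 'I_s.+1 -> V} => (~~ is_regular S)%:R) <= er.

Notation defect_bound := (defect_bound 'I_s.+1 rho h).

Let V_gt0 : (0 < #|V|)%N.
Proof. by apply: leq_trans V_large; rewrite muln_gt0 expn_gt0 addn2. Qed.

Let sample_size : (s.+1 * (r + 3) + 2 = s.+1 * r.+1 + s.+1 * 2 + 2)%N.
Proof. by lia. Qed.

Definition placement (sg : {perm V}) (p : slot) : V := sg (emb p).

Lemma avg_placement_le (I : finType) (iota : I -> slot) (F : (I -> V) -> R) :
  injective iota -> (#|I| <= s.+1 * (r + 3) + 2)%N -> (forall y, 0 <= F y) ->
  avg (fun sg => F (placement sg \o iota)) <= 2 * avg (fun y : {ffun I -> V} => F y).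
Proof.
move=> iota_inj I_small F0.
have I_large : (2 * #|I| ^ 2 <= #|V|)%N.
  by apply: leq_trans V_large; rewrite leq_pmul2l // leq_exp2r.
apply: le_trans (avg_perm_le (inj_comp emb_inj iota_inj) I_large (fun y : {ffun I -> V} => F0 y)).
apply: ler_avg => sg; apply: ler_eq; congr F.
by apply/funext => i; rewrite ffunE.
Qed.

Lemma avg_pair_failure : avg (fun sg => pair_failure (placement sg)) <= 2 * theta.
Proof.
pose F (y : option unit -> V) : R := (~~ good_pair (y None) (y (Some tt)))%:R.
apply: le_trans (@avg_placement_le _ (extend (first_slot L r s) (fun=> None)) F _ _ _) _ => //.
- by move=> [[]|] [[]|].
- by rewrite card_option card_unit addnC.
rewrite ler_pM2l // (avg_extend F); apply: le_trans avg_bad_pair; apply: ler_avg => u.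
by rewrite -(avg_ffun_unit (fun v => (~~ good_pair u v)%:R)).
Qed.

Lemma avg_poor_apex :
  avg (fun sg => poor_apex (placement sg)) <= 2 * (4 * defect_bound / kappa ^+ 2).
Proof.
pose F (y : unit -> V) : R := (~~ rich (y tt))%:R.
apply: le_trans (@avg_placement_le _ (fun=> None) F _ _ _) _ => //.
- by move=> [] [].
- by rewrite card_unit addn2.
rewrite ler_pM2l // (avg_ffun_unit (fun v => (~~ rich v)%:R)).
exact: avg_not_rich.
Qed.

Lemma avg_irregular_blocks :
  avg (fun sg => irregular_blocks (placement sg)) <= 2 * (L.+1%:R * r.+1%:R * er).
Proof.
rewrite avg_sum; under eq_bigr => j _ do rewrite avg_sum.
apply: (@le_trans _ _ (\sum_(j < L.+1) \sum_(i < r.+1) 2 * er)); last first.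
  by rewrite !sumr_ord_const; apply: ler_eq; ring.
apply: ler_sum => j _; apply: ler_sum => i _.
apply: le_trans (@avg_placement_le _ (fun k => Some (inord j, i, k))
  (fun S => (~~ is_regular S)%:R) _ _ _) _ => //.
- by move=> k k' [].
- by rewrite card_ord sample_size; lia.
by rewrite ler_pM2l //; exact: avg_irregular_block.
Qed.

Lemma avg_poor_start : avg (fun sg => poor_start (placement sg)) <= 2 * kappa.
Proof.
pose F (y : option 'I_s.+1 -> V) : R :=
  (rich (y None) && poor (y None) (fun k => y (Some k)))%:R.
apply: le_trans (@avg_placement_le _
  (extend None (fun k => Some (inord 0, ord0, k))) F _ _ _) _ => //.
- by move=> [k|] [k'|] //= [->].
- by rewrite card_option card_ord sample_size; lia.
rewrite ler_pM2l // (avg_extend F); apply: avg_le_cst => // v; rewrite /F /=.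
case v_rich : (rich v) => /=; first exact: avg_poor_block.
by apply: avg_le_cst => [|_]; [rewrite card_ffun expn_gt0 V_gt0|exact: ltW].
Qed.

Lemma avg_dead_ends : avg (fun sg => dead_ends (placement sg)) <=
  2 * (L%:R * r.+1%:R * (2 * kappa) ^+ r.+1).
Proof.
rewrite avg_sum; under eq_bigr => j _ do rewrite avg_sum.
apply: (@le_trans _ _ (\sum_(j < L) \sum_(i < r.+1) 2 * (2 * kappa) ^+ r.+1)); last first.
  by rewrite !sumr_ord_const; apply: ler_eq; ring.
apply: ler_sum => j _; apply: ler_sum => i _.
pose iota : option ('I_s.+1 + 'I_r.+1 * 'I_s.+1) -> slot :=
  extend None (glue (fun k => Some (inord j, i, k)) (fun ik => Some (inord j.+1, ik.1, ik.2))).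
pose F (y : option ('I_s.+1 + 'I_r.+1 * 'I_s.+1) -> V) : R :=
  (rich (y None) && ~~ poor (y None) (fun k => y (Some (inl k))))%:R *
  \prod_i' (bad (y None) (fun k => y (Some (inl k))) (fun k => y (Some (inr (i', k)))) ||
     poor (y None) (fun k => y (Some (inr (i', k)))))%:R.
have neq_levels := inord_neq_succ (ltn_ord j).
apply: le_trans (@avg_placement_le _ iota F _ _ _) _.
- by move=> [[k|[i1 k]]|] [[k'|[i2 k']]|] //= [] =>
    [->|/neq_levels|/esym/neq_levels|-> ->].
- by rewrite card_option card_sum card_prod !card_ord sample_size mulnC; lia.
- by move=> y; rewrite mulr_ge0 ?prodr_ge0.
have kappa2_ge0 : 0 <= (2 * kappa) ^+ r.+1 by rewrite exprn_ge0 // mulr_ge0 // ltW.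
rewrite ler_pM2l // (avg_extend F); apply: avg_le_cst => // v.
rewrite (avg_glue (fun y => F (extend v y))).
apply: avg_le_cst => [|S]; first by rewrite card_ffun expn_gt0 V_gt0.
rewrite /F /= avgZ; case: andP => [[v_rich S_rich]|_]; last by rewrite mul0r.
by rewrite mul1r -[X in _ ^+ X]card_ord; exact: avg_dead_end.
Qed.

Hypothesis L_gt0 : (0 < L)%N.

Lemma avg_first_defect :
  avg (fun sg => first_defect (placement sg)) <= 2 * (r.+1%:R * defect_bound).
Proof.
rewrite avg_sum; apply: (@le_trans _ _ (\sum_(i < r.+1) 2 * defect_bound)); last first.
  by rewrite sumr_ord_const; apply: ler_eq; ring.
apply: ler_sum => i _.
pose iota : option ('I_s.+1 + 'I_s.+1) -> slot :=
  extend None (glue (fun k => Some (inord 0, ord0, k)) (fun k => Some (inord 1, i, k))).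
pose F (y : option ('I_s.+1 + 'I_s.+1) -> V) : R :=
  (is_regular (fun k => y (Some (inl k))))%:R *
  block_defect G (y None) (fun k => y (Some (inl k))) (fun k => y (Some (inr k))).
have neq_levels := inord_neq_succ L_gt0.
apply: le_trans (@avg_placement_le _ iota F _ _ _) _.
- by move=> [[k|k]|] [[k'|k']|] //= [] => [->|/neq_levels|/esym/neq_levels|->].
- by rewrite card_option card_sum !card_ord sample_size; lia.
- by move=> y; rewrite mulr_ge0 ?block_defect_ge0.
rewrite ler_pM2l // (avg_extend F).
apply: le_trans (avg_block_defect 'I_s.+1 rho_gt0 h_ge0 G_flat V_gt0); apply: ler_avg => v.
by rewrite (avg_glue (fun y => F (extend v y))).
Qed.

Lemma avg_step_placement (j : 'I_L) i i' : (0 < j)%N -> avg (fun sg =>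
    (is_regular (block (placement sg) j i) && is_regular (block (placement sg) j.+1 i'))%:R *
    step_cost G (last_vertex (placement sg)) (block (placement sg) j i)
      (block (placement sg) j.+1 i') (first_vertex (placement sg))) <=
  2 * (2 * defect_bound / (rho * #|V|%:R)).
Proof.
move=> j0; pose iota : option (option ('I_s.+1 + 'I_s.+1)) -> slot :=
  extend (first_slot L r s) (extend None
    (glue (fun k => Some (inord j, i, k)) (fun k => Some (inord j.+1, i', k)))).
pose F (y : option (option ('I_s.+1 + 'I_s.+1)) -> V) : R :=
  (is_regular (fun k => y (Some (Some (inl k)))) &&
   is_regular (fun k => y (Some (Some (inr k)))))%:R *
  step_cost G (y (Some None)) (fun k => y (Some (Some (inl k))))
    (fun k => y (Some (Some (inr k)))) (y None).
have neq_levels := inord_neq_succ (ltn_ord j).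
have inord_neq0 m : (0 < m <= L)%N -> (inord m : 'I_L.+1) <> ord0.
  move=> /andP[m0 mL] /(congr1 (fun i : 'I_L.+1 => i : nat)).
  by rewrite inordK // => /= m_eq0; rewrite m_eq0 in m0.
have neq0 : (inord j : 'I_L.+1) <> ord0 by apply: inord_neq0; rewrite j0 /= ltnW.
have neq0S : (inord j.+1 : 'I_L.+1) <> ord0 by apply: inord_neq0; rewrite /= ltn_ord.
apply: le_trans (@avg_placement_le _ iota F _ _ _) _.
- by move=> [[[k|k]|]|] [[[k'|k']|]|] //= [] =>
    [->|/neq_levels|/neq0|/esym/neq_levels|->|/neq0S|/esym/neq0|/esym/neq0S].
- by rewrite !card_option card_sum !card_ord sample_size; lia.
- by move=> y; rewrite mulr_ge0 ?step_cost_ge0.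
rewrite ler_pM2l // (avg_extend F).
apply: le_trans (avg_step_cost 'I_s.+1 rho_gt0 h_ge0 G_flat V_gt0); apply: ler_avg => u.
rewrite (avg_extend (fun y => F (extend u y))); apply: ler_avg => v.
by rewrite (avg_glue (fun y => F (extend u (extend v y)))).
Qed.

Lemma avg_total_cost : avg (fun sg => total_cost (placement sg)) <=
  2 * (L%:R * r.+1%:R ^+ 2 * (2 * defect_bound / (rho * #|V|%:R))).
Proof.
have bound_ge0 : 0 <= 2 * (2 * defect_bound / (rho * #|V|%:R)).
  by rewrite !mulr_ge0 ?invr_ge0 ?mulr_ge0 ?sqr_ge0 // ltW.
apply: (@le_trans _ _ (\sum_(j < L) \sum_(i < r.+1) \sum_(i < r.+1)
    2 * (2 * defect_bound / (rho * #|V|%:R)))); last first.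
  by rewrite !sumr_ord_const; apply: ler_eq; ring.
rewrite avg_sum big_mkcond; apply: ler_sum => j _; case: ifP => [j0|_]; last first.
  by do 2 (apply: sumr_ge0 => ? _).
rewrite avg_sum; apply: ler_sum => i _; rewrite avg_sum; apply: ler_sum => i' _.
exact: avg_step_placement.
Qed.

Lemma avg_failure : avg (fun sg => failure (placement sg)) <=
  failure_bound theta er defect_bound (rho * #|V|%:R) kappa tau1 tau2 L r.
Proof.
have -> : (fun sg => failure (placement sg)) = fun sg => pair_failure (placement sg) +
  (irregular_blocks (placement sg) + (poor_apex (placement sg) + (poor_start (placement sg) +
    (dead_ends (placement sg) + (tau1^-1 * total_cost (placement sg) +
      tau2^-1 * first_defect (placement sg)))))).
  by apply/funext => sg; rewrite /failure; ring.
rewrite /failure_bound 6!avgD 2!avgZ !mulrDr -!addrA.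
rewrite lerD ?avg_pair_failure // lerD ?avg_irregular_blocks // lerD ?avg_poor_apex //.
rewrite lerD ?avg_poor_start // lerD ?avg_dead_ends // lerD //.
  by rewrite mulrC mulrA ler_pdivlMr // divfK ?gt_eqF // avg_total_cost.
by rewrite mulrC mulrA ler_pdivlMr // divfK ?gt_eqF // avg_first_defect.
Qed.

End Averages.
End Placements.

(** * Transport for a matrix with few rows *)

Lemma sum_num_nonzero_owned (R : realType) (V T J : finType) (M : V -> J -> T -> R)
    (owner : J -> V) : (forall a l b, M a l b != 0 -> owner l = a) ->
  (\sum_a num_nonzero (M a) <= #|J|)%N.
Proof.
move=> M_owner; apply: (@leq_trans (\sum_a \sum_(l : J) (owner l == a))).
  apply: leq_sum => a _; rewrite /num_nonzero -sum1dep_card big_mkcond /=; apply: leq_sum => l _.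
  case: ifP => // /eqP Ml_nz; have [b /M_owner->] : exists b, M a l b != 0; last by rewrite eqxx.
  apply: contrapT => /forallNP Ml0; apply: Ml_nz; apply/funext => b; apply/eqP.
  by have /negP := Ml0 b; rewrite negbK.
rewrite exchange_big /= (eq_bigr (fun=> 1%N)) ?sum1_card // => l _.
by rewrite (bigD1 (owner l)) //= eqxx big1 // => a /negPf; rewrite eq_sym => ->.
Qed.

Section FewRows.
Variables (R : realType) (V J : finType) (M : V -> J -> V -> R) (N : nat) (K : R).
Hypothesis M_hollow : hollow M.
Hypothesis M_rows : (\sum_a num_nonzero (M a) <= N)%N.
Hypothesis K_ge1 : 1 <= K.
Hypothesis V_gt0 : (0 < #|V|)%N.
Notation n := (#|V|%:R : R).

Let n_gt0 : 0 < n. Proof. by rewrite ltr0n. Qed.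
Let K_gt0 : 0 < K. Proof. exact: lt_le_trans K_ge1. Qed.
Let eta_gt0 : 0 < K / n. Proof. by rewrite divr_gt0. Qed.

Definition heavy a : bool := (K < (num_nonzero (M a))%:R)%R.

Definition light_pair a b : bool := ~~ heavy a && ~~ heavy b.

Lemma light_pairC a b : light_pair a b = light_pair b a.
Proof. exact: andbC. Qed.

Definition light_part a l b : R := (light_pair a b)%:R * M a l b.

Definition pair_weight := min_weight light_part (K / n).

Definition flat_rows := reweight light_part pair_weight.

Definition good_pair a b : bool := (1 <= pair_weight a b)%R && light_pair a b.

Lemma heavy_card : #|[set a | heavy a]%SET|%:R * K <= N%:R.
Proof.
apply: (@le_trans _ _ (\sum_a (num_nonzero (M a))%:R)); last by rewrite -natr_sum ler_nat.
rewrite -sumr_bool mulr_suml; apply: ler_sum => a _.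
by rewrite /heavy; case: ltP => [/ltW|_]; rewrite ?mul1r // mul0r.
Qed.

Lemma light_part_hollow : hollow light_part.
Proof. by move=> a l; rewrite /light_part M_hollow mulr0. Qed.

Lemma num_nonzero_light a : (num_nonzero (light_part a) <= num_nonzero (M a))%N.
Proof. by apply: num_nonzero_le => l Ml0; apply/funext => b; rewrite /light_part Ml0 mulr0. Qed.

Lemma num_nonzero_flat_rows a : (num_nonzero (flat_rows a))%:R <= K.
Proof.
apply: (@le_trans _ _ (num_nonzero (light_part a))%:R).
  by rewrite ler_nat num_nonzero_reweight.
have [a_heavy|a_light] := boolP (heavy a).
  rewrite /num_nonzero (_ : [set _ | _]%SET = finset.set0) ?cards0 ?ltW //.
  apply/setP => l; rewrite !inE; apply/negbTE; rewrite negbK; apply/eqP/funext => b.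
  by rewrite /light_part /light_pair a_heavy mul0r.
apply: le_trans (_ : (num_nonzero (M a))%:R <= _); first by rewrite ler_nat num_nonzero_light.
by move: a_light; rewrite /heavy -leNgt.
Qed.

Lemma flat_rows_hollow : hollow flat_rows.
Proof. by move=> a l; rewrite /flat_rows /reweight light_part_hollow mulr0. Qed.

Lemma flat_rows_flat : flat (2 * (K / n)) flat_rows.
Proof. exact: flat_reweight_min light_part_hollow. Qed.

Lemma sum_light_weight : \sum_(p : V * V) (pair_weight p.1 p.2 < 1)%R%:R <= 2 * N%:R * n / K.
Proof.
rewrite (sumr_bool R (fun p : V * V => (pair_weight p.1 p.2 < 1)%R)).
rewrite ler_pdivlMr // -ler_pdivrMr // -mulrA; apply: le_trans (min_weight_card _ eta_gt0) _.
rewrite ler_pM2l // ler_nat; apply: leq_trans M_rows; apply: leq_sum => a _.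
exact: num_nonzero_light.
Qed.

Lemma avg_bad_pair : avg (fun u => avg (fun v => (~~ good_pair u v)%:R)) <= 4 * N%:R / (K * n).
Proof.
rewrite -(avg_pair (fun u v => (~~ good_pair u v)%:R)) /avg card_prod natrM invfM.
have -> : 4 * N%:R / (K * n) = n^-1 / n * (4 * N%:R * n / K) by field; rewrite !gt_eqF.
rewrite ler_pM2l ?divr_gt0 ?invr_gt0 //.
apply: (@le_trans _ _ (\sum_(p : V * V)
    ((pair_weight p.1 p.2 < 1)%R%:R + (heavy p.1)%:R + (heavy p.2)%:R))).
  apply: ler_sum => p _; rewrite /good_pair /light_pair -!natrD ler_nat ltNge.
  by case: (1 <= pair_weight _ _)%R; case: (heavy p.1); case: (heavy p.2).
have sum_heavy : \sum_a \sum_(b : V) (heavy a)%:R <= N%:R * n / K.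
  rewrite (eq_bigr (fun a => (heavy a)%:R * n)) => [|a _]; last by rewrite sumr_const mulr_natr.
  by rewrite -mulr_suml sumr_bool mulrAC ler_pM2r // ler_pdivlMr // heavy_card.
rewrite !big_split /= -(pair_bigA _ (fun a b => (heavy a)%:R)) /=.
rewrite -(pair_bigA _ (fun a b => (heavy b)%:R)) /= [X in _ + _ + X]exchange_big /=.
by have := sum_light_weight; lra.
Qed.

Let weight_ge0 a b : 0 <= pair_weight a b.
Proof. exact: min_weight_ge0. Qed.

Lemma symm_flat_rows (y : J -> R) a b : symm (fun a => lincomb (flat_rows a) y) a b ^+ 2 =
  pair_weight a b * (light_pair a b)%:R * symm (fun a => lincomb (M a) y) a b ^+ 2.
Proof.
have rowE c d : lincomb (flat_rows c) y d =
    Num.sqrt (pair_weight c d) * (light_pair c d)%:R * lincomb (M c) y d.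
  rewrite lincomb_reweight -mulrA; congr (_ * _); rewrite /lincomb mulr_sumr.
  by apply: eq_bigr => l _; rewrite mulrCA.
rewrite /symm !rowE (light_pairC b a) (_ : pair_weight b a = pair_weight a b);
  last exact: min_weightC.
rewrite -mulrDr !exprMn sqr_sqrtr //.
by case: (light_pair a b); rewrite ?expr1n // expr0n.
Qed.

Lemma symm_good_pair (y : J -> R) a b : good_pair a b ->
  symm (fun a => lincomb (flat_rows a) y) a b ^+ 2 = symm (fun a => lincomb (M a) y) a b ^+ 2.
Proof.
move=> /andP[w_ge1 ab_light]; rewrite symm_flat_rows ab_light.
have -> : pair_weight a b = 1 by apply/le_anti; rewrite w_ge1 min_weight_le1.
by rewrite !mul1r.
Qed.

Lemma symm_flat_rows_le (y : J -> R) a b :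
  symm (fun a => lincomb (flat_rows a) y) a b ^+ 2 <= symm (fun a => lincomb (M a) y) a b ^+ 2.
Proof.
rewrite symm_flat_rows ler_piMl ?sqr_ge0 //.
by case: (light_pair a b); rewrite ?mulr1 ?mulr0 ?min_weight_le1.
Qed.

Variables (kappa tau1 tau2 : R) (L r s : nat) (emb : slot L r s -> V).
Hypothesis kappa_gt0 : 0 < kappa.
Hypothesis tau1_gt0 : 0 < tau1.
Hypothesis tau2_gt0 : 0 < tau2.
Hypothesis L_gt0 : (0 < L)%N.
Hypothesis emb_inj : injective emb.
Hypothesis V_large : (2 * (s.+1 * (r + 3) + 2) ^ 2 <= #|V|)%N.
Notation eta := (4 * K / s.+1%:R).
Hypothesis eta_small : 16 * eta <= 1.

Definition few_rows_failure : R :=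
  failure_bound (4 * N%:R / (K * n)) (2 * n * K ^+ 2 * expR (- (s.+1%:R / (512 * K ^+ 4))))
    (8 * eta ^+ 2 * (2 * s.+1 + 1)%:R) (s.+1%:R / 2) kappa tau1 tau2 L r.

Lemma few_rows_transport : exists good : {perm V} -> bool,
  avg (fun sg => (~~ good sg)%:R) <= few_rows_failure /\
  forall sg, good sg -> forall y : J -> R,
    symm (fun a => lincomb (M a) y) (sg (emb (first_slot L r s))) (sg (emb None)) ^+ 2 <=
    transport_const eta tau1 tau2 L * (2 * \sum_p \sum_(q | close p q)
      symm (fun a => lincomb (M a) y) (sg (emb p)) (sg (emb q)) ^+ 2).
Proof.
pose h : R := 2 * (K / n); pose rho : R := s.+1%:R / (2 * n).
have s0 : 0 < s.+1%:R :> R by rewrite ltr0n.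
have rho0 : 0 < rho by rewrite divr_gt0 // mulr_gt0.
have h0 : 0 <= h by rewrite mulr_ge0 // ltW.
have etaE : eta = h / rho by rewrite /h /rho; field; rewrite !gt_eqF.
pose fail sg := failure flat_rows rho kappa tau1 tau2 good_pair (placement emb sg).
exists (fun sg => fail sg < 1); split=> [|sg sg_good y].
  apply: (@le_trans _ _ (avg fail)).
    apply: ler_avg => sg; rewrite -leNgt; have fail_ge0 : 0 <= fail sg by exact: failure_ge0.
    by case: (leP 1 (fail sg)).
  have h_ge : n^-1 <= h by rewrite /h mulrA ler_pMl ?invr_gt0 //; move: K_ge1; lra.
  have irregular := avg_irregular V_gt0 K_ge1 num_nonzero_flat_rows flat_rows_flat h_ge
    (I := 'I_s.+1).
  rewrite card_ord -/rho in irregular.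
  apply: le_trans (avg_failure tau1_gt0 tau2_gt0 emb_inj V_large rho0 h0 kappa_gt0 flat_rows_flat
    avg_bad_pair (irregular isT) L_gt0) _.
  rewrite /few_rows_failure /defect_bound card_ord -etaE.
  rewrite (_ : s.+1%:R / (128 * n ^+ 2 * K ^+ 2 * h ^+ 2) = s.+1%:R / (512 * K ^+ 4)); last first.
    by rewrite /h; field; rewrite !gt_eqF.
  by rewrite (_ : rho * n = s.+1%:R / 2) // /rho; field; rewrite gt_eqF.
have ratio_small : 16 * (h / rho) <= 1 by rewrite -etaE.
rewrite etaE; have := success_transport tau1_gt0 tau2_gt0 sg_good rho0 h0
  flat_rows_hollow flat_rows_flat
  ratio_small L_gt0 (F := fun a => lincomb (flat_rows a) y) (fun a => ex_intro _ y erefl).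
rewrite symm_good_pair; last exact: success_pair sg_good.
move=> /le_trans; apply; rewrite ler_wpM2l //.
  by rewrite transport_const_ge0 ?divr_ge0 // ltW.
rewrite ler_pM2l //; apply: ler_sum => p _; apply: ler_sum => q _.
exact: symm_flat_rows_le.
Qed.

End FewRows.

(** * Hellinger affinity on the line *)

Section IntegralR.
Variable R : realType.
Implicit Types f g : R -> R.

Definition integralR f : \bar R := (\int[@lebesgue_measure R]_t (f t)%:E)%E.
Arguments integralR f%_ring_scope.

Lemma integralR_ge0 f : (forall t, 0 <= f t) -> (0 <= integralR f)%E.
Proof. by move=> f0; apply: integral_ge0 => t _; rewrite lee_fin. Qed.

Lemma integralRD f g : measurable_fun setT f -> measurable_fun setT g ->
  (forall t, 0 <= f t) -> (forall t, 0 <= g t) ->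
  integralR (fun t => f t + g t) = (integralR f + integralR g)%E.
Proof.
move=> mf mg f0 g0; rewrite /integralR -ge0_integralD //; try by move=> t _; rewrite lee_fin.
- exact/measurable_EFinP.
- exact/measurable_EFinP.
Qed.

Lemma integralRZ f k : measurable_fun setT f -> (forall t, 0 <= f t) -> 0 <= k ->
  integralR (fun t => k * f t) = (k%:E * integralR f)%E.
Proof.
move=> mf f0 k0; rewrite /integralR -ge0_integralZl_EFin //; first by move=> t _; rewrite lee_fin.
exact/measurable_EFinP.
Qed.

Lemma le_integralR f g : measurable_fun setT f -> measurable_fun setT g ->
  (forall t, 0 <= f t) -> (forall t, f t <= g t) -> (integralR f <= integralR g)%E.
Proof.
move=> mf mg f0 fg; apply: ge0_le_integral => //; try by move=> t _; rewrite lee_fin.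
- exact/measurable_EFinP.
- exact/measurable_EFinP.
Qed.

Definition translation (a t : R) : R := t - a.

Lemma measurable_translation (a : R) :
  measurable_fun [set: measurableTypeR R] (translation a : _ -> measurableTypeR R).
Proof. by apply: measurable_funB => //; exact: measurable_cst. Qed.

HB.instance Definition _ (a : R) := isMeasurableFun.Build _ _ _ _
  (translation a : measurableTypeR R -> measurableTypeR R) (measurable_translation a).

Lemma lebesgue_measure_translation (a : R) (A : set R) : measurable A ->
  pushforward (@lebesgue_measure R) (translation a : _ -> measurableTypeR R) A =
  lebesgue_measure A.
Proof.
move=> mA; apply/esym/lebesgue_measure_unique => //= _ [[x y]] _ <-.
rewrite /pushforward.
have -> : translation a @^-1` (`]x, y]%classic : set R) = `]x + a, y + a]%classic.
  by apply/seteqP; split => t /=; rewrite !in_itv /= /translation ltrBrDr lerBlDr.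
rewrite /= !lebesgue_measure_itv /= !lte_fin ltrD2r.
by case: ifP => // _; rewrite -!EFinD; congr (_%:E); ring.
Qed.

Lemma measurable_fun_translate f (a : R) :
  measurable_fun setT f -> measurable_fun setT (fun t : R => f (t - a)).
Proof. by move=> mf; apply: (measurableT_comp mf); exact: measurable_translation. Qed.

Lemma integralR_translate f a : measurable_fun setT f -> (forall t, 0 <= f t) ->
  integralR (fun t => f (t - a)) = integralR f.
Proof.
move=> mf f0; rewrite /integralR.
transitivity (\int[pushforward (@lebesgue_measure R)
    (translation a : _ -> measurableTypeR R)]_t (f t)%:E)%E.
  rewrite ge0_integral_pushforward //.
  - exact/measurable_EFinP.
  - by move=> t _; rewrite lee_fin.
by apply: eq_measure_integral => //= A mA _; exact: lebesgue_measure_translation.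
Qed.

Lemma integralR_indic (a b : R) : a <= b -> integralR (\1_(`[a, b]%classic : set R)) = (b - a)%:E.
Proof.
move=> ab; rewrite /integralR integral_indic // setIT /= lebesgue_measure_itv /= lte_fin.
by case: ltP => // ba; rewrite (_ : b = a) ?subrr //; apply/le_anti; rewrite ab ba.
Qed.

Lemma measurable_scale f k : measurable_fun setT f -> measurable_fun setT (fun t : R => k * f t).
Proof. by move=> mf; apply: measurable_funM => //; exact: measurable_cst. Qed.

Lemma integralR_cauchy_schwarz f g A : measurable_fun setT f -> measurable_fun setT g ->
  (forall t, 0 <= f t) -> (forall t, 0 <= g t) ->
  integralR (fun t => f t ^+ 2) = A%:E -> integralR (fun t => g t ^+ 2) = 1%E ->
  (integralR (fun t => f t * g t)%R <= (Num.sqrt A)%:E)%E.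
Proof.
move=> mf mg f0 g0 fA g1; apply/lee_addgt0Pr => e e0.
have A0 : 0 <= A by rewrite -lee_fin -fA integralR_ge0 // => t; exact: sqr_ge0.
have sA0 := sqrtr_ge0 A; pose l := Num.sqrt A + e; have l0 : 0 < l by rewrite /l; lra.
have mf2 : measurable_fun setT (fun t : R => f t ^+ 2) by exact: measurable_funX.
have mg2 : measurable_fun setT (fun t : R => g t ^+ 2) by exact: measurable_funX.
have p1 : 0 <= (2 * l)^-1 by rewrite invr_ge0 mulr_ge0 // ltW.
have p2 : 0 <= l / 2 by rewrite divr_ge0 // ltW.
apply: (@le_trans _ _ (integralR (fun t => (2 * l)^-1 * f t ^+ 2 + l / 2 * g t ^+ 2))).
  apply: le_integralR.
  - exact: measurable_funM.
  - by apply: measurable_funD; exact: measurable_scale.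
  - by move=> t; rewrite mulr_ge0.
  - move=> t; rewrite -subr_ge0 (_ : _ - _ = (2 * l)^-1 * (f t - l * g t) ^+ 2).
      by rewrite mulr_ge0 ?sqr_ge0.
    by field; rewrite gt_eqF.
rewrite integralRD; [|exact: measurable_scale|exact: measurable_scale
  |by move=> t; rewrite mulr_ge0 ?sqr_ge0|by move=> t; rewrite mulr_ge0 ?sqr_ge0].
rewrite !integralRZ // ?fA ?g1 ?mule1 => [|t|t]; [|exact: sqr_ge0|exact: sqr_ge0].
rewrite -!EFinM -!EFinD lee_fin -/l mulrC -[X in X / _](sqr_sqrtr A0).
rewrite -lerBrDr ler_pdivrMr ?mulr_gt0 //.
by rewrite /l; nra.
Qed.

End IntegralR.
Arguments integralR {R} f%_ring_scope.

Section SqrtDensity.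
Variables (R : realType) (k : R) (g : R -> R).

Definition sqrt_density := [/\ measurable_fun setT g, forall t, 0 <= g t,
  forall t, g t != 0 -> 1 <= t <= 2, integralR (fun t => g t ^+ 2) = 1%E &
  forall t t', (g t - g t') ^+ 2 <= k * (t - t') ^+ 2].

Definition density_mean (a : R -> R) : R := fine (integralR (fun t => a t * g t ^+ 2)).

Hypothesis g_density : sqrt_density.

Lemma sqrt_density_measurable : measurable_fun setT g.
Proof. by have [] := g_density. Qed.

Lemma sqrt_density_ge0 t : 0 <= g t.
Proof. by have [_ + _ _ _] := g_density; apply. Qed.

Lemma sqrt_density_sqr_measurable : measurable_fun setT (fun t : R => g t ^+ 2).
Proof. exact: measurable_funX sqrt_density_measurable. Qed.

Lemma integralR_translate_density z : integralR (fun t => g (t - z) ^+ 2) = 1%E.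
Proof.
have [_ _ _ g1 _] := g_density.
rewrite (integralR_translate z (f := fun t => g t ^+ 2)) //.
  exact: sqrt_density_sqr_measurable.
by move=> t; exact: sqr_ge0.
Qed.

Lemma translation_cost_pointwise z t : g t ^+ 2 + g (t - z) ^+ 2 <=
  2 * (g t * g (t - z)) + k * z ^+ 2 *
    ((\1_(`[1, 2]%classic : set R) : R -> R) t +
     (\1_(`[1, 2]%classic : set R) : R -> R) (t - z)).
Proof.
have [_ _ g_supp _ /(_ t (t - z))] := g_density; rewrite (_ : t - (t - z) = z); last by ring.
move=> lip; rewrite -lerBlDl (_ : _ - _ = (g t - g (t - z)) ^+ 2); last by ring.
have off_supp x : x \notin (`[1, 2]%classic : set R) -> g x = 0.
  rewrite notin_setE /= in_itv /= => /negP x_out; apply/eqP; apply: contraNT x_out.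
  exact: g_supp.
have kz0 : 0 <= k * z ^+ 2 by apply: le_trans lip; exact: sqr_ge0.
move: lip; rewrite !indicE; case: (boolP (t \in _)) => [_|/off_supp->] lip.
  by apply: le_trans lip _; rewrite ler_peMr // lerDl.
case: (boolP (t - z \in _)) lip => [_|/off_supp->] lip.
  by rewrite [X in _ * X]add0r mulr1.
by rewrite subrr expr0n addr0 mulr0.
Qed.

Lemma affinity_translate z :
  ((1 - k * z ^+ 2)%R%:E <= integralR (fun t => g t * g (t - z))%R)%E.
Proof.
have [mg g0 _ g1 lip] := g_density.
have mgz := measurable_fun_translate z mg.
have m1 : measurable_fun setT (\1_(`[1, 2]%classic : set R) : R -> R) by exact: measurable_indic.
have indic0 t : 0 <= (\1_(`[1, 2]%classic : set R) : R -> R) t by rewrite indicE.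
have kz0 : 0 <= k * z ^+ 2.
  by apply: le_trans (sqr_ge0 (g z - g 0)) _; have := lip z 0; rewrite subr0.
have mgg : measurable_fun setT (fun t : R => g t * g (t - z)) by exact: measurable_funM.
have gg0 t : 0 <= g t * g (t - z) by rewrite mulr_ge0.
have m1z := measurable_fun_translate z m1.
have m11 : measurable_fun setT (fun t : R => (\1_(`[1, 2]%classic : set R) : R -> R) t +
  (\1_(`[1, 2]%classic : set R) : R -> R) (t - z)) by exact: measurable_funD.
have sum_measurable : measurable_fun setT (fun t : R => g t ^+ 2 + g (t - z) ^+ 2).
  by apply: measurable_funD; exact: measurable_funX.
have := le_integralR sum_measurable
  (measurable_funD (measurable_scale 2 mgg) (measurable_scale (k * z ^+ 2) m11))
  (fun t => addr_ge0 (sqr_ge0 _) (sqr_ge0 _)) (translation_cost_pointwise z).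
rewrite integralRD; [|exact: measurable_funX|exact: measurable_funX
  |by move=> t; exact: sqr_ge0|by move=> t; exact: sqr_ge0].
rewrite g1 integralR_translate_density integralRD; [|exact: measurable_scale
  |exact: measurable_scale|by move=> t; rewrite mulr_ge0|by move=> t; rewrite mulr_ge0 // addr_ge0].
rewrite !integralRZ //.
rewrite integralRD // (integralR_translate z m1) // integralR_indic; last by lra.
have := integralR_ge0 gg0; case: (integralR _) => [x| |] // _; last by move=> _; rewrite leey.
by rewrite -!EFinD !lee_fin; lra.
Qed.

Lemma density_meanP (a : R -> R) : measurable_fun setT a -> (forall t, 0 <= a t <= 1) ->
  integralR (fun t => a t * g t ^+ 2) = (density_mean a)%:E /\ 0 <= density_mean a <= 1.
Proof.
move=> ma a01; have [_ _ _ g1 _] := g_density.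
have ag0 t : 0 <= a t * g t ^+ 2 by rewrite mulr_ge0 ?sqr_ge0 //; case/andP: (a01 t).
have int0 := integralR_ge0 ag0.
have int1 : (integralR (fun t => a t * g t ^+ 2)%R <= 1%E)%E.
  rewrite -g1; apply: le_integralR => // [||t].
  - by apply: measurable_funM => //; exact: sqrt_density_sqr_measurable.
  - exact: sqrt_density_sqr_measurable.
  - by rewrite ler_piMl ?sqr_ge0 //; case/andP: (a01 t).
have int_fin : integralR (fun t => a t * g t ^+ 2) \is a fin_num.
  by rewrite ge0_fin_numE //; apply: le_lt_trans int1 _; rewrite ltry.
have meanE : integralR (fun t => a t * g t ^+ 2) = (density_mean a)%:E.
  by rewrite /density_mean fineK.
by move: int0 int1; rewrite meanE !lee_fin => -> ->.
Qed.

Let measurable_sqrt_fun (a : R -> R) :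
  measurable_fun setT a -> measurable_fun setT (fun t : R => Num.sqrt (a t)).
Proof.
by move=> ma; apply: measurableT_comp ma; apply: continuous_measurable_fun; exact: sqrt_continuous.
Qed.

Lemma integralR_sqrt_density (a : R -> R) (g' : R -> R) : measurable_fun setT a ->
  (forall t, 0 <= a t <= 1) -> measurable_fun setT g' -> (forall t, 0 <= g' t) ->
  integralR (fun t => g' t ^+ 2) = 1%E ->
  (integralR (fun t => Num.sqrt (a t) * g t * g' t)%R <= (Num.sqrt (density_mean a))%:E)%E.
Proof.
move=> ma a01 mg' g'0 g'1; apply: integralR_cauchy_schwarz => //.
- by apply: measurable_funM; [exact: measurable_sqrt_fun|exact: sqrt_density_measurable].
- by move=> t; rewrite mulr_ge0 ?sqrtr_ge0 ?sqrt_density_ge0.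
have [<- _] := density_meanP ma a01; congr integralR; apply/funext => t.
by rewrite exprMn sqr_sqrtr //; case/andP: (a01 t).
Qed.

Lemma hellinger_translate (a b : R -> R) (kap z : R) :
  measurable_fun setT a -> measurable_fun setT b ->
  (forall t, 0 <= a t <= 1) -> (forall t, 0 <= b t <= 1) -> 0 <= kap ->
  (forall t, kap <= Num.sqrt (a t) + Num.sqrt (b (t - z))) ->
  kap * (1 - k * z ^+ 2) <= Num.sqrt (density_mean a) + Num.sqrt (density_mean b).
Proof.
move=> ma mb a01 b01 kap0 kap_le; have [mg g0 _ g1 _] := g_density.
pose p t := Num.sqrt (a t) * g t * g (t - z).
pose q t := Num.sqrt (b t) * g t * g (t + z).
have mp : measurable_fun setT p.
  by apply: measurable_funM; [apply: measurable_funM => //; exact: measurable_sqrt_fun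
    |exact: measurable_fun_translate].
have mgz : measurable_fun setT (fun t : R => g (t + z)).
  by rewrite -[z]opprK; exact: measurable_fun_translate.
have mq : measurable_fun setT q.
  by apply: measurable_funM => //; apply: measurable_funM => //; exact: measurable_sqrt_fun.
have p0 t : 0 <= p t by rewrite !mulr_ge0 ?sqrtr_ge0.
have q0 t : 0 <= q t by rewrite !mulr_ge0 ?sqrtr_ge0.
have p_le : (integralR p <= (Num.sqrt (density_mean a))%:E)%E.
  apply: integralR_sqrt_density => //; first exact: measurable_fun_translate.
  exact: integralR_translate_density.
have q_le : (integralR q <= (Num.sqrt (density_mean b))%:E)%E.
  apply: integralR_sqrt_density => //.
  by rewrite -[z]opprK integralR_translate_density.
rewrite -lee_fin EFinD; apply: le_trans (leeD p_le q_le).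
rewrite -(integralR_translate z mq q0) -integralRD //; last exact: measurable_fun_translate.
apply: le_trans (_ : (kap%:E * integralR (fun t => g t * g (t - z))%R <= _)%E).
  by rewrite EFinM lee_wpmul2l ?lee_fin // affinity_translate.
rewrite -integralRZ //; last 2 first.
- by apply: measurable_funM => //; exact: measurable_fun_translate.
- by move=> t; rewrite mulr_ge0.
apply: le_integralR.
- by apply: measurable_scale; apply: measurable_funM => //; exact: measurable_fun_translate.
- by apply: measurable_funD => //; exact: measurable_fun_translate.
- by move=> t; rewrite !mulr_ge0.
- by move=> t; rewrite /p /q subrK -!mulrA [g (t - z) * g t]mulrC -mulrDl ler_wpM2r ?mulr_ge0.
Qed.

End SqrtDensity.

Section Tent.
Variable R : realType.

Definition tent (t : R) : R := Num.max 0 (Num.min (t - 1) (2 - t)).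

Lemma tent_ge0 t : 0 <= tent t.
Proof. by rewrite le_max lexx. Qed.

Lemma tent_le1 t : tent t <= 1.
Proof. by rewrite /tent ge_max ge_min ler01 /=; lra. Qed.

Lemma tent_support t : tent t != 0 -> 1 <= t <= 2.
Proof.
rewrite /tent; case: (leP (Num.min (t - 1) (2 - t)) 0) => [_|]; first by rewrite eqxx.
by rewrite lt_min => /andP[? ?] _; lra.
Qed.

Lemma tent_middle t : 5 / 4 <= t <= 7 / 4 -> 1 / 4 <= tent t.
Proof.
by move=> /andP[? ?]; rewrite /tent le_max le_min; apply/orP; right; apply/andP; split; lra.
Qed.

Lemma tent_lipschitz t t' : (tent t - tent t') ^+ 2 <= (t - t') ^+ 2.
Proof.
have diff_le a b : tent a - tent b <= `|a - b|.
  have := ler_norm (a - b); have := ler_norm (b - a); rewrite (distrC b a) => ba ab.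
  rewrite lerBlDr /tent ge_max addr_ge0 ?normr_ge0 ?le_max ?lexx //=.
  rewrite -lerBlDl le_max; apply/orP; right; rewrite le_min lerBlDl lerBlDl.
  by apply/andP; split; rewrite ge_min; apply/orP; [left|right]; lra.
rewrite -[leRHS]real_normK ?num_real // -[leLHS]real_normK ?num_real //.
rewrite lerXn2r ?nnegrE ?normr_ge0 //.
by rewrite ler_norml diff_le lerNl opprB distrC diff_le.
Qed.

Lemma measurable_tent : measurable_fun setT tent.
Proof.
apply: measurable_maxr; first exact: measurable_cst.
apply: measurable_minr; first exact: measurable_translation.
by apply: measurable_funB => //; exact: measurable_cst.
Qed.

Lemma measurable_tent_sqr : measurable_fun setT (fun t : R => tent t ^+ 2).
Proof. exact: measurable_funX measurable_tent. Qed.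

Lemma integralR_tent_le : (integralR (fun t : R => tent t ^+ 2)%R <= 1%:E)%E.
Proof.
have <- : integralR (\1_(`[1, 2]%classic : set R)) = 1%:E.
  by rewrite integralR_indic; [congr (_%:E)|]; lra.
apply: le_integralR => [||t|t].
- exact: measurable_tent_sqr.
- exact: measurable_indic.
- exact: sqr_ge0.
have [->|/tent_support t12] := eqVneq (tent t) 0; first by rewrite expr0n /= indicE ler0n.
rewrite indicE mem_set /= ?in_itv //=.
by rewrite expr2; have := tent_ge0 t; have := tent_le1 t; nra.
Qed.

Lemma integralR_tent_ge : ((1 / 32 : R)%R%:E <= integralR (fun t : R => tent t ^+ 2)%R)%E.
Proof.
have m1 : measurable_fun setT (\1_(`[5 / 4, 7 / 4]%classic : set R) : R -> R).
  exact: measurable_indic.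
have -> : (1 / 32 : R)%:E =
    integralR (fun t => (1 / 16) * (\1_(`[5 / 4, 7 / 4]%classic : set R) : R -> R) t).
  rewrite integralRZ; [|exact: m1|by move=> t; rewrite indicE ler0n|by lra].
  by rewrite integralR_indic; [rewrite -EFinM; congr (_%:E)|]; lra.
apply: le_integralR => [||t|t]; [exact: measurable_scale|exact: measurable_tent_sqr| |].
  by rewrite mulr_ge0 // indicE ler0n.
rewrite indicE; case: (boolP (t \in _)) => [|_]; last by rewrite mulr0 sqr_ge0.
by rewrite inE /= in_itv /= => /tent_middle; rewrite mulr1 expr2; have := tent_ge0 t; nra.
Qed.

Lemma exists_sqrt_density : exists g : R -> R, sqrt_density 32 g.
Proof.
have int_le := integralR_tent_le; have int_ge := integralR_tent_ge.
have int_fin : integralR (fun t : R => tent t ^+ 2) \is a fin_num.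
  rewrite ge0_fin_numE; first by apply: le_lt_trans int_le _; rewrite ltry.
  by apply: integralR_ge0 => t; exact: sqr_ge0.
pose c := fine (integralR (fun t : R => tent t ^+ 2)).
have cE : integralR (fun t : R => tent t ^+ 2) = c%:E by rewrite fineK.
rewrite cE lee_fin in int_ge; have c0 : 0 < c by lra.
exists (fun t => (Num.sqrt c)^-1 * tent t); split.
- by apply: measurable_scale; exact: measurable_tent.
- by move=> t; rewrite mulr_ge0 ?tent_ge0 // invr_ge0 sqrtr_ge0.
- by move=> t nz; apply: tent_support; apply: contraNneq nz => ->; rewrite mulr0.
- have -> : (fun t : R => ((Num.sqrt c)^-1 * tent t) ^+ 2) = fun t => c^-1 * tent t ^+ 2.
    by apply/funext => t; rewrite exprMn exprVn sqr_sqrtr // ltW.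
  rewrite integralRZ; [|exact: measurable_tent_sqr|by move=> t; exact: sqr_ge0
    |by rewrite invr_ge0 ltW].
  by rewrite cE -EFinM mulVf // gt_eqF.
- move=> t t'; rewrite -mulrBr exprMn exprVn sqr_sqrtr ?(ltW c0) //.
  apply: ler_pM; rewrite ?sqr_ge0 ?invr_ge0 ?(ltW c0) ?tent_lipschitz //.
  by rewrite -[leLHS]mul1r ler_pdivrMr //; lra.
Qed.

End Tent.

(** * Iterated means over independent weights *)

Section DensityMeans.
Variables (R : realType) (k : R) (g : R -> R).
Hypothesis g_density : sqrt_density k g.
Variables (d : measure_display) (T : measurableType d) (Phi : T * R -> R).
Hypothesis Phi_measurable : measurable_fun setT Phi.
Hypothesis Phi01 : forall p, 0 <= Phi p <= 1.

Let weighted (p : T * R) : \bar R := (Phi p * g p.2 ^+ 2)%:E.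

Let weighted_ge0 p : (0 <= weighted p)%E.
Proof. by rewrite lee_fin mulr_ge0 ?sqr_ge0 //; case/andP: (Phi01 p). Qed.

Let weighted_measurable : measurable_fun setT weighted.
Proof.
apply/measurable_EFinP; apply: measurable_funM => //; apply: measurable_funX.
exact: (measurableT_comp (sqrt_density_measurable g_density) measurable_snd).
Qed.

Lemma measurable_section x : measurable_fun setT (fun t : R => Phi (x, t)).
Proof. by apply: (measurableT_comp Phi_measurable); exact: measurable_fun_pair. Qed.

Lemma measurable_density_mean :
  measurable_fun setT (fun x => density_mean g (fun t => Phi (x, t))).
Proof.
apply: (measurableT_comp (fine_measurable measurableT)).
exact: (measurable_fun_fubini_tonelli_F (m2 := @lebesgue_measure R) weighted
  weighted_measurable weighted_ge0).
Qed.

Variable P : probability T R.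

Lemma integral_density_mean_le (delta : R) : 0 <= delta ->
  (forall t, 1 <= t <= 2 -> (\int[P]_x (Phi (x, t))%:E <= delta%:E)%E) ->
  (\int[P]_x (density_mean g (fun t => Phi (x, t)))%:E <= delta%:E)%E.
Proof.
have [mg g0 g_supp g1 _] := g_density => delta0 le_delta.
have -> : (\int[P]_x (density_mean g (fun t => Phi (x, t)))%:E =
    \int[P]_x \int[@lebesgue_measure R]_t weighted (x, t))%E.
  apply: eq_integral => x _.
  by have [<- _] := density_meanP g_density (measurable_section x) (fun t => Phi01 (x, t)).
rewrite fubini_tonelli //.
have slice_le t : (\int[P]_x weighted (x, t) <= (delta * g t ^+ 2)%:E)%E.
  rewrite (_ : (\int[P]_x _ = \int[P]_x ((g t ^+ 2)%:E * (Phi (x, t))%:E))%E); last first.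
    by apply: eq_integral => x _; rewrite /weighted /= mulrC EFinM.
  rewrite ge0_integralZl_EFin ?sqr_ge0 //; last 2 first.
  - by move=> x _; rewrite lee_fin; case/andP: (Phi01 (x, t)).
  - apply/measurable_EFinP; apply: (measurableT_comp Phi_measurable).
    by apply: measurable_fun_pair => //; exact: measurable_cst.
  have [->|/g_supp t12] := eqVneq (g t) 0; first by rewrite expr0n /= mul0e mulr0.
  rewrite [leRHS](_ : _ = (g t ^+ 2)%:E * delta%:E)%E; last by rewrite -EFinM mulrC.
  by apply: lee_wpmul2l; [rewrite lee_fin sqr_ge0|exact: le_delta].
apply: (@le_trans _ _ (integralR (fun t => delta * g t ^+ 2))).
  apply: ge0_le_integral => //.
  - by move=> t _; exact: integral_ge0.
  - exact: (measurable_fun_fubini_tonelli_G (m1 := P) weighted).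
  - apply/measurable_EFinP; apply: measurable_scale; exact: measurable_funX.
by rewrite integralRZ ?g1 ?mule1 // => [|t]; [exact: measurable_funX|exact: sqr_ge0].
Qed.

End DensityMeans.

Section IteratedMeans.
Variables (R : realType) (E : eqType) (k : R) (g : R -> R).
Hypothesis g_density : sqrt_density k g.
Implicit Types (F : (E -> R) -> R) (w : E -> R).

(* The mean of [F] when the coordinates in [es] are drawn independently with
   density [g ^ 2] and the others are those of [w]. *)
Fixpoint iterated_mean (es : seq E) F w : R :=
  if es is e :: es' then
    density_mean g (fun t => iterated_mean es' F [eta w with e |-> t])
  else F w.

Definition unit_valued F := forall w, 0 <= F w <= 1.

Section Joint.
Variables (d0 : measure_display) (Om : measurableType d0).
Implicit Type (H : Om -> (E -> R) -> R).

(* Functions of finitely many real coordinates and of a sample: measurability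
   is tested along measurable families, so that no sigma-algebra on [E -> R]
   is needed. *)
Definition jointly_measurable H := forall (d : measure_display) (T : measurableType d)
  (phi : T -> Om) (x : T -> E -> R), measurable_fun setT phi ->
  (forall e, measurable_fun setT (fun t => x t e)) ->
  measurable_fun setT (fun t => H (phi t) (x t)).

Lemma jointly_measurable_at H w : jointly_measurable H -> measurable_fun setT (H^~ w).
Proof. by move=> mH; apply: (mH _ _ id (fun=> w)) => // e; exact: measurable_cst. Qed.

Lemma jointly_measurable_update H e (d : measure_display) (T : measurableType d)
    (phi : T -> Om) (x : T -> E -> R) : jointly_measurable H -> measurable_fun setT phi ->
  (forall e, measurable_fun setT (fun t => x t e)) ->
  measurable_fun setT (fun p : T * R => H (phi p.1) [eta x p.1 with e |-> p.2]).
Proof.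
move=> mH mphi mx.
apply: (mH _ _ (fun p : T * R => phi p.1) (fun p : T * R => [eta x p.1 with e |-> p.2])).
  exact: (measurableT_comp mphi measurable_fst).
move=> e' /=; case: (e' == e); first exact: measurable_snd.
exact: (measurableT_comp (mx e') measurable_fst).
Qed.

Lemma measurable_update H om e w : jointly_measurable H ->
  measurable_fun setT (fun t : R => H om [eta w with e |-> t]).
Proof.
move=> mH; apply: (mH _ _ (fun=> om) (fun t => [eta w with e |-> t])).
  exact: measurable_cst.
by move=> e' /=; case: (e' == e); [exact: measurable_id|exact: measurable_cst].
Qed.

Lemma iterated_mean_regular H es : jointly_measurable H -> (forall om, unit_valued (H om)) ->
  jointly_measurable (fun om => iterated_mean es (H om)) /\
  forall om, unit_valued (iterated_mean es (H om)).
Proof.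
move=> mH H01; elim: es => [//|e es [IHm IH01]]; split=> [d T phi x mphi mx /=|om w /=].
  have mPhi := jointly_measurable_update e IHm mphi mx.
  by apply: (measurable_density_mean g_density mPhi) => p; exact: IH01.
by have [] // := density_meanP g_density (measurable_update om e w IHm) (fun t => IH01 om _).
Qed.

Lemma jointly_measurable_mean H es : jointly_measurable H -> (forall om, unit_valued (H om)) ->
  jointly_measurable (fun om => iterated_mean es (H om)).
Proof. by move=> mH H01; have [] := iterated_mean_regular es mH H01. Qed.

Lemma unit_valued_mean H es om : jointly_measurable H -> (forall om, unit_valued (H om)) ->
  unit_valued (iterated_mean es (H om)).
Proof. by move=> mH H01; have [] := iterated_mean_regular es mH H01. Qed.

Lemma integral_iterated_mean_le (P : probability Om R) H es w (delta : R) :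
  jointly_measurable H -> (forall om, unit_valued (H om)) -> 0 <= delta ->
  (forall w', {in es, forall e, 1 <= w' e <= 2} -> {in [predC es], w' =1 w} ->
     (\int[P]_om (H om w')%:E <= delta%:E)%E) ->
  (\int[P]_om (iterated_mean es (H om) w)%:E <= delta%:E)%E.
Proof.
move=> mH H01 delta0; elim: es w => [|e es IH] w le_delta /=; first exact: le_delta.
have IHm := jointly_measurable_mean es mH H01.
have mPhi : measurable_fun setT
    (fun p : Om * R => iterated_mean es (H p.1) [eta w with e |-> p.2]).
  exact: (@jointly_measurable_update (fun om => iterated_mean es (H om)) e _ Om id (fun=> w)).
apply: (integral_density_mean_le g_density mPhi) => // [p|t t12]; first exact: unit_valued_mean.
apply: (IH [eta w with e |-> t]) => w' w'12 w'w; apply: le_delta => e'.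
  rewrite inE => /orP[/eqP->|/w'12//].
  have [/w'12//|e_out] := boolP (e \in es).
  by rewrite w'w //= eqxx.
by rewrite !inE negb_or => /andP[/negPf ne e'_out]; rewrite w'w //= ne.
Qed.

Lemma iterated_mean_hellinger H H' om es (z : E -> R) (kap : R) :
  jointly_measurable H -> jointly_measurable H' ->
  (forall om, unit_valued (H om)) -> (forall om, unit_valued (H' om)) -> 0 <= kap ->
  (forall e, k * z e ^+ 2 <= 1) ->
  (forall w w', (forall e, w' e = w e - z e) ->
    kap <= Num.sqrt (H om w) + Num.sqrt (H' om w')) ->
  forall w w', {in [predC es], forall e, w' e = w e - z e} ->
  kap * \prod_(e <- es) (1 - k * z e ^+ 2) <=
    Num.sqrt (iterated_mean es (H om) w) + Num.sqrt (iterated_mean es (H' om) w').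
Proof.
move=> mH mH' H01 H'01 kap0 z_small kap_le; elim: es => [|e es IH] w w' w'w.
  by rewrite big_nil mulr1; apply: kap_le => e; exact: w'w.
have IHm := jointly_measurable_mean es mH H01.
have IHm' := jointly_measurable_mean es mH' H'01.
rewrite big_cons mulrCA mulrC /=.
apply: (hellinger_translate g_density (z := z e)).
- exact: measurable_update IHm.
- exact: measurable_update IHm'.
- by move=> t; exact: unit_valued_mean.
- by move=> t; exact: unit_valued_mean.
- by rewrite mulr_ge0 // prodr_ge0 // => e' _; rewrite subr_ge0.
- move=> t; apply: IH => e'; rewrite inE => e'_out /=; case: eqP => [->//|/eqP ne].
  by apply: w'w; rewrite !inE negb_or ne.
Qed.

End Joint.
End IteratedMeans.

(** * Distances, spanners and their measurability *)

Section Weights.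
Variables (R : realType) (n : nat).
Implicit Types (w h : vpair n -> R) (u v a b : 'I_n) (p : seq 'I_n).

Lemma weightC w a b : weight w a b = weight w b a.
Proof. by rewrite /weight finset.setUC. Qed.

Lemma weight_diag w a : weight w a a = 0.
Proof. by rewrite /weight insubF //= finset.setUid cards1. Qed.

Lemma weight_edge w (e : vpair n) a b :
  val e = [set a; b]%SET -> weight w a b = w e.
Proof. by move=> ab; rewrite /weight -ab valK. Qed.

Lemma exists_vpair a b : a != b -> exists e : vpair n, val e = [set a; b]%SET.
Proof.
move=> ab; have two_ends : #|[set a; b]%SET| == 2 by rewrite cards2 ab.
by exists (exist (fun e : {set 'I_n} => #|e| == 2) _ two_ends).
Qed.

Lemma weight_cases a b :
  (forall w, weight w a b = 0) \/
  exists2 e : vpair n, val e = [set a; b]%SET & forall w, weight w a b = w e.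
Proof.
have [e _ ab|no_slot] := insubP {e : {set 'I_n} | #|e| == 2} [set a; b]%SET.
  by right; exists e => // w; exact: weight_edge.
by left => w; rewrite /weight insubN.
Qed.

Lemma weight_lincomb (J : finType) (Phi : J -> vpair n -> R) (y : J -> R) a b :
  weight (lincomb Phi y) a b = lincomb (fun l => weight (Phi l) a) y b.
Proof.
have [no_slot|[e _ ab]] := weight_cases a b.
  by rewrite /lincomb no_slot big1 // => l _; rewrite no_slot mulr0.
by rewrite ab; apply: eq_bigr => l _; rewrite ab.
Qed.

Lemma adjP w a b :
  reflect (exists2 e : vpair n, val e = [set a; b]%SET & is_edge w e)
    (adj w a b).
Proof.
apply: (iffP idP) => [|[e ab we]]; last by rewrite /adj (weight_edge w ab).
rewrite /adj; have [->|[e ab ->]] := weight_cases a b; first by rewrite eqxx.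
by move=> we; exists e.
Qed.

Lemma path_length_nil w u : path_length w u [::] = 0.
Proof. by rewrite /path_length big_nil. Qed.

Lemma path_length_cons w u b p :
  path_length w u (b :: p) = weight w u b + path_length w b p.
Proof. by rewrite /path_length /= big_cons. Qed.

Lemma path_length_ge c w u p : (forall e, is_edge w e -> c <= w e) ->
  path (adj w) u p -> c *+ size p <= path_length w u p.
Proof.
move=> w_ge; elim: p u => [|b p IHp] u /=; first by rewrite path_length_nil.
move=> /andP[/adjP[e ub we] bp].
by rewrite path_length_cons mulrS lerD ?IHp // (weight_edge w ub) w_ge.
Qed.

Lemma level_path (lev : 'I_n -> nat) w u p :
  (forall a b, adj w a b -> (lev b <= (lev a).+1)%N) ->
  path (adj w) u p -> (lev (last u p) <= lev u + size p)%N.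
Proof.
move=> lev_adj; elim: p u => [|b p IHp] u /=; first by rewrite addn0.
move=> /andP[ub bp]; apply: leq_trans (IHp _ bp) _.
by rewrite addnS -addSn leq_add2r lev_adj.
Qed.

Lemma dist_le_edge w a b :
  a != b -> adj w a b -> (dist w a b <= (weight w a b)%:E)%E.
Proof.
move=> ab wab; apply: ereal_inf_lbound; exists [:: b].
  by rewrite /is_path /= wab /= inE ab eqxx.
by rewrite path_length_cons path_length_nil addr0.
Qed.

Lemma dist_ge c w a b : 0 <= c -> (forall e, is_edge w e -> c <= w e) ->
  a != b -> (c%:E <= dist w a b)%E.
Proof.
move=> c0 w_ge ab; apply: le_ereal_inf_tmp => _ [p /and3P[pp _ /eqP lp] <-].
rewrite lee_fin; apply: le_trans (path_length_ge w_ge pp).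
case: p lp {pp} => [/= ab'|? p _]; first by rewrite ab' eqxx in ab.
by rewrite mulrS lerDl mulrn_wge0.
Qed.

Lemma spanner_edge_ge t c w h : 0 <= c -> spanner t w h ->
  (forall e, is_edge w e -> c <= w e) -> forall e, is_edge h e -> c <= h e.
Proof.
move=> c0 [h0 hw wh] w_ge e he; have /cards2P[a [b [ab eab]]] := valP e.
have [dist_wh _] := wh a b.
rewrite -(weight_edge h eab) -lee_fin.
apply: le_trans (dist_ge c0 w_ge ab) (le_trans dist_wh _).
by apply: dist_le_edge => //; apply/adjP; exists e.
Qed.

(* An h-path from u to v avoiding the slot uv climbs at most one level per
   step and has edges of weight at least 1, so it is longer than t. *)
Lemma spanner_keeps_edge t w h (lev : 'I_n -> nat) (e : vpair n) u v :
  spanner t w h -> 0 <= t -> (forall e', is_edge w e' -> 1 <= w e') ->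
  val e = [set u; v]%SET -> w e = 1 ->
  (forall a b, adj w a b -> [set a; b]%SET != [set u; v]%SET ->
    (lev b <= (lev a).+1)%N) ->
  t < (lev v - lev u)%N%:R -> h e != 0.
Proof.
move=> spw t0 w_ge euv we lev_adj t_lt; apply/negP => /eqP he.
have h_ge := spanner_edge_ge ler01 spw w_ge; have [_ hw dist_wh] := spw.
have lev_adj_h a b : adj h a b -> (lev b <= (lev a).+1)%N.
  move=> /adjP[e' eab he']; apply: lev_adj; first by apply/adjP; exists e'; rewrite ?hw.
  rewrite -eab -euv (inj_eq val_inj).
  by apply: contraTneq he' => ->; rewrite /is_edge he eqxx.
have uv : u != v.
  by have /= := valP e; rewrite euv cards2 eqSS eqb1.
have : (dist h u v < ((lev v - lev u)%:R : R)%:E)%E.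
  have [_ le_h] := dist_wh u v; apply: le_lt_trans le_h _.
  apply: le_lt_trans (_ : t%:E * 1%:E < _)%E; last by rewrite mule1 lte_fin.
  rewrite lee_wpmul2l ?lee_fin // -we -(weight_edge w euv) dist_le_edge //.
  by rewrite /adj (weight_edge w euv) we oner_neq0.
move=> /ereal_inf_lt[_ [p /and3P[pp _ /eqP lp] <-]].
rewrite lte_fin ltNge => /negP; apply; apply: le_trans (path_length_ge h_ge pp).
by rewrite ler_nat leq_subLR -[in leqLHS]lp; exact: level_path lev_adj_h pp.
Qed.

Definition edges_within (lo hi : R) w : Prop :=
  forall e, is_edge w e -> lo <= w e <= hi.

Lemma nonneg_edges_within (lo hi : R) w : 0 <= lo -> edges_within lo hi w -> nonneg w.
Proof.
move=> lo0 wlh e; have [->//|/wlh/andP[low _]] := eqVneq (w e) 0.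
exact: le_trans low.
Qed.

Lemma ratio_le_edges_within (lo hi : R) w : 0 < lo -> edges_within lo hi w ->
  (exists e, is_edge w e) -> ratio_le (hi / lo) w.
Proof.
move=> lo0 wlh [e we]; split; first by exists e.
have /andP[low whi] := wlh _ we; have hi0 : 0 <= hi by lra.
have wmax_le : wmax w <= hi.
  rewrite /wmax; elim/big_ind: _ => // [x y xhi yhi|e' _]; first by rewrite ge_max xhi.
  by have [->//|/wlh/andP[]] := eqVneq (w e') 0.
have wmax_ge : lo <= wmax w.
  by apply: le_trans low _; rewrite /wmax (bigD1 e) //= le_max lexx.
have wmin_ge : lo <= wmin w.
  rewrite /wmin; elim/big_ind: _ => // [x y lox loy|e' /wlh/andP[]//].
  by rewrite le_min lox.
by rewrite ler_pM ?invr_ge0 ?lef_pV2 ?posrE //; lra.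
Qed.

End Weights.

Lemma measurable_forall (d : measure_display) (T : measurableType d)
    (I : finType) (A : I -> set T) :
  (forall i, measurable (A i)) -> measurable [set t | forall i, A i t].
Proof.
move=> mA; rewrite (_ : [set t | _] = \bigcap_i A i); last first.
  by apply/seteqP; split => t /= At i; [move=> _|]; exact: At.
by apply: fin_bigcap_measurable => //; exact: finite_finset.
Qed.

Section GraphMeasurability.
Variables (R : realType) (n : nat).
Variables (d : measure_display) (T : measurableType d) (h : T -> vpair n -> R).
Hypothesis mh : forall e, measurable_fun setT (h^~ e).
Implicit Types (u v : 'I_n) (p : seq 'I_n).

Lemma measurable_weight u v : measurable_fun setT (fun s => weight (h s) u v).
Proof.
have [no_slot|[e _ uv]] := weight_cases R u v.
  by under eq_fun do rewrite no_slot; exact: measurable_cst.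
by under eq_fun do rewrite uv; exact: mh.
Qed.

Lemma measurable_path_length u p :
  measurable_fun setT (fun s => path_length (h s) u p).
Proof.
elim: p u => [|b p IHp] u.
  by under eq_fun do rewrite path_length_nil; exact: measurable_cst.
under eq_fun do rewrite path_length_cons.
by apply: measurable_funD; [exact: measurable_weight|exact: IHp].
Qed.

Lemma measurable_is_path u v p :
  measurable_fun setT (fun s => is_path (h s) u v p).
Proof.
apply: measurable_and; last exact: measurable_cst.
elim: p u => [|b p IHp] u; first exact: measurable_cst.
apply: measurable_and => //; apply: measurable_neg.
apply: measurable_fun_eqr; [exact: measurable_weight|exact: measurable_cst].
Qed.

Lemma measurable_dist u v : measurable_fun setT (fun s => dist (h s) u v).
Proof.
pose len k s : \bar R := if unpickle k is Some p then
  if is_path (h s) u v p then (path_length (h s) u p)%:E else +oo%E else +oo%E.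
have mlen k : measurable_fun setT (len k).
  rewrite /len; case: (unpickle k) => [p|]; last exact: measurable_cst.
  apply: measurable_fun_ifT => //; first exact: measurable_is_path.
  by apply/measurable_EFinP; exact: measurable_path_length.
rewrite (_ : (fun s => _) = fun s => einfs (len^~ s) 0).
  exact: measurable_fun_einfs.
apply/funext => s; apply/eqP; rewrite eq_le; apply/andP; split.
  apply: le_ereal_inf_tmp => _ [k _ <-]; rewrite /len.
  case: (unpickle k) => [p|]; rewrite ?leey //; case: ifP => up; rewrite ?leey //.
  by apply: ereal_inf_lbound; exists p.
apply: le_ereal_inf_tmp => _ [p up <-]; apply: ereal_inf_lbound.
by exists (pickle p) => //; rewrite /len pickleK up.
Qed.

Lemma measurable_spanner (t : R) (w : vpair n -> R) :
  measurable [set s | spanner t w (h s)].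
Proof.
have mle (f g : T -> \bar R) : measurable_fun setT f -> measurable_fun setT g ->
    measurable [set s | (f s <= g s)%E].
  by move=> mf mg; rewrite -[X in measurable X]setTI; exact: measurable_lee.
rewrite (_ : [set s | _] = [set s | forall e, (0%:E <= (h s e)%:E)%E] `&`
  [set s | forall e, is_edge (h s) e ==> is_edge w e] `&`
  [set s | forall uv, ((dist w uv.1 uv.2 <= dist (h s) uv.1 uv.2)%E) /\
    (dist (h s) uv.1 uv.2 <= t%:E * dist w uv.1 uv.2)%E]); last first.
  apply/seteqP; split => s [].
    move=> h0 hw dist_h; split; last by move=> [u v]; exact: dist_h.
    by split => e; [rewrite lee_fin; exact: h0|apply/implyP; exact: hw].
  move=> [h0 hw] dist_h; split => [e|e|u v].
  - by rewrite -lee_fin h0.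
  - exact/implyP.
  - exact: (dist_h (u, v)).
apply: measurableI; first apply: measurableI.
- apply: measurable_forall => e; apply: mle; first exact: measurable_cst.
  exact/measurable_EFinP.
- apply: measurable_forall => e; rewrite -[X in measurable X]setTI.
  have medge : measurable_fun setT (fun s => is_edge (h s) e ==> is_edge w e).
    under eq_fun do rewrite implybE.
    apply: measurable_or; last exact: measurable_cst.
    do 2!apply: measurable_neg; apply: measurable_fun_eqr => //.
  exact: (medge measurableT [set true]).
- apply: measurable_forall => -[u v]; apply: measurableI; apply: mle => //=.
  exact: measurable_dist.
  exact: measurable_dist.
Qed.

End GraphMeasurability.

(** * Layered graphs with or without the long edge *)

Section LayeredGraph.
Variables (R : realType) (n L r s : nat) (x : slot L r s -> 'I_n).
Implicit Types (w Y z : vpair n -> R) (e : vpair n) (p q : slot L r s).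

Definition layered_slot e : bool :=
  [exists p, exists q, close p q && (val e == [set x p; x q]%SET)].

Definition layered_slots : seq (vpair n) :=
  [seq e <- enum {: vpair n} | layered_slot e].

Definition layered_graph w e : R := if layered_slot e then w e else 0.

Lemma layered_slotP e :
  reflect (exists p q, close p q /\ val e = [set x p; x q]%SET) (layered_slot e).
Proof.
apply: (iffP existsP) => [[p /existsP[q /andP[pq /eqP epq]]]|[p [q [pq epq]]]].
  by exists p, q.
by exists p; apply/existsP; exists q; rewrite pq epq eqxx.
Qed.

Lemma mem_layered_slots e : (e \in layered_slots) = layered_slot e.
Proof. by rewrite mem_filter mem_enum andbT. Qed.

Lemma lincomb_layered (J : finType) (Phi : J -> vpair n -> R) y :
  lincomb (fun l => layered_graph (Phi l)) y = layered_graph (lincomb Phi y).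
Proof.
apply/funext => e; rewrite /lincomb /layered_graph; case: ifP => // _.
by rewrite big1 // => l _; rewrite mulr0.
Qed.

Lemma sqr_weight Y a b :
  weight Y a b ^+ 2 = \sum_e (val e == [set a; b]%SET)%:R * Y e ^+ 2.
Proof.
have [no_slot|[e eab ->]] := weight_cases R a b; last first.
  rewrite (bigD1 e) //= eab eqxx mul1r big1 ?addr0 // => e' e'e.
  by rewrite -eab (inj_eq val_inj) (negPf e'e) mul0r.
rewrite no_slot expr0n big1 // => e _; case: eqP => [eab|]; rewrite ?mul0r //.
by have := weight_edge Y eab; rewrite no_slot => <-; rewrite expr0n mulr0.
Qed.

Hypothesis x_inj : injective x.

Lemma edge_ends e p q p' q' :
  val e = [set x p; x q]%SET -> val e = [set x p'; x q']%SET ->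
  (p, q) = (p', q') \/ (p, q) = (q', p').
Proof.
move=> epq epq'; have pq : p != q.
  by have /= := valP e; rewrite epq cards2 eqSS eqb1 (inj_eq x_inj).
have : x p \in [set x p'; x q']%SET by rewrite -epq' epq !inE eqxx.
have : x q \in [set x p'; x q']%SET by rewrite -epq' epq !inE eqxx orbT.
rewrite !inE !(inj_eq x_inj) => /orP[]/eqP qE /orP[]/eqP pE; subst p q; auto;
  by rewrite eqxx in pq.
Qed.

Lemma card_edge_ends e :
  (#|[set pq | val e == [set x pq.1; x pq.2]%SET]%SET| <= 2)%N.
Proof.
have [[p q] /= /eqP epq|no_ends] :=
    pickP (fun pq => val e == [set x pq.1; x pq.2]%SET); last first.
  by rewrite (_ : finset _ = finset.set0) ?cards0 //; apply/setP => pq; rewrite !inE no_ends.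
apply: (@leq_trans #|[set (p, q); (q, p)]%SET|); last by rewrite cards2; case: (_ != _).
apply/subset_leq_card/fintype.subsetP => -[p' q']; rewrite !inE => /eqP epq'.
by case: (edge_ends epq' epq) => ->; rewrite eqxx ?orbT.
Qed.

Lemma close_energy_le Y :
  \sum_p \sum_(q | close p q) weight Y (x p) (x q) ^+ 2 <=
  2 * sqnorm (layered_graph Y).
Proof.
pose joined e pq : bool := close pq.1 pq.2 && (val e == [set x pq.1; x pq.2]%SET).
under eq_bigr do rewrite big_mkcond.
rewrite pair_bigA sqnormE mulr_sumr /=.
rewrite (eq_bigr (fun pq => \sum_e (joined e pq)%:R * Y e ^+ 2)) => [|pq _]; last first.
  rewrite /joined; case: (close _ _); first exact: sqr_weight.
  by rewrite big1 // => e _; rewrite mul0r.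
rewrite exchange_big; apply: ler_sum => e _ /=.
rewrite -mulr_suml sumr_bool /layered_graph; case: ifPn => [_|not_layered].
  rewrite ler_wpM2r ?sqr_ge0 // ler_nat; apply: leq_trans (card_edge_ends e).
  by apply/subset_leq_card/fintype.subsetP => pq; rewrite !inE => /andP[].
rewrite (_ : finset _ = finset.set0) ?cards0 ?mul0r ?expr0n ?mulr0 //.
apply/setP => -[p q]; rewrite !inE; apply/negbTE; apply: contraNN not_layered.
by move=> /andP[pq /eqP epq]; apply/layered_slotP; exists p, q.
Qed.

Definition vertex_level a : nat :=
  if [pick p | x p == a] is Some p then level p else 0.

Lemma vertex_levelE p : vertex_level (x p) = level p.
Proof.
by rewrite /vertex_level; case: pickP => [q /eqP/x_inj->//|/(_ p)]; rewrite eqxx.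
Qed.

Lemma layered_slot_levels e a b : layered_slot e -> val e = [set a; b]%SET ->
  (vertex_level b <= (vertex_level a).+1)%N.
Proof.
move=> /layered_slotP[p [q [/andP[pq qp] epq]]] eab.
have : a \in [set x p; x q]%SET by rewrite -epq eab !inE eqxx.
have : b \in [set x p; x q]%SET by rewrite -epq eab !inE eqxx orbT.
by rewrite !inE => /orP[]/eqP-> /orP[]/eqP->; rewrite !vertex_levelE // ?leqnSn.
Qed.

Hypothesis L_gt0 : (0 < L)%N.

Lemma exists_layered_slot : exists e, layered_slot e.
Proof.
pose p0 := first_slot L r s; pose p1 : slot L r s := Some (inord 1, ord0, ord0).
have p01 : x p0 != x p1.
  rewrite (inj_eq x_inj); apply/eqP => -[] /(congr1 (fun i : 'I_L.+1 => i : nat)).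
  by rewrite /= inordK.
have [e ep] := exists_vpair p01; exists e.
by apply/layered_slotP; exists p0, p1; rewrite /close /= inordK.
Qed.

Variable e0 : vpair n.
Hypothesis e0_ends : val e0 = [set x (first_slot L r s); x None]%SET.

Lemma long_edge_not_layered : layered_slot e0 = false.
Proof.
apply/negbTE/negP => /layered_slotP[p [q [pq epq]]].
by case: (edge_ends epq e0_ends) pq => -[-> ->];
  rewrite /close /= ltnS [(L <= 0)%N]leqNgt L_gt0 ?andbF.
Qed.

Lemma layered_graph_long_edge w : layered_graph w e0 = 0.
Proof. by rewrite /layered_graph long_edge_not_layered. Qed.

Definition closed_graph w : vpair n -> R := [eta layered_graph w with e0 |-> 1].

Lemma closed_graphE w : closed_graph w = fun e => layered_graph w e + unit_vec R e0 e.
Proof.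
apply/funext => e; rewrite /closed_graph /= /unit_vec.
by case: eqP => [->|_]; rewrite ?layered_graph_long_edge ?add0r ?addr0.
Qed.

Lemma layered_graph_within w (lo hi : R) :
  {in layered_slots, forall e, lo <= w e <= hi} ->
  edges_within lo hi (layered_graph w).
Proof.
move=> wlh e; rewrite /is_edge /layered_graph; case: ifPn => [ee _|_].
  by apply: wlh; rewrite mem_layered_slots.
by rewrite eqxx.
Qed.

Lemma closed_graph_within w (lo hi : R) :
  {in layered_slots, forall e, lo <= w e <= hi} -> lo <= 1 <= hi ->
  edges_within lo hi (closed_graph w).
Proof.
move=> wlh lh1 e; rewrite /is_edge /closed_graph /=; case: ifP => // _.
exact: layered_graph_within wlh e.
Qed.

Lemma closed_graph_levels w a b : adj (closed_graph w) a b ->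
  [set a; b]%SET != [set x (first_slot L r s); x None]%SET ->
  (vertex_level b <= (vertex_level a).+1)%N.
Proof.
move=> /adjP[e eab]; rewrite /is_edge /closed_graph -eab -e0_ends (inj_eq val_inj) /=.
move=> + /negPf ne; rewrite ne /layered_graph; case: ifPn => [ee _|_]; last by rewrite eqxx.
exact: layered_slot_levels ee eab.
Qed.

End LayeredGraph.

(** * The two errors of a sketch on a placement *)

Lemma prod_ge_sqnorm (R : realType) (E : finType) (es : seq E) (k : R) (z : E -> R) :
  uniq es -> 0 <= k -> (forall e, k * z e ^+ 2 <= 1) ->
  1 - k * sqnorm z <= \prod_(e <- es) (1 - k * z e ^+ 2).
Proof.
move=> es_uniq k0 z_small; apply: le_trans (weierstrass_product _ _); last first.
  by move=> e; rewrite z_small andbT mulr_ge0 ?sqr_ge0.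
rewrite lerD2l lerN2 -mulr_sumr ler_wpM2l // big_uniq //= big_mkcond sqnormE.
apply: ler_sum => e _.
by case: ifP => // _; exact: sqr_ge0.
Qed.

Lemma sqr_le_sqrtrD (R : rcfType) (c p q : R) :
  0 <= c -> 0 <= p -> 0 <= q -> c <= Num.sqrt p + Num.sqrt q -> c ^+ 2 <= 2 * (p + q).
Proof.
move=> c0 p0 q0 c_le; rewrite -(sqr_sqrtr p0) -(sqr_sqrtr q0).
have := sqr_ge0 (Num.sqrt p - Num.sqrt q).
have : c ^+ 2 <= (Num.sqrt p + Num.sqrt q) ^+ 2.
  by rewrite lerXn2r ?nnegrE ?addr_ge0 ?sqrtr_ge0.
by lra.
Qed.

Section SketchErrors.
Variables (R : realType) (n N : nat) (S : linear_sketch R n N).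

Lemma measurements_dot (om : sk_space S) w :
  measurements om w = [tuple dot (sk_mx om l) w | l < N].
Proof. by []. Qed.

Section Measurability.
Variables (d : measure_display) (T : measurableType d).
Variables (phi : T -> sk_space S) (y : T -> vpair n -> R).
Hypothesis mphi : measurable_fun setT phi.
Hypothesis my : forall e, measurable_fun setT (y^~ e).

Lemma measurable_output e : measurable_fun setT (fun t => output (phi t) (y t) e).
Proof.
apply: (measurableT_comp (@sk_recover_measurable R n N S e)
  (g := fun t => (phi t, measurements (phi t) (y t)))).
apply: measurable_fun_pair => //.
apply/measurable_fun_tnthP => l.
rewrite (_ : _ \o _ = fun t => \sum_e' sk_mx (phi t) l e' * y t e'); last first.
  by apply/funext => t /=; rewrite tnth_mktuple.
apply: measurable_sum => e'; apply: measurable_funM => //.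
exact: (measurableT_comp (@sk_mx_measurable R n N S l e') mphi).
Qed.

Lemma measurable_output_edge e :
  measurable_fun setT (fun t => is_edge (output (phi t) (y t)) e).
Proof.
apply: measurable_neg; apply: measurable_fun_eqr; first exact: measurable_output.
exact: measurable_cst.
Qed.

End Measurability.

Lemma measurable_natr (d : measure_display) (T : measurableType d) (b : T -> bool) :
  measurable_fun setT b -> measurable_fun setT (fun t => (b t)%:R : R).
Proof.
move=> mb; rewrite (_ : (fun t => _) = fun t => if b t then 1 else 0).
  by apply: measurable_fun_ifT => //; exact: measurable_cst.
by apply/funext => t; case: (b t).
Qed.

Lemma integral_error_le (delta C t : R) w (err : sk_space S -> bool) :
  computes_spanner C delta t S -> nonneg w -> ratio_le C w ->
  measurable_fun setT err ->
  (forall om, spanner t w (output om w) -> ~~ err om) ->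
  (\int[sk_prob S]_om ((err om)%:R)%:E <= delta%:E)%E.
Proof.
move=> Sw w0 wC merr err_spanner; pose A := [set om : sk_space S | spanner t w (output om w)].
have mA : measurable A.
  by apply: measurable_spanner => e; apply: (measurable_output (phi := id) (y := fun=> w)).
have merr_set : measurable [set om | err om].
  by rewrite -[X in measurable X]setTI; exact: (merr measurableT [set true]).
rewrite (eq_integral (fun om => (\1_[set om | err om] om)%:E)) => [|om _]; last first.
  by rewrite indicE mem_setE /in_mem /=.
rewrite integral_indic // setIT; apply: le_trans (_ : sk_prob S (~` A) <= _)%E.
  apply: le_measure; rewrite ?inE //; first exact: measurableC.
  by move=> om om_err /err_spanner; rewrite om_err.
rewrite probability_setC // leeBlDr; last exact: fin_num_measure.
by rewrite -leeBlDl // -EFinB; exact: Sw.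
Qed.

Variables (L r s : nat) (x : slot L r s -> 'I_n) (e0 : vpair n).

Definition false_alarm (om : sk_space S) w : R :=
  (is_edge (output om (layered_graph x w)) e0)%:R.

Definition missed_edge (om : sk_space S) w : R :=
  (~~ is_edge (output om (closed_graph x e0 w)) e0)%:R.

Lemma jointly_measurable_false_alarm : jointly_measurable false_alarm.
Proof.
move=> d T phi y mphi my; apply: measurable_natr.
apply: measurable_output_edge => // e.
by rewrite /layered_graph; case: layered_slot => //; exact: measurable_cst.
Qed.

Lemma jointly_measurable_missed_edge : jointly_measurable missed_edge.
Proof.
move=> d T phi y mphi my; apply: measurable_natr.
apply: measurable_neg; apply: measurable_output_edge => // e.
rewrite /closed_graph /= /layered_graph; case: (e == e0); first exact: measurable_cst.
by case: layered_slot => //; exact: measurable_cst.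
Qed.

Lemma unit_valued_false_alarm om : unit_valued (false_alarm om).
Proof. by move=> w; rewrite /false_alarm; case: is_edge; rewrite /= ?ler01 ?lexx. Qed.

Lemma unit_valued_missed_edge om : unit_valued (missed_edge om).
Proof. by move=> w; rewrite /missed_edge; case: is_edge; rewrite /= ?ler01 ?lexx. Qed.

Hypothesis x_inj : injective x.
Hypothesis e0_ends : val e0 = [set x (first_slot L r s); x None]%SET.
Hypothesis L_gt0 : (0 < L)%N.

Section ErrorProbabilities.
Variables (t delta : R).
Hypothesis S_spanner : computes_spanner 2 delta t S.
Hypothesis t_ge0 : 0 <= t.
Hypothesis t_lt : t < L.+1%:R.
Variable w : vpair n -> R.
Hypothesis w_within : {in layered_slots x, forall e, 1 <= w e <= 2}.

Lemma integral_false_alarm_le :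
  (\int[sk_prob S]_om (false_alarm om w)%:E <= delta%:E)%E.
Proof.
have w12 := layered_graph_within w_within.
apply: (integral_error_le S_spanner (nonneg_edges_within ler01 w12)).
- have [e ee] := exists_layered_slot x_inj L_gt0.
  rewrite -[2]divr1; apply: ratio_le_edges_within w12 _ => //.
  exists e; rewrite /is_edge /layered_graph ee.
  have /andP[we _] : 1 <= w e <= 2 by apply: w_within; rewrite mem_layered_slots.
  by rewrite gt_eqF // (lt_le_trans ltr01).
- by apply: (measurable_output_edge (phi := id) (y := fun=> _)).
move=> om [_ sub _]; apply: contraTN (eqxx (0 : R)) => /sub.
by rewrite /is_edge layered_graph_long_edge.
Qed.

Lemma integral_missed_edge_le :
  (\int[sk_prob S]_om (missed_edge om w)%:E <= delta%:E)%E.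
Proof.
have w12 : edges_within 1 2 (closed_graph x e0 w).
  by apply: closed_graph_within w_within _; lra.
have e0_weight : closed_graph x e0 w e0 = 1 by rewrite /closed_graph /= eqxx.
apply: (integral_error_le S_spanner (nonneg_edges_within ler01 w12)).
- rewrite -[2]divr1; apply: ratio_le_edges_within w12 _ => //; exists e0.
  by rewrite /is_edge e0_weight oner_neq0.
- by apply: measurable_neg; apply: (measurable_output_edge (phi := id) (y := fun=> _)).
move=> om om_spanner; rewrite negbK.
apply: (spanner_keeps_edge (lev := vertex_level x) om_spanner) e0_ends _ _ _ => //.
- by move=> e /w12/andP[].
- by move=> a b; exact: closed_graph_levels.
- by rewrite !vertex_levelE // subn0.
Qed.

End ErrorProbabilities.

Lemma measurements_indistinguishable (om : sk_space S) (w w' z : vpair n -> R) :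
  (forall l, dot (layered_graph x (sk_mx om l)) z = sk_mx om l e0) ->
  (forall e, w' e = w e - z e) ->
  measurements om (layered_graph x w) = measurements om (closed_graph x e0 w').
Proof.
move=> z_e0 w'E; rewrite !measurements_dot; congr [tuple _ | _ < _].
apply/funext => l; rewrite closed_graphE // dotDr dot_unitr -z_e0 /dot -big_split.
apply: eq_bigr => e _ /=; rewrite /layered_graph w'E.
by case: ifP => _; rewrite ?mulr0 ?mul0r ?addr0 //; ring.
Qed.

Lemma exists_translation (om : sk_space S) (C : R) : 0 <= C ->
  (forall y, lincomb (sk_mx om) y e0 ^+ 2 <=
     C * sqnorm (layered_graph x (lincomb (sk_mx om) y))) ->
  exists z : vpair n -> R,
    [/\ forall l, dot (layered_graph x (sk_mx om l)) z = sk_mx om l e0,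
        {in [predC layered_slots x], z =1 fun=> 0} & sqnorm z <= C].
Proof.
move=> C0 energy; pose F l := layered_graph x (sk_mx om l).
have [y|z [c z_span] [z_e0 z_C]] := riesz_span (g := F) (phi := sk_mx om ^~ e0) _ C0.
  by rewrite lincomb_layered; exact: energy.
exists z; split=> // e; rewrite inE /= mem_layered_slots => /negPf not_layered.
by rewrite z_span lincomb_layered /layered_graph not_layered.
Qed.

(* A translation trades the measurements of the layered graph for those of the
   closed graph while displacing the random weights by little. *)
Lemma mean_errors_ge (k : R) (g : R -> R) (om : sk_space S) (C : R) :
  sqrt_density k g -> 0 <= k -> 0 <= C -> k * C <= 1 / 2 ->
  (forall y, lincomb (sk_mx om) y e0 ^+ 2 <=
     C * sqnorm (layered_graph x (lincomb (sk_mx om) y))) ->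
  1 / 8 <= iterated_mean g (layered_slots x) (false_alarm om) (fun=> 0) +
    iterated_mean g (layered_slots x) (missed_edge om) (fun=> 0).
Proof.
move=> g_density k0 C0 kC /(exists_translation C0)[z [z_e0 z_layered z_C]].
have kz_small : k * sqnorm z <= 1 / 2 by have := ler_wpM2l k0 z_C; lra.
have z_small e : k * z e ^+ 2 <= 1.
  by have := ler_wpM2l k0 (sqr_le_sqnorm z e); lra.
have error_forced (w w' : vpair n -> R) : (forall e, w' e = w e - z e) ->
    1 <= Num.sqrt (false_alarm om w) + Num.sqrt (missed_edge om w').
  move=> w'E; rewrite /false_alarm /missed_edge /output.
  rewrite (measurements_indistinguishable z_e0 w'E).
  by case: is_edge; rewrite /= sqrtr0 sqrtr1 ?add0r ?addr0.
have m_alarm := jointly_measurable_false_alarm.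
have m_missed := jointly_measurable_missed_edge.
have u_alarm := unit_valued_false_alarm; have u_missed := unit_valued_missed_edge.
have off : {in [predC layered_slots x], forall e, (0 : R) = 0 - z e}.
  by move=> e /z_layered->; rewrite subr0.
have := iterated_mean_hellinger g_density m_alarm m_missed u_alarm u_missed
  ler01 z_small error_forced off.
have /andP[+ _] := unit_valued_mean g_density (layered_slots x) om m_alarm u_alarm (fun=> 0).
have /andP[+ _] := unit_valued_mean g_density (layered_slots x) om m_missed u_missed (fun=> 0).
set q := iterated_mean _ _ _ _; set p := iterated_mean _ _ _ _ => q0 p0.
have : 1 - k * sqnorm z <= \prod_(e <- layered_slots x) (1 - k * z e ^+ 2).
  by apply: prod_ge_sqnorm => //; rewrite filter_uniq ?enum_uniq.
move=> prod_ge; rewrite [1 * \prod_(_ <- _) _]mul1r => /(le_trans prod_ge) sqrt_ge.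
have half_le : 1 / 2 <= Num.sqrt p + Num.sqrt q by apply: le_trans sqrt_ge; lra.
by have := sqr_le_sqrtrD _ p0 q0 half_le; lra.
Qed.

End SketchErrors.

(** * The impossibility argument *)

Section IncidenceRows.
Variables (R : realType) (n N : nat) (Phi : 'I_N -> vpair n -> R) (owner : 'I_N -> 'I_n).
Hypothesis owner_incident : forall l e, Phi l e != 0 -> owner l \in val e.

Definition vertex_rows a l b : R := if owner l == a then weight (Phi l) a b else 0.

Lemma vertex_rows_hollow : hollow vertex_rows.
Proof. by move=> a l; rewrite /vertex_rows weight_diag; case: ifP. Qed.

Lemma sum_num_nonzero_vertex_rows : (\sum_a num_nonzero (vertex_rows a) <= N)%N.
Proof.
rewrite -[leqRHS]card_ord; apply: (sum_num_nonzero_owned (owner := owner)) => a l b.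
by rewrite /vertex_rows; case: ifP => [/eqP//|]; rewrite eqxx.
Qed.

Lemma vertex_rowsD a l b : vertex_rows a l b + vertex_rows b l a = weight (Phi l) a b.
Proof.
rewrite /vertex_rows [weight _ b a]weightC.
have [->|ab] := eqVneq a b; first by rewrite weight_diag; case: ifP; rewrite addr0.
have [->|[e eab ->]] := weight_cases R a b; first by do 2!case: ifP => _; rewrite addr0.
have [->|le0] := eqVneq (Phi l e) 0; first by do 2!case: ifP => _; rewrite addr0.
have := owner_incident le0; rewrite eab !inE => /orP[]/eqP->; rewrite eqxx.
  by rewrite (negPf ab) addr0.
by rewrite eq_sym (negPf ab) add0r.
Qed.

Lemma symm_vertex_rows y a b :
  symm (fun a => lincomb (vertex_rows a) y) a b = weight (lincomb Phi y) a b.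
Proof.
rewrite weight_lincomb /symm /lincomb -big_split; apply: eq_bigr => l _ /=.
by rewrite -mulrDr vertex_rowsD.
Qed.

End IncidenceRows.

Lemma avg_integral_le (R : realType) (T : finType) (d : measure_display)
    (Om : measurableType d) (P : probability Om R) (F : T -> Om -> R) (lo hi : R) :
  (0 < #|T|)%N -> (forall t, measurable_fun setT (F t)) -> (forall t om, 0 <= F t om) ->
  0 <= lo -> (forall om, lo <= avg (F^~ om)) ->
  (forall t, (\int[P]_om (F t om)%:E <= hi%:E)%E) -> lo <= hi.
Proof.
move=> T0 mF F0 lo0 lo_le le_hi; pose m : R := #|T|%:R.
have m0 : 0 < m by rewrite ltr0n.
have mFE t : measurable_fun setT (EFin \o F t) by exact/measurable_EFinP.
rewrite -(ler_pM2l m0) -lee_fin.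
have -> : ((m * lo)%:E = \int[P]_om (m * lo)%:E)%E.
  have := integral_cst P (@measurableT _ Om) (m * lo)%:E.
  by move=> ->; rewrite [X in (_ * X)%E]probability_setT mule1.
apply: (@le_trans _ _ (\int[P]_om (\sum_t (F t om)%:E))%E).
  apply: ge0_le_integral => //.
  - by move=> om _; rewrite lee_fin mulr_ge0 // ltW.
  - exact: emeasurable_sum.
  - move=> om _; rewrite sumEFin lee_fin -ler_pdivlMl //; exact: lo_le.
rewrite ge0_integral_sum //; last by move=> t om _; rewrite lee_fin.
apply: le_trans (lee_sum _ (fun t _ => le_hi t)) _.
by rewrite sumEFin lee_fin sumr_const -mulr_natl.
Qed.

Section Impossibility.
Variables (R : realType) (n N : nat) (S : linear_sketch R n N) (t : R).
Variables (K kappa tau1 tau2 : R) (L r s : nat) (emb : slot L r s -> 'I_n).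
Hypothesis S_incidence : incidence S.
Hypothesis S_spanner : computes_spanner 2 (1 / 40) t S.
Hypothesis t_ge0 : 0 <= t.
Hypothesis t_lt : t < L.+1%:R.
Hypothesis K_ge1 : 1 <= K.
Hypothesis kappa_gt0 : 0 < kappa.
Hypothesis tau1_gt0 : 0 < tau1.
Hypothesis tau2_gt0 : 0 < tau2.
Hypothesis L_gt0 : (0 < L)%N.
Hypothesis emb_inj : injective emb.
Hypothesis n_large : (2 * (s.+1 * (r + 3) + 2) ^ 2 <= n)%N.
Notation eta := (4 * K / s.+1%:R).
Hypothesis eta_small : 16 * eta <= 1.
Hypothesis failure_small : few_rows_failure 'I_n N K kappa tau1 tau2 L r s <= 1 / 2.
Hypothesis transport_small : 32 * (4 * transport_const eta tau1 tau2 L) <= 1 / 2.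

Variables (g : R -> R) (long_edge : {perm 'I_n} -> vpair n).
Hypothesis g_density : sqrt_density 32 g.
Notation place sg := (placement emb sg).
Hypothesis long_edge_ends : forall sg,
  val (long_edge sg) = [set place sg (first_slot L r s); place sg None]%SET.

Definition mean_false_alarm sg (om : sk_space S) : R :=
  iterated_mean g (layered_slots (place sg)) (false_alarm (place sg) (long_edge sg) om) (fun=> 0).

Definition mean_missed_edge sg (om : sk_space S) : R :=
  iterated_mean g (layered_slots (place sg)) (missed_edge (place sg) (long_edge sg) om) (fun=> 0).

Let place_inj sg : injective (place sg).
Proof. by move=> p q /perm_inj/emb_inj. Qed.

Let measurable_alarm sg :
  jointly_measurable (@false_alarm _ _ _ S _ _ _ (place sg) (long_edge sg)).
Proof. exact: jointly_measurable_false_alarm. Qed.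

Let measurable_missed sg :
  jointly_measurable (@missed_edge _ _ _ S _ _ _ (place sg) (long_edge sg)).
Proof. exact: jointly_measurable_missed_edge. Qed.

Let alarm01 sg om : unit_valued (@false_alarm _ _ _ S _ _ _ (place sg) (long_edge sg) om).
Proof. exact: unit_valued_false_alarm. Qed.

Let missed01 sg om : unit_valued (@missed_edge _ _ _ S _ _ _ (place sg) (long_edge sg) om).
Proof. exact: unit_valued_missed_edge. Qed.

Lemma mean_false_alarm_ge0 sg om : 0 <= mean_false_alarm sg om.
Proof.
by have /andP[] := unit_valued_mean g_density (layered_slots (place sg)) om
  (@measurable_alarm sg) (alarm01 sg) (fun=> 0).
Qed.

Lemma mean_missed_edge_ge0 sg om : 0 <= mean_missed_edge sg om.
Proof.
by have /andP[] := unit_valued_mean g_density (layered_slots (place sg)) om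
  (@measurable_missed sg) (missed01 sg) (fun=> 0).
Qed.

Lemma measurable_mean_false_alarm sg : measurable_fun setT (mean_false_alarm sg).
Proof.
exact: (jointly_measurable_at (fun=> 0) (jointly_measurable_mean g_density _
  (@measurable_alarm sg) (alarm01 sg))).
Qed.

Lemma measurable_mean_missed_edge sg : measurable_fun setT (mean_missed_edge sg).
Proof.
exact: (jointly_measurable_at (fun=> 0) (jointly_measurable_mean g_density _
  (@measurable_missed sg) (missed01 sg))).
Qed.

Lemma integral_mean_errors_le sg :
  (\int[sk_prob S]_om (mean_false_alarm sg om + mean_missed_edge sg om)%:E <= (1 / 20)%:E)%E.
Proof.
have delta_ge0 : (0 : R) <= 1 / 40 by lra.
have alarm_le : (\int[sk_prob S]_om (mean_false_alarm sg om)%:E <= (1 / 40)%:E)%E.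
  apply: (integral_iterated_mean_le g_density (@measurable_alarm sg) (alarm01 sg)) => //.
  move=> w w12 _.
  exact: (integral_false_alarm_le (@place_inj sg) (long_edge_ends sg) L_gt0 S_spanner w12).
have missed_le : (\int[sk_prob S]_om (mean_missed_edge sg om)%:E <= (1 / 40)%:E)%E.
  apply: (integral_iterated_mean_le g_density (@measurable_missed sg) (missed01 sg)) => //.
  move=> w w12 _.
  exact: (integral_missed_edge_le (@place_inj sg) (long_edge_ends sg) S_spanner t_ge0 t_lt w12).
under eq_integral do rewrite EFinD.
rewrite ge0_integralD //; first last.
- exact/measurable_EFinP/measurable_mean_missed_edge.
- by move=> om _; rewrite lee_fin mean_missed_edge_ge0.
- exact/measurable_EFinP/measurable_mean_false_alarm.
- by move=> om _; rewrite lee_fin mean_false_alarm_ge0.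
by apply: le_trans (leeD alarm_le missed_le) _; rewrite -EFinD lee_fin; lra.
Qed.

Let n_gt0 : (0 < #|'I_n|)%N.
Proof. by rewrite card_ord; apply: leq_trans n_large; rewrite muln_gt0 expn_gt0 addn2. Qed.

Lemma avg_mean_errors_ge om :
  1 / 16 <= avg (fun sg => mean_false_alarm sg om + mean_missed_edge sg om).
Proof.
have /choice[owner owner_incident] : forall l, exists v : 'I_n,
    forall e, sk_mx om l e != 0 -> v \in val e by exact: S_incidence.
have large : (2 * (s.+1 * (r + 3) + 2) ^ 2 <= #|'I_n|)%N by rewrite card_ord.
have [good [bad_rare good_transport]] := few_rows_transport (vertex_rows_hollow (sk_mx om) owner)
  (sum_num_nonzero_vertex_rows (sk_mx om) owner) K_ge1 n_gt0 kappa_gt0 tau1_gt0 tau2_gt0 L_gt0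
  emb_inj large eta_small.
have C0 : 0 <= transport_const eta tau1 tau2 L.
  apply: transport_const_ge0; [|exact: ltW|exact: ltW].
  by rewrite divr_ge0 // mulr_ge0 // (le_trans ler01).
have errors_good sg : good sg -> 1 / 8 <= mean_false_alarm sg om + mean_missed_edge sg om.
  move=> sg_good; apply: (mean_errors_ge (@place_inj sg) (long_edge_ends sg) L_gt0 g_density
    (C := 4 * transport_const eta tau1 tau2 L)) => // [|y]; first by rewrite mulr_ge0.
  have := good_transport sg sg_good y; rewrite symm_vertex_rows //.
  rewrite (weight_edge _ (long_edge_ends sg)) => /le_trans; apply.
  under eq_bigr do under eq_bigr do rewrite symm_vertex_rows //.
  have := ler_wpM2l C0 (close_energy_le (@place_inj sg) (lincomb (sk_mx om) y)).
  by rewrite /placement; lra.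
have avg_good : avg (fun sg => (good sg)%:R : R) + avg (fun sg => (~~ good sg)%:R) = 1.
  rewrite -avgD -[RHS](@avg_cst _ {perm 'I_n}); last by apply/card_gt0P; exists 1%g.
  by congr avg; apply/funext => sg; case: (good sg); rewrite ?addr0 ?add0r.
apply: (@le_trans _ _ (avg (fun sg => 1 / 8 * (good sg)%:R))).
  by rewrite avgZ; have := le_trans bad_rare failure_small; lra.
apply: ler_avg => sg; have [/errors_good|_] := boolP (good sg); rewrite ?mulr1 ?mulr0 //.
by rewrite addr_ge0 ?mean_false_alarm_ge0 ?mean_missed_edge_ge0.
Qed.

End Impossibility.

Lemma no_incidence_spanner_sketch (R : realType) (n N : nat) (S : linear_sketch R n N) (t : R)
    (K kappa tau1 tau2 : R) (L r s : nat) (emb : slot L r s -> 'I_n) :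
  incidence S -> 0 <= t -> t < L.+1%:R ->
  1 <= K -> 0 < kappa -> 0 < tau1 -> 0 < tau2 -> (0 < L)%N -> injective emb ->
  (2 * (s.+1 * (r + 3) + 2) ^ 2 <= n)%N -> 16 * (4 * K / s.+1%:R) <= 1 ->
  few_rows_failure 'I_n N K kappa tau1 tau2 L r s <= 1 / 2 ->
  32 * (4 * transport_const (4 * K / s.+1%:R) tau1 tau2 L) <= 1 / 2 ->
  ~ computes_spanner 2 (1 / 40) t S.
Proof.
move=> S_inc t0 tL K1 kappa0 tau10 tau20 L0 emb_inj n_large eta_small fail_small C_small S_spanner.
have [g g_density] := exists_sqrt_density R.
have /choice[long_edge ends] : forall sg : {perm 'I_n}, exists e : vpair n,
    val e = [set placement emb sg (first_slot L r s); placement emb sg None]%SET.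
  by move=> sg; apply: exists_vpair; rewrite /placement (inj_eq perm_inj) (inj_eq emb_inj).
pose errors sg (om : sk_space S) :=
  mean_false_alarm emb g long_edge sg om + mean_missed_edge emb g long_edge sg om.
have : 1 / 16 <= 1 / 20 :> R.
  apply: (@avg_integral_le _ {perm 'I_n} _ _ (sk_prob S) errors).
  - by apply/card_gt0P; exists 1%g.
  - move=> sg; apply: measurable_funD.
      exact: measurable_mean_false_alarm.
    exact: measurable_mean_missed_edge.
  - by move=> sg om; rewrite addr_ge0 ?mean_false_alarm_ge0 ?mean_missed_edge_ge0.
  - by lra.
  - exact: (avg_mean_errors_ge S_inc K1 kappa0 tau10 tau20 L0 emb_inj n_large eta_small
      fail_small C_small g_density ends).
  - exact: (integral_mean_errors_le S_spanner t0 tL L0 emb_inj g_density ends).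
by lra.
Qed.

(** * Choice of the scales *)

Lemma expRN_le (R : realType) (y : R) (m : nat) : 0 < y -> (0 < m)%N ->
  expR (- y) <= (m%:R / y) ^+ m.
Proof.
move=> y0 m0; have mR : 0 < m%:R :> R by rewrite ltr0n.
have expR_ge : (y / m%:R) ^+ m <= expR y.
  rewrite -[in leRHS](divfK (lt0r_neq0 mR) y) [X in expR X]mulrC expRM_natl.
  have ym : y / m%:R <= expR (y / m%:R) by apply: le_trans (expR_ge1Dx _); rewrite lerDr.
  by rewrite lerXn2r ?nnegrE ?expR_ge0 // divr_ge0 // ltW.
rewrite expRN -[m%:R / y]invrK invf_div exprVn lef_pV2 ?posrE ?expR_gt0 //.
by rewrite exprn_gt0 // divr_gt0.
Qed.

Lemma exists_inj_ord (T : finType) (n : nat) : (#|T| <= n)%N ->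
  exists f : T -> 'I_n, injective f.
Proof.
move=> Tn; exists (fun t => widen_ord Tn (enum_rank t)) => t t' /(congr1 val) /= tt'.
by apply: enum_rank_inj; exact: val_inj.
Qed.

Definition failure_coef (R : realType) (tau1 tau2 : R) (r : nat) : R :=
  2 * (1 + r.+1%:R + 4 + 1 + r.+1%:R * 2 ^+ r.+1 + 2 * r.+1%:R ^+ 2 / tau1 + r.+1%:R / tau2).

Lemma failure_coef_gt0 (R : realType) (tau1 tau2 : R) r :
  0 < tau1 -> 0 < tau2 -> 0 < failure_coef tau1 tau2 r.
Proof.
move=> tau10 tau20; rewrite mulr_gt0 // -3!addrA ltr_pwDl //.
by rewrite !addr_ge0 ?divr_ge0 ?mulr_ge0 ?exprn_ge0 // ltW.
Qed.

Lemma failure_bound_le (R : realType) (theta er D m kappa tau1 tau2 q : R) (L r : nat) :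
  0 < kappa -> kappa <= 1 -> 0 < tau1 -> 0 < tau2 ->
  theta <= q -> L.+1%:R * er <= q -> D <= q * kappa ^+ 2 -> kappa <= q ->
  L%:R * kappa ^+ r.+1 <= q -> L%:R * (D / m) <= q ->
  failure_bound theta er D m kappa tau1 tau2 L r <= failure_coef tau1 tau2 r * q.
Proof.
move=> kappa0 kappa1 tau10 tau20 theta_le er_le D_le kappa_le power_le step_le.
have q0 : 0 <= q by exact: le_trans (ltW kappa0) kappa_le.
have D_le_q : D <= q by apply: le_trans D_le _; rewrite ler_piMr // exprn_ile1 // ltW.
rewrite /failure_bound /failure_coef -[leRHS]mulrA ler_wpM2l // 6![in leRHS]mulrDl !mul1r.
apply: lerD; last first.
  by rewrite [leRHS]mulrAC ler_wpM2r ?invr_ge0 ?(ltW tau20) // ler_wpM2l.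
apply: lerD; last first.
  rewrite [leRHS]mulrAC ler_wpM2r ?invr_ge0 ?(ltW tau10) //.
  rewrite (_ : _ * _ * _ = 2 * r.+1%:R ^+ 2 * (L%:R * (D / m))); last by ring.
  by rewrite ler_wpM2l // mulr_ge0 // exprn_ge0.
apply: lerD; last first.
  rewrite exprMn (_ : _ * _ * _ = r.+1%:R * 2 ^+ r.+1 * (L%:R * kappa ^+ r.+1)); last by ring.
  by rewrite ler_wpM2l // mulr_ge0 // exprn_ge0.
apply: lerD => //; apply: lerD; last by rewrite ler_pdivrMr ?exprn_gt0 // -mulrA ler_wpM2l.
by apply: lerD => //; rewrite mulrAC mulrC ler_wpM2l.
Qed.

Lemma powRX (R : realType) (x u : R) k : (x `^ u) ^+ k = x `^ (u * k%:R).
Proof. by rewrite powRrM powR_mulrn // powR_ge0. Qed.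

Lemma powR_ge1 (R : realType) (x u : R) : 1 <= x -> 0 <= u -> 1 <= x `^ u.
Proof. by move=> x1 u0; rewrite -(powRr0 x) ler_powR. Qed.

Definition slack_coef (R : realType) (m : nat) : R := 768 + 4 * (512 * m%:R) ^+ m.

Lemma slack_coef_gt0 (R : realType) (m : nat) : 0 < slack_coef R m.
Proof.
apply: ltr_pwDl; first by rewrite ltr0n.
by apply/mulr_ge0/exprn_ge0/mulr_ge0; exact: ler0n.
Qed.

Section Scales.
Variables (R : realType) (alpha e : R) (n : nat).
Hypothesis alpha_range : 0 < alpha < 1 / 10.
Hypothesis e_range : 0 < e < alpha.
Hypothesis n_gt0 : (0 < n)%N.
Notation pow u := (n%:R `^ u : R).

Definition slack : R := pow (- (e / 4)).
Definition stretch : R := pow (2 / 3 * (1 - alpha)).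
Definition row_bound : R := pow (alpha - e / 2).
Definition block_size : R := pow (1 - 2 / 3 * (1 - alpha) - e / 4).
Definition threshold : R := pow (- (1 / 20)).

Let n_ge1 : 1 <= n%:R :> R. Proof. by rewrite ler1n. Qed.
Let n_R_gt0 : 0 < n%:R :> R. Proof. by rewrite ltr0n. Qed.

Let powD u v : pow u * pow v = pow (u + v).
Proof. by rewrite powRD // (gt_eqF n_R_gt0) implybT. Qed.

Let pow1 : n%:R = pow 1.
Proof. by rewrite powRr1 // ltW. Qed.

Let ranges : [/\ 0 < alpha, alpha < 1 / 10, 0 < e & e < alpha].
Proof. by have [[? ?] [? ?]] := (andP alpha_range, andP e_range). Qed.

Lemma stretch_ge1 : 1 <= stretch.
Proof. by have /andP[? ?] := alpha_range; apply: powR_ge1 => //; lra. Qed.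

Lemma row_bound_ge1 : 1 <= row_bound.
Proof. by have [? ? ? ?] := ranges; apply: powR_ge1 => //; lra. Qed.

Lemma block_size_ge1 : 1 <= block_size.
Proof. by have [? ? ? ?] := ranges; apply: powR_ge1 => //; lra. Qed.

Lemma block_sizeV : block_size^-1 = pow (- (1 - 2 / 3 * (1 - alpha) - e / 4)).
Proof. by rewrite [RHS]powRN. Qed.

Lemma threshold_le_slack : threshold <= slack.
Proof. by have [? ? ? ?] := ranges; apply: (ler_powR n_ge1); lra. Qed.

Lemma threshold_le1 : threshold <= 1.
Proof. by rewrite -(powRr0 n%:R); apply: (ler_powR n_ge1); lra. Qed.

Lemma slots_le : block_size * stretch <= slack * n%:R.
Proof. by rewrite pow1 !powD; apply: (ler_powR n_ge1); lra. Qed.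

Lemma sqr_block_size_le : block_size ^+ 2 <= slack * n%:R.
Proof.
have [? ? ? ?] := ranges.
by rewrite pow1 powRX powD; apply: (ler_powR n_ge1); lra.
Qed.

Lemma row_ratio_le : row_bound / block_size <= slack.
Proof.
have [? ? ? ?] := ranges.
by rewrite block_sizeV powD; apply: (ler_powR n_ge1); lra.
Qed.

Lemma block_defect_le : row_bound ^+ 2 / block_size <= slack * threshold ^+ 2.
Proof.
have [? ? ? ?] := ranges.
by rewrite block_sizeV !powRX !powD; apply: (ler_powR n_ge1); lra.
Qed.

Lemma route_defect_le : stretch * row_bound ^+ 2 / block_size ^+ 2 <= slack.
Proof.
have [? ? ? ?] := ranges.
by rewrite -exprVn block_sizeV !powRX !powD; apply: (ler_powR n_ge1); lra.
Qed.

Lemma dead_end_le : stretch * threshold ^+ 20 <= slack.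
Proof.
have [? ? ? ?] := ranges.
by rewrite powRX powD; apply: (ler_powR n_ge1); lra.
Qed.

Lemma bad_pair_le (N : nat) : N%:R <= pow (1 + alpha - e) ->
  N%:R / (row_bound * n%:R) <= slack.
Proof.
have [? ? ? ?] := ranges => N_le.
rewrite ler_pdivrMr ?mulr_gt0 ?powR_gt0 //; apply: le_trans N_le _.
by rewrite [X in _ * (_ * X)]pow1 !powD; apply: (ler_powR n_ge1); lra.
Qed.

(* The exponent of [n] in [block_size / row_bound ^ 4]. *)
Definition tail_exponent : R := 1 - 2 / 3 * (1 - alpha) - e / 4 - (alpha - e / 2) * 4.

Lemma tail_exponent_gt0 : 0 < tail_exponent.
Proof. by have [? ? ? ?] := ranges; rewrite /tail_exponent; lra. Qed.

Lemma tail_le (m : nat) : 4 <= tail_exponent * m%:R -> (0 < m)%N ->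
  n%:R ^+ 3 * expR (- (block_size / (512 * row_bound ^+ 4))) <= (512 * m%:R) ^+ m * slack.
Proof.
have [? ? ? ?] := ranges => m_ge m_gt0.
have y_gt0 : 0 < block_size / (512 * row_bound ^+ 4).
  apply: divr_gt0; first exact: powR_gt0.
  by apply: mulr_gt0; [rewrite ltr0n|rewrite exprn_gt0 ?powR_gt0].
apply: le_trans (ler_wpM2l (exprn_ge0 3 (ltW n_R_gt0)) (expRN_le y_gt0 m_gt0)) _.
rewrite (_ : m%:R / _ = 512 * m%:R * pow (- tail_exponent)); last first.
  rewrite (_ : pow _ = row_bound ^+ 4 / block_size); first by rewrite invf_div; ring.
  by rewrite block_sizeV powRX powD; congr (_ `^ _); rewrite /tail_exponent; ring.
rewrite exprMn mulrCA; apply: ler_wpM2l; first by apply/exprn_ge0/mulr_ge0; exact: ler0n.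
by rewrite [X in X ^+ 3]pow1 !powRX powD; apply: (ler_powR n_ge1); lra.
Qed.

Definition num_levels : nat := Num.truncn stretch.
Definition block_card : nat := Num.truncn block_size.
Notation L := num_levels.
Notation s := block_card.
Notation eta := (4 * row_bound / s.+1%:R).

Let stretch_gt0 : 0 < stretch. Proof. exact: powR_gt0. Qed.
Let row_bound_gt0 : 0 < row_bound. Proof. exact: powR_gt0. Qed.
Let block_size_gt0 : 0 < block_size. Proof. exact: powR_gt0. Qed.
Let slack_gt0 : 0 < slack. Proof. exact: powR_gt0. Qed.

Lemma num_levels_gt0 : (0 < L)%N.
Proof. by rewrite truncn_gt0 stretch_ge1. Qed.

Lemma num_levels_le : L%:R <= stretch.
Proof. by rewrite truncn_le // ltW. Qed.

Lemma num_levelsS_le : L.+1%:R <= 2 * stretch.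
Proof. by rewrite -natr1; have := num_levels_le; have := stretch_ge1; lra. Qed.

Lemma block_size_lt : block_size < s.+1%:R.
Proof. exact: truncnS_gt. Qed.

Lemma block_cardS_le : s.+1%:R <= 2 * block_size.
Proof.
have : s%:R <= block_size by rewrite truncn_le // ltW.
by rewrite -natr1; have := block_size_ge1; lra.
Qed.

Lemma num_slots_le : slack <= 1 / 81 -> (1 + L.+1 * 20 * s.+1 <= n)%N.
Proof.
move=> slack_small; rewrite -(ler_nat R) natrD !natrM.
have : L.+1%:R * s.+1%:R <= 2 * stretch * (2 * block_size).
  by apply: ler_pM; [exact: ler0n|exact: ler0n|exact: num_levelsS_le|exact: block_cardS_le].
have := ler_pM ler01 ler01 block_size_ge1 stretch_ge1.
have := slots_le; have := ler_wpM2r (ltW n_R_gt0) slack_small.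
by rewrite mulrAC [_ * 20]mulrC; lra.
Qed.

Lemma block_card_sqr_le : slack <= 1 / 4608 -> (2 * (s.+1 * (19 + 3) + 2) ^ 2 <= n)%N.
Proof.
move=> slack_small; rewrite -(ler_nat R) natrM natrX natrD natrM.
have s_ge1 : 1 <= s.+1%:R :> R by rewrite ler1n.
have le_48 : s.+1%:R * (19 + 3)%:R + 2%:R <= 48 * block_size.
  by have := block_cardS_le; lra.
apply: (@le_trans _ _ (2 * (48 * block_size) ^+ 2)).
  apply: ler_wpM2l => //; rewrite lerXn2r ?nnegrE //; exact: le_trans le_48.
have := sqr_block_size_le; have := ler_wpM2r (ltW n_R_gt0) slack_small.
by rewrite exprMn; lra.
Qed.

Lemma row_ratioS_le : eta <= 4 * slack.
Proof.
rewrite -mulrA ler_wpM2l //; apply: le_trans row_ratio_le.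
by rewrite ler_wpM2l ?lef_pV2 ?posrE ?ltr0n ?ltW // block_size_lt.
Qed.

Lemma irregular_le (m : nat) : 4 <= tail_exponent * m%:R -> (0 < m)%N ->
  L.+1%:R * (2 * n%:R * row_bound ^+ 2 * expR (- (s.+1%:R / (512 * row_bound ^+ 4)))) <=
  4 * ((512 * m%:R) ^+ m * slack).
Proof.
move=> m_ge m_gt0; have [? ? ? ?] := ranges.
apply: le_trans (ler_wpM2l (ler0n R 4) (tail_le m_ge m_gt0)).
have levels_le : L.+1%:R <= 2 * n%:R :> R.
  apply: le_trans num_levelsS_le _; rewrite ler_wpM2l // pow1.
  by apply: (ler_powR n_ge1); lra.
have rows_le : row_bound ^+ 2 <= n%:R.
  by rewrite pow1 powRX; apply: (ler_powR n_ge1); lra.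
have D0 : 0 <= 512 * row_bound ^+ 4.
  by apply: mulr_ge0; [exact: ler0n|rewrite exprn_ge0 // ltW].
have tail_decr : expR (- (s.+1%:R / (512 * row_bound ^+ 4))) <=
    expR (- (block_size / (512 * row_bound ^+ 4))).
  rewrite ler_expR lerN2; apply: ler_wpM2r; last exact: ltW block_size_lt.
  by rewrite invr_ge0; exact: D0.
have tail_ge0 := expR_ge0 (- (s.+1%:R / (512 * row_bound ^+ 4))).
move: tail_decr tail_ge0; set E := expR (- (s.+1%:R / _)); set E' := expR _ => EE' E0.
clearbody E E'; rewrite (_ : 4 * _ = 2 * n%:R * (2 * n%:R * n%:R * E')); last by ring.
have n0 : 0 <= n%:R :> R by exact: ler0n.
have row0 := ltW row_bound_gt0; apply: ler_pM => //; first by rewrite !mulr_ge0.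
by apply: ler_pM => //; rewrite ?ler_wpM2l ?mulr_ge0.
Qed.

Lemma step_defect_le : 8 * eta ^+ 2 * (2 * s.+1 + 1)%:R <= 384 * (row_bound ^+ 2 / s.+1%:R).
Proof.
have s_ge1 : 1 <= s.+1%:R :> R by rewrite ler1n.
apply: (@le_trans _ _ (8 * eta ^+ 2 * (3 * s.+1%:R))).
  apply: ler_wpM2l; last by rewrite natrD natrM; lra.
  by apply: mulr_ge0 => //; exact: sqr_ge0.
by rewrite le_eqVlt; apply/orP; left; apply/eqP; field; rewrite gt_eqF // (lt_le_trans ltr01).
Qed.

Let card_inv_le : s.+1%:R^-1 <= block_size^-1.
Proof. by rewrite lef_pV2 ?posrE ?ltr0n // ltW // block_size_lt. Qed.

Lemma block_defect_card_le : row_bound ^+ 2 / s.+1%:R <= slack * threshold ^+ 2.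
Proof. by apply: le_trans block_defect_le; rewrite ler_wpM2l // sqr_ge0. Qed.

Lemma route_defect_card_le : L%:R * (row_bound ^+ 2 / s.+1%:R / s.+1%:R) <= slack.
Proof.
apply: le_trans route_defect_le; rewrite -[leRHS]mulrA; apply: ler_pM => //.
- by rewrite !mulr_ge0 ?invr_ge0 // ltW.
- exact: num_levels_le.
rewrite -mulrA ler_wpM2l ?sqr_ge0 // [in leRHS]expr2 invfM.
by apply: ler_pM => //; rewrite invr_ge0.
Qed.

Lemma few_rows_failure_le (N m : nat) (tau : R) : 0 < tau -> N%:R <= pow (1 + alpha - e) ->
  4 <= tail_exponent * m%:R -> (0 < m)%N ->
  few_rows_failure 'I_n N row_bound threshold tau tau L 19 s <=
  failure_coef tau tau 19 * (slack_coef R m * slack).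
Proof.
move=> tau0 N_le m_ge m_gt0; rewrite /few_rows_failure card_ord.
have Z0 : 0 <= (512 * m%:R) ^+ m :> R by apply/exprn_ge0/mulr_ge0; exact: ler0n.
have slack0 := slack_gt0; have Zq0 := mulr_ge0 Z0 (ltW slack_gt0).
have step_le := step_defect_le.
have s0 : 0 < s.+1%:R :> R by rewrite ltr0n.
have threshold2 : threshold ^+ 2 >= 0 by rewrite sqr_ge0.
rewrite (_ : slack_coef R m * _ = 768 * slack + 4 * ((512 * m%:R) ^+ m * slack)); last first.
  by rewrite /slack_coef; ring.
apply: failure_bound_le => //.
- exact: powR_gt0.
- exact: threshold_le1.
- by have := bad_pair_le N_le; lra.
- by have := irregular_le m_ge m_gt0; lra.
- apply: le_trans step_le (le_trans (ler_wpM2l (ler0n R 384) _) _).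
    exact: block_defect_card_le.
  by have := mulr_ge0 Zq0 threshold2; have := mulr_ge0 (ltW slack0) threshold2; lra.
- by have := threshold_le_slack; lra.
- apply: le_trans (ler_wpM2r _ num_levels_le) _; first by rewrite exprn_ge0 // powR_ge0.
  by have := dead_end_le; lra.
rewrite (_ : _ / (_ / 2) = 2 * (8 * eta ^+ 2 * (2 * s.+1 + 1)%:R / s.+1%:R)); last first.
  by field; rewrite gt_eqF.
apply: (@le_trans _ _ (768 * (L%:R * (row_bound ^+ 2 / s.+1%:R / s.+1%:R)))).
  rewrite (_ : 768 * _ = L%:R * (2 * (384 * (row_bound ^+ 2 / s.+1%:R) / s.+1%:R))); last by ring.
  by rewrite !ler_wpM2l // ler_wpM2r // invr_ge0.
by apply: le_trans (ler_wpM2l (ler0n R 768) route_defect_card_le) _; lra.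
Qed.

Lemma transport_const_le (tau : R) : 0 <= tau -> slack <= 1 / 1000 ^+ 2 -> tau <= 1 / 2000 ->
  32 * (4 * transport_const eta tau tau L) <= 1 / 2.
Proof.
move=> tau0 slack_small tau_small; rewrite /transport_const.
have eta2L : eta ^+ 2 * L%:R <= 16 * slack.
  apply: le_trans (ler_wpM2l (ler0n R 16) route_defect_card_le).
  by rewrite le_eqVlt; apply/orP; left; apply/eqP; field; rewrite gt_eqF ?ltr0n.
have := row_ratioS_le; move: eta2L; rewrite -[16 * eta ^+ 2 * _]mulrA.
by move: (eta) (eta ^+ 2 * _) => a b b_le a_le; lra.
Qed.

End Scales.

Lemma sketch_lower_bound (R : realType) (alpha e : R) : 0 < alpha < 1 / 10 -> 0 < e < alpha ->
  exists2 c : R, 0 < c & forall (n N : nat) (S : linear_sketch R n N) (t : R),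
    (0 < n)%N -> n%:R `^ (- (e / 4)) <= c ->
    0 <= t -> t <= n%:R `^ (2 / 3 * (1 - alpha)) ->
    incidence S -> computes_spanner 2 (1 / 40) t S ->
    n%:R `^ (1 + alpha - e) <= N%:R.
Proof.
move=> alpha_range e_range; pose rho := tail_exponent alpha e.
have rho0 : 0 < rho by exact: tail_exponent_gt0.
pose m := (Num.truncn (4 / rho)).+1.
have m_ge : 4 <= rho * m%:R by rewrite -ler_pdivrMl // mulrC ltW // truncnS_gt.
have [tau [tau0 tau_le]] : exists tau : R, 0 < tau /\ tau <= 1 / 2000.
  by exists (1 / 2000); split; [lra|exact: lexx].
pose A := failure_coef tau tau 19 * slack_coef R m.
have A0 : 0 < A := mulr_gt0 (failure_coef_gt0 19 tau0 tau0) (slack_coef_gt0 R m).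
have [z [z0 z_le]] : exists z : R, 0 < z /\ z <= 1 / 1000 ^+ 2.
  by exists (1 / 1000 ^+ 2); split; [lra|exact: lexx].
exists (Num.min z (1 / (2 * A))); first by rewrite lt_min z0 divr_gt0 // mulr_gt0.
move=> n N S t n0; rewrite -/(slack e n) le_min => /andP[/le_trans/(_ z_le) slack_small slack_A].
move=> t0 t_le S_inc S_spanner.
rewrite leNgt; apply/negP => N_lt.
have [emb emb_inj] : exists emb : slot (num_levels alpha n) 19 (block_card alpha e n) -> 'I_n,
    injective emb.
  apply: exists_inj_ord; rewrite card_option !card_prod !card_ord -add1n.
  by apply: (num_slots_le alpha_range e_range n0); apply: le_trans slack_small _; lra.
apply: (@no_incidence_spanner_sketch R n N S t (row_bound alpha e n) (threshold R n) tau tau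
  _ 19 _ emb S_inc t0) => //.
- by apply: le_lt_trans t_le _; exact: truncnS_gt.
- exact: row_bound_ge1.
- by apply: powR_gt0; rewrite ltr0n.
- exact: num_levels_gt0.
- by apply: (block_card_sqr_le alpha_range e_range n0); apply: le_trans slack_small _; lra.
- apply: le_trans (ler_wpM2l (ler0n R 16) (row_ratioS_le alpha_range e_range n0)) _.
  by move: slack_small; lra.
- apply: le_trans (few_rows_failure_le alpha_range e_range n0 tau0 (ltW N_lt) m_ge isT) _.
  rewrite mulrA -/A; have := ler_wpM2l (ltW A0) slack_A.
  by rewrite (_ : A * (1 / (2 * A)) = 1 / 2) //; field; rewrite gt_eqF.
- exact: transport_const_le (ltW tau0) slack_small tau_le.
Qed.

Lemma powRN_near (R : realType) (u c : R) : 0 < u -> 0 < c ->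
  \forall n \near \oo, n%:R `^ (- u) <= c.
Proof.
move=> u0 c0; near=> n.
have n_ge : c^-1 `^ u^-1 <= n%:R by near: n; exact: nbhs_infty_ger.
have cV0 : 0 < c^-1 by rewrite invr_gt0.
have := ge0_ler_powR (ltW u0) _ _ n_ge; rewrite !nnegrE powR_ge0 ler0n => /(_ isT isT).
rewrite -powRrM mulVf ?gt_eqF // powRr1 ?(ltW cV0) // => cV_le.
by rewrite powRN -[leRHS]invrK lef_pV2 ?posrE // (lt_le_trans cV0).
Unshelve. all: by end_near.
Qed.

Lemma exists_diagonal (R : realType) (a : R) (Q : nat -> R -> Prop) : 0 < a ->
  (\forall n \near \oo, forall e e', e <= e' -> Q n e -> Q n e') ->
  (forall e, 0 < e < a -> \forall n \near \oo, Q n e) ->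
  exists eps : nat -> R, eps n @[n --> \oo] --> (0 : R) /\ \forall n \near \oo, Q n (eps n).
Proof.
move=> a0 Q_mono Q_near; pose E n := [set e | 0 < e /\ Q n e].
have E_lb n : lbound (E n) 0 by move=> e [/ltW].
exists (fun n => inf (E n) + n.+1%:R^-1); split; last first.
  have a2 : 0 < a / 2 < a by apply/andP; split; lra.
  near=> n.
  have E_inf : has_inf (E n).
    split; last by exists 0; exact: E_lb.
    by exists (a / 2); split; [lra|near: n; exact: Q_near].
  have nV0 : 0 < n.+1%:R^-1 :> R by rewrite invr_gt0 ltr0n.
  have [e [_ Qe] /ltW e_le] := inf_adherent nV0 E_inf.
  have mono : forall e e', e <= e' -> Q n e -> Q n e' by near: n.
  exact: mono e_le Qe.
apply/cvgrPdist_lt => d d0.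
have [e [e0 e_lt e_le]] : exists e, [/\ 0 < e, e < a & e <= d / 2].
  exists (Num.min (d / 2) (a / 2)); rewrite lt_min gt_min !ge_min lexx.
  by split=> //; [apply/andP; split; lra|apply/orP; right; lra].
have d2 : 0 < d / 2 by lra.
near=> n.
have Qe : Q n e by near: n; apply: Q_near; rewrite e0.
have inf_ge0 : 0 <= inf (E n) by apply: lb_le_inf => //; exists e.
have inf_le : inf (E n) <= e by apply: ge_inf; [exists 0; exact: E_lb|].
have nV_lt : n.+1%:R^-1 < d / 2 by near: n; exact: (near_infty_natSinv_lt (PosNum d2)).
have nV0 : 0 < n.+1%:R^-1 :> R by rewrite invr_gt0 ltr0n.
rewrite sub0r normrN ger0_norm ?addr_ge0 ?(ltW nV0) //.
by rewrite [ltRHS]splitr ler_ltD // (le_trans inf_le).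
Unshelve. all: by end_near.
Qed.

Theorem theorem1p11 (R : realType) (alpha : R)
    (halpha : 0 < alpha < 1 / 10) :
  exists C delta : R, 1 <= C /\ 0 < delta < 1 /\
    forall t : nat -> R,
      (forall n, 1 <= t n) ->
      t n / n%:R `^ (2 / 3 * (1 - alpha)) @[n --> \oo] --> (0 : R) ->
      exists eps : nat -> R, eps n @[n --> \oo] --> (0 : R) /\
        \forall n \near \oo,
          forall (N : nat) (S : linear_sketch R n N),
            incidence S ->
            computes_spanner C delta (t n) S ->
            n%:R `^ (1 + alpha - eps n) <= N%:R.
Proof.
exists 2, (1 / 40); split; first by lra.
split=> [|t t_ge1 t_small]; first by apply/andP; split; lra.
pose Q n e := forall (N : nat) (S : linear_sketch R n N), incidence S ->
  computes_spanner 2 (1 / 40) (t n) S -> n%:R `^ (1 + alpha - e) <= N%:R.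
apply: (exists_diagonal (Q := Q) (proj1 (andP halpha))) => [|e e_range].
  near=> n => e e' ee' n_le N S S_inc S_spanner.
  have n0 : (0 < n)%N by near: n; exact: nbhs_infty_gt.
  by apply: le_trans (n_le N S S_inc S_spanner); rewrite ler_powR ?ler1n //; lra.
have [c c0 lower_bound] := sketch_lower_bound halpha e_range.
have e4 : 0 < e / 4 by case/andP: e_range; lra.
near=> n => N S; have n0 : (0 < n)%N by near: n; exact: nbhs_infty_gt.
apply: lower_bound => //; first by near: n; exact: powRN_near.
  exact: le_trans ler01 (t_ge1 n).
have : t n / n%:R `^ (2 / 3 * (1 - alpha)) < 1 by near: n; exact: cvgr_lt t_small _ ltr01.
by rewrite ltr_pdivrMr ?powR_gt0 ?ltr0n // mul1r => /ltW.
Unshelve. all: by end_near.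
Qed.
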